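(* Let $T'$ and $p$ be as defined in the context, let $\mathcal{C}'$ be any model of $T'$ and let $A\subseteq V^{\mathcal{C}'}$. Then $A$ is a set of indiscernibles and the principal types over $A$ are dense. Further, if $|A|\le\aleph_1$ then there is an atomic model of $T'(A)=\mathrm{Th}(\mathcal{C}',a)_{a\in A}$, while if $|A|>\aleph_1$ then every model of $T'(A)$ realizes the complete type $p$.
   Context: Let $L$ be the countable language consisting of unary predicate symbols $U,V$, a unary function symbol $p$, and for each $n\in\omega$ a binary function symbol $f_n$ and a binary relation symbol $R_n$; the function symbols may be interpreted as partial functions. For a subset $X$ of an $L$-structure $M$, $cl(X)$ is the transitive closure of $cl_0(X)=\{f_n(b,c):b,c\in X,\ n\in\omega\}$ (i.e., the closure under the functions $f_n$). Let $K$ be the class of all finite $L$-structures $\mathcal{A}$ (universe $A$) such that: (i) $U$ and $V$ are disjoint and their union is $A$; (ii) $p:U\to V$; (iii) each $f_n:U\times U\to U$; (iv) $R_n(x,y)\rightarrow(U(x)\wedge U(y))$ for each $n$; (v) the family $\{R_n:n\in\omega\}$ partitions $U^2$ into disjoint pieces; (vi) for each $n$ and $m\ge n$, $R_n(x,y)\rightarrow f_m(x,y)=x$; (vii) if $x',y'\in cl(\{x,y\})$ and $R_n(x,y)$, then $\bigvee_{j\le n}R_j(x',y')$; (viii) for all $x_0,x_1,x_2\in U$ there is a permutation $\sigma$ of $\{0,1,2\}$ with $x_{\sigma(0)}\in cl(\{x_{\sigma(1)},x_{\sigma(2)}\})$. The class $K$ is closed under isomorphism and substructures, has countably many isomorphism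 types, and has the joint embedding and amalgamation properties; let $\mathcal{B}$ (universe $B$) be its countable $K$-generic structure (the countable structure that is a union of an increasing chain of members of $K$, into which every member of $K$ embeds, and in which every isomorphism between finite substructures extends to an automorphism). Let $L'=L\cup\{W,g,h\}\cup\{c_n:n\in\omega\}$ with $W$ a unary predicate, $g$ a binary and $h$ a ternary function symbol, and $c_n$ constant symbols. Let $\mathcal{B}'$ be the $L'$-structure with universe $B\cup D$, where $D=\{d_n:n\in\omega\}$ is disjoint from $B$, extending $\mathcal{B}$, with $W$ interpreted as $D$, $c_n$ interpreted as $d_n$, $g:U\times U\to W$ given by $g(a,b)=d_n$ where $R_n(a,b)$ holds, and $h(a,b,c)=d_n$ iff $n=|cl(\{a,b,c\})|$. Let $T'=\mathrm{Th}(\mathcal{B}')$ and let $p(x)$ be the type $\{W(x)\}\cup\{x\neq c_n:n\in\omega\}$ (a complete non-principal type of $T'$). ''The principal types over $A$ are dense'' means every formula with parameters from $A$ consistent with $T'(A)$ is implied by a formula with parameters from $A$ isolating a complete type of $T'(A)$. An atomic model of $T'(A)$ is a model in which every finite tuple realizes an isolated type of $T'(A)$. *)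

(* Defs.v *)
From mathcomp Require Import all_boot fingroup perm.
From mathcomp Require Import boolp classical_sets functions cardinality wochoice.

Set Implicit Arguments.
Unset Strict Implicit.
Unset Printing Implicit Defensive.

Local Open Scope classical_set_scope.
Local Open Scope card_scope.

(** * First-order languages and structures with partial functions *)

Record language := Language {
  fsym : Type;
  far : fsym -> nat;
  psym : Type;
  par : psym -> nat }.

Definition lang_sum (L1 L2 : language) : language := {|
  fsym := fsym L1 + fsym L2;
  far := fun f => match f with inl f1 => far f1 | inr f2 => far f2 end;
  psym := psym L1 + psym L2;
  par := fun P => match P with inl P1 => par P1 | inr P2 => par P2 end |}.

Definition const_lang (A : Type) : language := {|
  fsym := A;
  far := fun=> 0;
  psym := void;
  par := fun=> 0 |}.

(* Carriers may be empty, so that the empty substructure is allowed. *)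
Record structure (L : language) := Structure {
  carrier :> Type;
  fint : forall f : fsym L, (far f).-tuple carrier -> option carrier;
  pint : forall P : psym L, set ((par P).-tuple carrier) }.

Definition reduct (L1 L2 : language) (M : structure (lang_sum L1 L2)) :
    structure L1 := {|
  carrier := M;
  fint := fun f => @fint _ M (inl f);
  pint := fun P => @pint _ M (inl P) |}.

Definition expand_const (L : language) (M : structure L) (A : set M) :
    structure (lang_sum L (const_lang A)) :=
  @Structure (lang_sum L (const_lang A)) M
    (fun f => match f with
              | inl f1 => @fint _ M f1
              | inr a => fun=> Some (val a)
              end)
    (fun P => match P with
              | inl P1 => @pint _ M P1
              | inr P2 => match P2 with end
              end).

(* An embedding preserves and reflects the domains of the partial functions. *)
Definition embedding (L : language) (M N : structure L) (h : M -> N) :=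
  [/\ injective h,
      forall (P : psym L) (z : (par P).-tuple M),
        pint (map_tuple h z) <-> pint z
    & forall (f : fsym L) (z : (far f).-tuple M),
        fint (map_tuple h z) = omap h (fint z)].

Definition isomorphism (L : language) (M N : structure L) (h : M -> N) :=
  embedding h /\ bijective h.

Definition sub_closed (L : language) (M : structure L) (X : set M) :=
  forall (f : fsym L) (z : (far f).-tuple M) (y : M),
    (forall i, X (tnth z i)) -> fint z = Some y -> X y.

(* The structure induced on [X]; it is used only when [sub_closed X] holds, and
   is then the substructure of [M] with universe [X]. *)
Definition induced (L : language) (M : structure L) (X : set M) :
    structure L := {|
  carrier := X;
  fint := fun f z => obind insub (fint (map_tuple val z));
  pint := fun P z => pint (map_tuple val z) |}.

(** * First-order logic *)

(* [term L n] and [formula L n] have their free variables in ['I_n]; under a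
   quantifier, variable [0] is the bound one. *)
Inductive term (L : language) (n : nat) : Type :=
| Var of 'I_n
| App (f : fsym L) of ('I_(far f) -> term L n).

Inductive formula (L : language) : nat -> Type :=
| Bot n : formula L n
| Eq n : term L n -> term L n -> formula L n
| Pred n (P : psym L) : ('I_(par P) -> term L n) -> formula L n
| Imp n : formula L n -> formula L n -> formula L n
| All n : formula L n.+1 -> formula L n.

Definition Neg (L : language) n (phi : formula L n) := Imp phi (Bot L n).

(* A term need not have a value; an atomic formula holds when all its terms have
   values and these values satisfy it. *)
Fixpoint tval (L : language) (M : structure L) n (e : n.-tuple M)
    (t : term L n) (y : M) : Prop :=
  match t with
  | Var i => tnth e i = y
  | App f ts => exists z : (far f).-tuple M,
      (forall i, tval e (ts i) (tnth z i)) /\ fint z = Some y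
  end.

Fixpoint sat (L : language) (M : structure L) n (phi : formula L n) :
    n.-tuple M -> Prop :=
  match phi in formula _ n return n.-tuple M -> Prop with
  | Bot _ => fun=> False
  | Eq _ t u => fun e => exists y : M, tval e t y /\ tval e u y
  | Pred _ P ts => fun e => exists z : (par P).-tuple M,
      (forall i, tval e (ts i) (tnth z i)) /\ pint z
  | Imp _ phi psi => fun e => sat phi e -> sat psi e
  | All _ phi => fun e => forall a : M, sat phi [tuple of a :: e]
  end.

Definition theory (L : language) := set (formula L 0).

Definition Th (L : language) (M : structure L) : theory L :=
  [set phi | sat phi ([tuple] : 0.-tuple M)].

Definition model (L : language) (T : theory L) (M : structure L) :=
  T `<=` Th M.

Section Types.
Variables (L : language) (T : theory L).

Definition consistent n (phi : formula L n) :=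
  exists2 M : structure L, model T M & exists e : n.-tuple M, sat phi e.

Definition entails n (phi psi : formula L n) :=
  forall M : structure L, model T M ->
  forall e : n.-tuple M, sat phi e -> sat psi e.

Definition realizes (M : structure L) n (p : set (formula L n))
    (e : n.-tuple M) :=
  forall phi, p phi -> sat phi e.

Definition complete_type n (p : set (formula L n)) :=
  (exists2 M : structure L, model T M & exists e : n.-tuple M, realizes p e) /\
  forall phi, p phi \/ p (Neg phi).

Definition isolates n (phi : formula L n) (p : set (formula L n)) :=
  p phi /\ forall psi, p psi -> entails phi psi.

Definition principal_types_dense :=
  forall n (phi : formula L n), consistent phi ->
  exists (psi : formula L n) (p : set (formula L n)),
    [/\ complete_type p, isolates psi p & entails psi phi].

Definition atomic_model (M : structure L) :=
  model T M /\
  forall n (e : n.-tuple M), exists p : set (formula L n),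
    [/\ complete_type p, exists psi, isolates psi p & realizes p e].

End Types.

Definition indiscernible_set (L : language) (M : structure L) (A : set M) :=
  forall n (a b : n.-tuple M),
    injective (tnth a) -> injective (tnth b) ->
    (forall i, A (tnth a i)) -> (forall i, A (tnth b i)) ->
    forall phi : formula L n, sat phi a <-> sat phi b.

(** * The language [L] and the class [K] *)

Inductive Lfun := Lp | Lf of nat.
Inductive Lpred := LU | LV | LR of nat.

Definition L : language := {|
  fsym := Lfun;
  far := fun f => match f with Lp => 1 | Lf _ => 2 end;
  psym := Lpred;
  par := fun P => match P with LU => 1 | LV => 1 | LR _ => 2 end |}.

Section Interpretations.
Variable M : structure L.

Definition U : set M := fun x => @pint L M LU [tuple x].
Definition V : set M := fun x => @pint L M LV [tuple x].
Definition R (n : nat) (x y : M) : Prop := @pint L M (LR n) [tuple x; y].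
Definition p_ (x : M) : option M := @fint L M Lp [tuple x].
Definition f_ (n : nat) (x y : M) : option M := @fint L M (Lf n) [tuple x; y].

Inductive cl (X : set M) : set M :=
| cl_base x : X x -> cl X x
| cl_step n b c y : cl X b -> cl X c -> f_ n b c = Some y -> cl X y.

End Interpretations.

(* The partial function [F] has domain exactly [D] and takes values in [E]. *)
Definition pfun_on (S T : Type) (F : S -> option T) (D : set S) (E : set T) :=
  forall x, if F x is Some y then D x /\ E y else ~ D x.

Definition i0 : 'I_3 := @Ordinal 3 0 isT.
Definition i1 : 'I_3 := @Ordinal 3 1 isT.
Definition i2 : 'I_3 := @Ordinal 3 2 isT.

Record K (A : structure L) : Prop := {
  K_finite : finite_set [set: A];
  K_disjoint : @U A `&` @V A = set0;
  K_cover : @U A `|` @V A = setT;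
  K_p : pfun_on (@p_ A) (@U A) (@V A);
  K_f : forall n,
    pfun_on (fun xy : A * A => f_ n xy.1 xy.2) (@U A `*` @U A) (@U A);
  K_RU : forall n (x y : A), R n x y -> U x /\ U y;
  K_R_cover : forall x y : A, U x -> U y -> exists n, R n x y;
  K_R_disjoint : forall m n (x y : A), R m x y -> R n x y -> m = n;
  K_R_f : forall n m (x y : A), n <= m -> R n x y -> f_ m x y = Some x;
  K_R_cl : forall n (x y x' y' : A),
    cl [set x; y] x' -> cl [set x; y] y' -> R n x y ->
    exists2 j, j <= n & R j x' y';
  K_dep : forall x : 'I_3 -> A, (forall i, U (x i)) ->
    exists s : 'S_3, cl [set x (s i1); x (s i2)] (x (s i0)) }.

Record generic (B : structure L) : Prop := {
  generic_countable : countable [set: B];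
  generic_chain : exists X : nat -> set B,
    [/\ forall n, sub_closed (X n) /\ K (induced (X n)),
        forall n, X n `<=` X n.+1
      & \bigcup_n X n = setT];
  generic_universal : forall A : structure L, K A ->
    exists h : A -> B, embedding h;
  generic_homogeneous : forall (X Y : set B)
      (phi : induced X -> induced Y),
    sub_closed X -> finite_set X -> sub_closed Y -> finite_set Y ->
    isomorphism phi ->
    exists2 alpha : B -> B, isomorphism alpha &
      forall x : X, alpha (val x) = val (phi x) }.

(** * The expanded language [L'] and the structure [B'] *)

Inductive Lfun' := Lg | Lh | Lc of nat.

Definition L' : language := lang_sum L {|
  fsym := Lfun';
  far := fun f => match f with Lg => 2 | Lh => 3 | Lc _ => 0 end;
  psym := unit; (* the single symbol [W] *)
  par := fun=> 1 |}.

Definition LW : psym L' := inr tt.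

(* The element of [P] if there is one; used only when it is unique. *)
Definition the (T : Type) (P : set T) : option T :=
  match pselect (exists x, P x) with
  | left exP => Some (projT1 (cid exP))
  | right _ => None
  end.

Section BPrime.
Variable B : structure L.

(* [inr n] is the element d_n of [D]. *)
Let BD : Type := (B + nat)%type.

Definition U2_to_D (x y : BD) : option BD :=
  match x, y with
  | inl a, inl b => omap inr (the [set n | R n a b])
  | _, _ => None
  end.

(* Defined on all triples from [B], with no restriction to [U]. *)
Definition B3_to_D (x y z : BD) : option BD :=
  match x, y, z with
  | inl a, inl b, inl c => omap inr (the [set n | cl [set a; b; c] #= `I_n])
  | _, _, _ => None
  end.

(* The symbols of [L] keep on [B] their interpretation in [B]: their relations
   hold of, and their functions are defined at, tuples from [B] only. *)
Definition Bprime : structure L' :=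
  @Structure L' BD
    (fun f => match f return (@far L' f).-tuple BD -> option BD with
     | inl Lp => fun z =>
         if tnth z ord0 is inl a then omap inl (p_ a) else None
     | inl (Lf n) => fun z =>
         match tnth z ord0, tnth z ord_max with
         | inl a, inl b => omap inl (f_ n a b)
         | _, _ => None
         end
     | inr Lg => fun z => U2_to_D (tnth z ord0) (tnth z ord_max)
     | inr Lh => fun z => B3_to_D (tnth z i0) (tnth z i1) (tnth z i2)
     | inr (Lc n) => fun=> Some (inr n)
     end)
    (fun P => match P return set ((@par L' P).-tuple BD) with
     | inl Q => [set z | exists2 w : (par Q).-tuple B,
                           pint w & z = map_tuple inl w]
     | inr _ => [set z | exists n, tnth z ord0 = inr n]
     end).

End BPrime.

(** * The type [p] *)

Definition W_x : formula L' 1 := @Pred L' 1 LW (fun=> Var L' ord0).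

Definition x_neq_c (n : nat) : formula L' 1 :=
  Neg (Eq (Var L' ord0) (@App L' 1 (inr (Lc n)) (fun=> Var L' ord0))).

Definition p_type : set (formula L' 1) :=
  [set phi | phi = W_x \/ exists n, phi = x_neq_c n].

(** * The cardinal aleph_1 *)

(* [O] is well-ordered in type omega_1. *)
Definition is_aleph1 (O : Type) :=
  exists le : rel O,
    [/\ well_order le, ~ countable [set: O]
      & forall x, countable [set y | le y x /\ y <> x]].

Lemma aleph1_exists : exists O : Type, is_aleph1 O.
Proof.
have uncS : ~ countable [set: set nat].
  move=> /countable_injP [f] /(_ _ _ (in_setT _) (in_setT _)) fI.
  pose D : set nat := [set n | exists2 X, f X = n & ~ X n].
  have [DD|nDD] := pselect (D (f D)).
    by case: (DD) => X /fI-> nX; apply: nX.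
  by apply: (nDD); exists D.
have [le wo] := well_ordering_principle ({classic set nat}).
have [allc|/existsNP[x nx]] := pselect (forall x, countable [set y | le y x /\ y <> x]).
  by exists (set nat), le.
have [x0 [[x0A x0m] _]] : exists! z, minimum_of le (fun x => `[< ~ countable [set y | le y x /\ y <> x] >]) z.
  by apply: wo; exists x; apply/asboolP.
move/asboolP: x0A => x0A.
pose I := [set y | le y x0 /\ y <> x0].
exists I, (fun a b => le (val a) (val b)); split.
- move=> A [a aA].
  have [|m [[/asboolP[b bA bm] mm] mu]] := wo (fun y => `[< exists2 b : I, A b & val b = y >]).
    by exists (val a); apply/asboolP; exists a.
  exists b; split.
    split=> // c cA; rewrite bm; apply: mm; apply/asboolP; by exists c.
  move=> c [cA cm]. apply: val_inj; rewrite bm; apply: mu; split.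
    by apply/asboolP; exists c.
  by move=> y /asboolP[d dA <-]; apply: cm.
- move=> cI; apply: x0A.
  move: cI => /countable_injP [f] fI.
  apply/countable_injP.
  exists (fun y => if pselect (y \in I) is left h then f (exist _ y h) else 0%N).
  move=> y z yI zI /=. case: pselect => // hy; case: pselect => // hz.
  by move=> /(fI _ _ (in_setT _) (in_setT _)) [].
- move=> a.
  have : countable [set y | le y (val a) /\ y <> val a].
    apply: contrapT => nc.
    have lea : le x0 (val a) by apply: x0m; apply/asboolP.
    have /set_mem[lea' ne] := valP a.
    apply: ne.
    have [|m [_ mu]] := wo (pred2 (x0 : {classic set nat}) (val a)).
      by exists x0; rewrite !inE eqxx.
    have lr z : le z z.
      have [|w [[/eqP ww wl] _]] := wo (pred1 z); first by exists z; apply: eqxx.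
      by have := wl z (eqxx z); rewrite ww.
    have m0 : m = x0.
      by apply: mu; split; [rewrite !inE eqxx | move=> w /orP[/eqP->|/eqP->]].
    have m1 : m = val a.
      by apply: mu; split; [rewrite !inE eqxx orbT | move=> w /orP[/eqP->|/eqP->]].
    by rewrite -m1 m0.
  move=> /countable_injP [f fI].
  apply/countable_injP; exists (f \o val) => y z yI zI /= e; apply: val_inj.
  apply: fI => //; apply: mem_set => /=.
    by have /set_mem[l n] := yI; split=> // /val_inj.
  by have /set_mem[l n] := zI; split=> // /val_inj.
Qed.

(* Main.v *)
From mathcomp Require Import all_boot fingroup perm.
From mathcomp Require Import boolp classical_sets functions cardinality wochoice.
From Stdlib Require List.
Require Import Defs.

(** A finite partial isomorphism between a structure with the back-and-forth
    property over [B] and [B] itself preserves all formulas of [L'], so the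
    theory T' is governed by finite closed subsets; distinct points of [V] carry
    no structure, whence indiscernibility. Over [A], a tuple is isolated by the
    diagram of a finite closed set containing it, provided all [V]-points of that
    set are parameters; when [A] is infinite, unused parameters can be matched
    with those points, which gives density.

    An atomic model over an infinite [A] must then have exactly [A] as its [V].
    For |A| = aleph_1 it comes from Zorn's lemma applied to diagrams along a
    well-order of [A] with countable initial segments: a countable piece embeds
    into [B] avoiding a point of [V], hence is a proper part of a copy of [B].
    Amalgamation is never used directly: homogeneity of [B] supplies it.

    For |A| > aleph_1, a model omitting [p] has all its [g]- and [h]-values
    standard, so any two points of its [U] lie in a finite closed set and (viii)
    excludes free triples. Kuratowski's free set theorem then bounds [U],
    hence [A], by aleph_1. *)

Set Implicit Arguments.
Unset Strict Implicit.
Unset Printing Implicit Defensive.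

Local Open Scope classical_set_scope.
Local Open Scope card_scope.

(** * Cardinality *)

(** The parameters live in an arbitrary model, while all constructions take place in [B]. The bridge
    is that a formula mentions finitely many parameters and that these, being distinct points of
    [V], may be read as any distinct points of [V] in [B] ([sat_sentence]). The reading may vary
    with the formula, which is what leaves parameters free to be matched with prescribed points.

    The obstacle to isolation is a point of [V] named by no parameter: it differs from all of them,
    and no single formula says so when [A] is infinite. For finite [A] the isolating formula can
    mention every parameter. Hence the two alternatives that recur: all points of [V] concerned are
    named, or all parameters are listed.

    The bound aleph_1 appears on both sides for exact reasons. A well-order of type omega_1 has
    countable proper initial segments, and a countable piece embeds into [B] by omega one-point
    extensions. Conversely (viii) speaks of three points, and a finite-valued set mapping on pairs
    can lack free triples only up to cardinality aleph_1. *)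

Lemma card_le_inj_fun (T U : Type) (A : set T) (B : set U) :
  A #<= B <-> exists f : A -> B, injective f.
Proof.
split=> [/card_leP[f]|[f fI]].
  exists f => x y e; exact: (@inj _ _ _ f x y (mem_set I) (mem_set I) e).
rewrite -(card_le_eql (card_setT A)) -(card_le_eqr (card_setT B)).
rewrite -(card_le_eql (@inj_card_eq _ _ setT f (fun x y _ _ => fI x y))).
exact: card_leT.
Qed.

Lemma card_le_of_inj (T U : Type) (A : set T) (f : T -> U) :
  (forall x y, A x -> A y -> f x = f y -> x = y) -> A #<= [set: U].
Proof.
move=> fI; rewrite -(card_le_eql (@inj_card_eq _ _ A f _)) ?card_leT //.
by move=> x y /set_mem Ax /set_mem Ay; exact: fI.
Qed.

Lemma infinite_nat_inj (T : Type) (A : set T) : infinite_set A ->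
  exists c : nat -> T, injective c /\ forall k, A (c k).
Proof.
move=> /infiniteP /card_le_inj_fun[f fI].
exists (fun k => val (f (exist _ k (mem_set I)))); split; last first.
  by move=> k; exact: set_valP.
by move=> i j /val_inj /fI [].
Qed.

(** Zorn's lemma on the graphs of injections from [X * nat] to [X]. For a maximal one the complement
    of [X] is finite, and a finite complement is absorbed by the injection itself. *)
Lemma infinite_prod_nat_inj (T : Type) : infinite_set [set: T] ->
  exists f : T * nat -> T, injective f.
Proof.
move=> Tinf.
(* The clauses say: single-valued and injective, defined on a full product [X * nat], and with
   values in [X]. *)
pose P (G : set (T * nat * T)) := [/\
  forall x n y x' n' y', G (x, n, y) -> G (x', n', y') ->
    ((x, n) = (x', n') <-> y = y'),
  forall x n y, G (x, n, y) -> forall n', exists y', G (x, n', y')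
  & forall x n y, G (x, n, y) -> exists n' y', G (y, n', y')].
have [F FP Ftot|G [[Gb Gt Gr] Gmax]] := @Zorn_bigcup _ P.
  split.
  - move=> x n y x' n' y' [G1 F1 g1] [G2 F2 g2].
    case: (Ftot _ _ F1 F2) => s.
      by have [/(_ _ _ _ _ _ _ (s _ g1) g2)] := FP _ F2.
    by have [/(_ _ _ _ _ _ _ g1 (s _ g2))] := FP _ F1.
  - move=> x n y [G FG g] n'; have [_ /(_ _ _ _ g n')[y' g'] _] := FP _ FG.
    by exists y', G.
  - move=> x n y [G FG g]; have [_ _ /(_ _ _ _ g)[n' [y' g']]] := FP _ FG.
    by exists n', y', G.
pose X : set T := [set x | exists n y, G (x, n, y)].
have Gran x n y : G (x, n, y) -> X y by move=> /Gr.
have [Cfin|/infinite_nat_inj[c [cI cX]]] := pselect (finite_set (~` X)); last first.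
  (* A sequence [c] outside [X] can be adjoined to the domain: [pickle] sends the pairs of an index
     and a number injectively back into the same sequence. *)
  pose G' := G `|` [set q | exists k n, q = (c k, n, c (pickle (k, n)))].
  exfalso; apply: (Gmax G').
    split; first by left.
    move=> s; apply: (cX 0); exists 0, (c (pickle (0, 0))).
    by apply: s; right; exists 0, 0.
  split.
  - move=> x n y x' n' y' [g|[k [m [-> -> ->]]]] [g'|[k' [m' [-> -> ->]]]].
    + exact: Gb.
    + split=> [[e _]|e]; [case: (cX k')|case: (cX (pickle (k', m')))].
        by rewrite -e; exists n, y.
      by rewrite -e; exact: Gran g.
    + split=> [[e _]|e]; [case: (cX k)|case: (cX (pickle (k, m)))].
        by rewrite e; exists n', y'.
      by rewrite e; exact: Gran g'.
    + split=> [[/cI-> ->]//|/cI /(pcan_inj (@pickleK _)) [-> ->]//].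
  - move=> x n y [g|[k [m [-> _ _]]]] n'.
      by have [y' g'] := Gt _ _ _ g n'; exists y'; left.
    by exists (c (pickle (k, n'))); right; exists k, n'.
  - move=> x n y [g|[k [m [_ _ ->]]]].
      by have [n' [y' g']] := Gr _ _ _ g; exists n', y'; left.
    by exists 0, (c (pickle (pickle (k, m), 0))); right; exists (pickle (k, m)), 0.
have [x0 Xx0] : exists x, X x.
  apply: contrapT => nX; apply: Tinf; apply: sub_finite_set Cfin => x _ Xx.
  by apply: nX; exists x.
have /countable_injP[i /= iI] := finite_set_countable Cfin.
have /choice[g gP] : forall q : T * nat, exists y, X q.1 -> G (q.1, q.2, y).
  move=> [x n]; have [[m [y g]]|nX] := pselect (X x); last by exists x.
  by have [y' g'] := Gt _ _ _ g n; exists y'.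
have gX x n : X x -> X (g (x, n)) by move=> Xx; exact: Gran (gP (x, n) Xx).
have gI x n x' n' : X x -> X x' -> g (x, n) = g (x', n') -> (x, n) = (x', n').
  by move=> Xx Xx' e; apply/(Gb _ _ _ _ _ _ (gP (x, n) Xx) (gP (x', n') Xx')).
(* The last argument is 0 for points of [X] and a successor for the others, so the two kinds of
   values are disjoint; [x0] only serves to carry the number [q.2]. *)
exists (fun q => if pselect (X q.1) then g (g q, 0) else g (g (x0, q.2), (i q.1).+1)).
move=> [x n] [x' n'] /=; case: pselect => Xx; case: pselect => Xx' /=.
- by move=> /(gI _ _ _ _ (gX _ n Xx) (gX _ n' Xx'))[/(gI _ _ _ _ Xx Xx')].
- by move=> /(gI _ _ _ _ (gX _ n Xx) (gX _ n' Xx0))[].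
- by move=> /(gI _ _ _ _ (gX _ n Xx0) (gX _ n' Xx'))[].
- move=> /(gI _ _ _ _ (gX _ n Xx0) (gX _ n' Xx0))[].
  move=> /(gI _ _ _ _ Xx0 Xx0)[-> e]; congr (_, _).
  by apply: iI => //; exact: mem_set.
Qed.

(** * Diagrams and locally K structures *)

Inductive sym := sD | sU | sV | sP | sF of nat | sR of nat.

(* Atomic formulas are padded to three arguments; [sD] is the predicate true
   everywhere, so that the domain is a part of the diagram. *)
Definition diagram (N : structure L) (s : sym) (x y z : N) : Prop :=
  match s with
  | sD => True
  | sU => U x
  | sV => V x
  | sP => p_ x = Some y
  | sF n => f_ n x y = Some z
  | sR n => R n x y
  end.

Definition closed_under (N : structure L) (X : set N) :=
  (forall x y, X x -> p_ x = Some y -> X y) /\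
  (forall n x y z, X x -> X y -> f_ n x y = Some z -> X z).

Definition elts (T : Type) (l : seq T) : set T := fun x => List.In x l.

Lemma tuple1E (T : Type) (z : 1.-tuple T) : z = [tuple tnth z ord0].
Proof. by apply: eq_from_tnth => i; rewrite (ord1 i). Qed.

Lemma tuple2E (T : Type) (z : 2.-tuple T) : z = [tuple tnth z ord0; tnth z ord_max].
Proof.
apply: eq_from_tnth => i; case: (unliftP ord0 i) => [j ->|->] //.
by rewrite (ord1 j) [RHS](tnth_nth (tnth z ord0)) /=; congr tnth; exact: val_inj.
Qed.

Lemma map_tuple1 (S T : Type) (f : S -> T) x : map_tuple f [tuple x] = [tuple f x].
Proof. exact: val_inj. Qed.

Lemma map_tuple2 (S T : Type) (f : S -> T) x y :
  map_tuple f [tuple x; y] = [tuple f x; f y].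
Proof. exact: val_inj. Qed.

Lemma sub_closedP (N : structure L) (X : set N) : sub_closed X <-> closed_under X.
Proof.
split=> [cX|[cp cf]].
  split=> [x y Xx|n x y z Xx Xy].
    by apply: (cX Lp [tuple x]) => i; rewrite (ord1 i).
  apply: (cX (Lf n) [tuple x; y]) => i; case: (unliftP ord0 i) => [j ->|->] //.
  by rewrite (ord1 j).
case=> [|n] z y Xz.
  by rewrite (tuple1E z); exact: cp.
by rewrite (tuple2E z); exact: cf.
Qed.

Section Induced.
Variables (N : structure L) (X : set N).
Implicit Types x y z : induced X.

Lemma U_induced x : U x = U (val x) :> Prop.
Proof. by rewrite /U /= map_tuple1. Qed.

Lemma V_induced x : V x = V (val x) :> Prop.
Proof. by rewrite /V /= map_tuple1. Qed.

Lemma R_induced n x y : R n x y = R n (val x) (val y) :> Prop.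
Proof. by rewrite /R /= map_tuple2. Qed.

Lemma p_induced x : p_ x = obind insub (p_ (val x)).
Proof. by rewrite /p_ /= map_tuple1. Qed.

Lemma f_induced n x y : f_ n x y = obind insub (f_ n (val x) (val y)).
Proof. by rewrite /f_ /= map_tuple2. Qed.

Lemma p_inducedE x y : p_ x = Some y <-> p_ (val x) = Some (val y).
Proof.
rewrite p_induced; case e: (p_ (val x)) => [y'|] //=; split.
  by case: insubP => // u _ <- [->].
by case=> ->; rewrite valK.
Qed.

Lemma f_inducedE n x y z : f_ n x y = Some z <-> f_ n (val x) (val y) = Some (val z).
Proof.
rewrite f_induced; case e: (f_ _ _ _) => [y'|] //=; split.
  by case: insubP => // u _ <- [->].
by case=> ->; rewrite valK.
Qed.

Lemma diagram_induced s x y z : diagram s x y z <-> diagram s (val x) (val y) (val z).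
Proof.
case: s => [||||n|n]; rewrite /diagram; first by [].
- by rewrite U_induced.
- by rewrite V_induced.
- exact: p_inducedE.
- exact: f_inducedE.
- by rewrite R_induced.
Qed.

Lemma cl_induced (Z : set N) x : closed_under X -> Z `<=` X ->
  cl [set y : induced X | Z (val y)] x <-> cl Z (val x).
Proof.
move=> cX ZX; split.
  elim=> {x} [x Zx|n b c y _ ihb _ ihc /f_inducedE e]; first exact: cl_base.
  exact: cl_step e.
suff H v : cl Z v -> exists2 x' : induced X, val x' = v & cl [set y : induced X | Z (val y)] x'.
  by case/H => x' /val_inj ->.
elim=> {v} [v Zv|n b c y _ [b' <- ihb] _ [c' <- ihc] e].
  by exists (exist _ v (mem_set (ZX _ Zv))) => //; exact: cl_base.
have Xy : X y by apply: (cX.2 _ _ _ _ _ _ e); exact: set_valP.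
exists (exist _ y (mem_set Xy)) => //.
by apply: (cl_step (n := n) ihb ihc); apply/f_inducedE.
Qed.

End Induced.

Lemma cl_closed (N : structure L) (X Z : set N) :
  closed_under X -> Z `<=` X -> cl Z `<=` X.
Proof. by move=> [_ cf] ZX x; elim=> {x} [x /ZX//|n b c y _ ? _ ?]; exact: cf. Qed.

(* The properties of the members of [K] that are inherited by unions of chains. *)
Record locally_K (N : structure L) : Prop := {
  lK_disj : forall x : N, U x -> V x -> False;
  lK_cover : forall x : N, U x \/ V x;
  lK_p_def : forall x : N, U x -> exists y, p_ x = Some y;
  lK_p_range : forall x y : N, p_ x = Some y -> U x /\ V y;
  lK_f_def : forall n (x y : N), U x -> U y -> exists z, f_ n x y = Some z;
  lK_f_range : forall n (x y z : N), f_ n x y = Some z -> [/\ U x, U y & U z];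
  lK_RU : forall n (x y : N), R n x y -> U x /\ U y;
  lK_R_def : forall x y : N, U x -> U y -> exists n, R n x y;
  lK_R_inj : forall m n (x y : N), R m x y -> R n x y -> m = n;
  lK_R_f : forall n m (x y : N), n <= m -> R n x y -> f_ m x y = Some x;
  lK_R_cl : forall n (x y x' y' : N), cl [set x; y] x' -> cl [set x; y] y' ->
    R n x y -> exists2 j, j <= n & R j x' y';
  lK_dep : forall x y z : N, U x -> U y -> U z ->
    [\/ cl [set y; z] x, cl [set x; z] y | cl [set x; y] z];
  lK_finite : forall l : seq N, exists l', closed_under (elts l') /\ List.incl l l' }.

Lemma finite_elts (T : Type) (X : set T) : finite_set X -> exists l, X = elts l.
Proof.
move=> Xfin; have [l e] := (@finite_seqP {classic T} X).1 Xfin.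
exists l; apply/seteqP; split=> x; rewrite e /elts /=; elim: l {e} => //= y l ih.
  by rewrite inE => /predU1P[->|/ih]; [left|right].
by rewrite inE => -[->|/ih ->]; rewrite ?eqxx ?orbT.
Qed.

Lemma elts_finite (T : Type) (l : seq T) : finite_set (elts l).
Proof.
elim: l => [|x l ih]; first by rewrite (_ : elts _ = set0) //; apply/seteqP; split.
have -> : elts (x :: l) = [set x] `|` elts l.
  by apply/seteqP; split=> y [->|yl]; [left|right|left|right].
by rewrite finite_setU; split => //; exact: finite_set1.
Qed.

Lemma cl_mono (N : structure L) (X Y : set N) : X `<=` Y -> cl X `<=` cl Y.
Proof.
move=> XY x; elim=> {x} [x /XY|n b c y _ ihb _ ihc e]; first exact: cl_base.
exact: cl_step e.
Qed.

(** Each clause concerns finitely many points, which lie together in some closed [X] where the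
    clause is an axiom of [K]. Closures computed in [X] and in [N] agree by [cl_induced]. *)
Lemma locally_K_of_cofinal (N : structure L) :
  (forall l : seq N, exists2 X, closed_under X /\ K (induced X) & elts l `<=` X) ->
  locally_K N.
Proof.
move=> cof.
have cof1 (x : N) : exists2 X, closed_under X /\ K (induced X) & exists x' : induced X, val x' = x.
  have [X KX lX] := cof [:: x]; exists X => //.
  by exists (exist _ x (mem_set (lX x (or_introl erefl)))).
have cof2 (x y : N) : exists2 X, closed_under X /\ K (induced X) &
    exists x' y' : induced X, val x' = x /\ val y' = y.
  have [X KX lX] := cof [:: x; y]; exists X => //.
  exists (exist _ x (mem_set (lX x (or_introl erefl)))).
  by exists (exist _ y (mem_set (lX y (or_intror (or_introl erefl))))).
have cof3 (x y z : N) : exists2 X, closed_under X /\ K (induced X) &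
    exists x' y' z' : induced X, [/\ val x' = x, val y' = y & val z' = z].
  have [X KX lX] := cof [:: x; y; z]; exists X => //.
  exists (exist _ x (mem_set (lX x (or_introl erefl)))).
  exists (exist _ y (mem_set (lX y (or_intror (or_introl erefl))))).
  by exists (exist _ z (mem_set (lX z (or_intror (or_intror (or_introl erefl)))))).
have dg (X : set N) s (x y z : induced X) :
    diagram s (val x) (val y) (val z) -> diagram s x y z.
  by move=> /diagram_induced.
have KfE (M : structure L) (KM : K M) n (x y : M) :
    if f_ n x y is Some z then [/\ U x, U y & U z] else ~ (U x /\ U y).
  have := K_f KM n (x, y); rewrite -[f_ n (x, y).1 _]/(f_ n x y).
  by case: (f_ n x y) => [z [[]]|].
split.
- move=> x; have [X [cX KX] [x' <-]] := cof1 x.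
  move=> /(dg X sU x' x' x') Ux /(dg X sV x' x' x') Vx.
  by suff : set0 x' by []; rewrite -(K_disjoint KX).
- move=> x; have [X [cX KX] [x' <-]] := cof1 x.
  have : [set: induced X] x' by [].
  by rewrite -(K_cover KX) => -[/(diagram_induced sU x' x' x')|/(diagram_induced sV x' x' x')]; [left|right].
- move=> x; have [X [cX KX] [x' <-]] := cof1 x.
  move=> /(dg X sU x' x' x') Ux; have := K_p KX x'.
  case e: (p_ x') => [y|//] _; exists (val y).
  exact/p_inducedE.
- move=> x y; have [X [cX KX] [x' [y' [<- <-]]]] := cof2 x y.
  move=> /p_inducedE e; have := K_p KX x'; rewrite e => -[Ux Vy]; split.
    exact/(diagram_induced sU x' x' x').
  exact/(diagram_induced sV y' y' y').
- move=> n x y; have [X [cX KX] [x' [y' [<- <-]]]] := cof2 x y.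
  move=> /(dg X sU x' x' x') Ux /(dg X sU y' y' y') Uy.
  case e: (f_ n x' y') => [z|]; first by exists (val z); exact/f_inducedE.
  by have := KfE _ KX n x' y'; rewrite e; case.
- move=> n x y z; have [X [cX KX] [x' [y' [z' [<- <- <-]]]]] := cof3 x y z.
  move=> /f_inducedE e; have := KfE _ KX n x' y'; rewrite e => -[Ux Uy Uz]; split.
  + exact/(diagram_induced sU x' x' x').
  + exact/(diagram_induced sU y' y' y').
  + exact/(diagram_induced sU z' z' z').
- move=> n x y; have [X [cX KX] [x' [y' [<- <-]]]] := cof2 x y.
  move=> /(dg X (sR n) x' y' y') /(K_RU KX)[Ux Uy]; split.
    exact/(diagram_induced sU x' x' x').
  exact/(diagram_induced sU y' y' y').
- move=> x y; have [X [cX KX] [x' [y' [<- <-]]]] := cof2 x y.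
  move=> /(dg X sU x' x' x') Ux /(dg X sU y' y' y') Uy.
  have [n Rn] := K_R_cover KX Ux Uy; exists n.
  exact/(diagram_induced (sR n) x' y' y').
- move=> m n x y; have [X [cX KX] [x' [y' [<- <-]]]] := cof2 x y.
  by move=> /(dg X (sR m) x' y' y') Rm /(dg X (sR n) x' y' y'); exact: K_R_disjoint KX _ _ _ _ Rm.
- move=> n m x y nm; have [X [cX KX] [x' [y' [<- <-]]]] := cof2 x y.
  move=> /(dg X (sR n) x' y' y') Rn; apply/f_inducedE.
  exact: K_R_f KX _ _ _ _ nm Rn.
- move=> n x y x1 y1; have [X [cX KX] [x' [y' [ex ey]]]] := cof2 x y.
  move=> cx cy Rxy.
  have sX : [set x; y] `<=` X by move=> _ [->|->]; rewrite -(ex, ey); exact: set_valP.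
  have Xx1 : X x1 := cl_closed cX sX cx.
  have Xy1 : X y1 := cl_closed cX sX cy.
  pose x2 : induced X := exist _ x1 (mem_set Xx1).
  pose y2 : induced X := exist _ y1 (mem_set Xy1).
  have eZ : [set z : induced X | [set x; y] (val z)] = [set x'; y'].
    apply/seteqP; split=> z /=; rewrite -ex -ey => -[].
    + by move=> /val_inj ->; left.
    + by move=> /val_inj ->; right.
    + by move=> ->; left.
    + by move=> ->; right.
  have cx2 : cl [set x'; y'] x2 by rewrite -eZ; exact/(cl_induced _ cX sX).
  have cy2 : cl [set x'; y'] y2 by rewrite -eZ; exact/(cl_induced _ cX sX).
  have Rn : R n x' y' by apply: (dg X (sR n) x' y' y'); rewrite ex ey.
  have [j jn Rj] := K_R_cl KX cx2 cy2 Rn; exists j => //.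
  exact/(diagram_induced (sR j) x2 y2 y2).
- move=> x y z; have [X [cX KX] [x' [y' [z' [<- <- <-]]]]] := cof3 x y z.
  move=> /(dg X sU x' x' x') Ux /(dg X sU y' y' y') Uy /(dg X sU z' z' z') Uz.
  have H (u v w : induced X) : cl [set v; w] u -> cl [set val v; val w] (val u).
    have sX : [set val v; val w] `<=` X by move=> _ [->|->]; exact: set_valP.
    move=> c; apply/(cl_induced _ cX sX); apply: cl_mono c => _ [->|->] /=; by [left|right].
  pose t (i : 'I_3) := if i == i0 then x' else if i == i1 then y' else z'.
  have [|s] := K_dep KX (x := t); first by move=> i; rewrite /t; do 2?case: ifP.
  have n01 : s i0 != s i1 by rewrite (inj_eq perm_inj).
  have n02 : s i0 != s i2 by rewrite (inj_eq perm_inj).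
  have n12 : s i1 != s i2 by rewrite (inj_eq perm_inj).
  have tri i : [\/ i = i0, i = i1 | i = i2].
    by case: i => [[|[|[|//]]] h]; [apply: Or31|apply: Or32|apply: Or33]; exact: val_inj.
  move: n01 n02 n12.
  case: (tri (s i0)) => ->; case: (tri (s i1)) => ->; case: (tri (s i2)) => -> // _ _ _ /H c;
    solve [apply: Or31; solve [exact: c|rewrite setUC; exact: c]
          |apply: Or32; solve [exact: c|rewrite setUC; exact: c]
          |apply: Or33; solve [exact: c|rewrite setUC; exact: c]].
- move=> l; have [X [cX KX] lX] := cof l.
  have [m em] := finite_elts (K_finite KX).
  suff e : elts (map val m) = X.
    exists (map val m); split; first by rewrite e.
    by move=> x /lX; rewrite -{1}e.
  apply/seteqP; split=> x; first by move=> /List.in_map_iff[y [<- _]]; exact: set_valP.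
  move=> Xx; apply/List.in_map_iff; exists (exist _ x (mem_set Xx)); split => //.
  by rewrite -/(elts m _) -em.
Qed.

Section Generic.
Variables (B : structure L) (hB : generic B).

Lemma generic_locally_K : locally_K B.
Proof.
have [X [KX Xmono XT]] := generic_chain hB.
have XS i j x : X i x -> X (i + j) x.
  by elim: j => [|j ih]; rewrite ?addn0 // addnS => /ih /Xmono.
apply: locally_K_of_cofinal => l.
suff [n ln] : exists n, elts l `<=` X n.
  by exists (X n) => //; have [/sub_closedP cX KXn] := KX n.
elim: l => [|x l [n ln]]; first by exists 0.
have [m _ Xm] : (\bigcup_n X n) x by rewrite XT.
by exists (n + m) => _ [<-|/ln /XS//]; rewrite addnC; exact: XS.
Qed.

End Generic.

(** * Finite partial isomorphisms *)

Lemma embedding_diagram (M N : structure L) (h : M -> N) : embedding h ->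
  forall s x y z, diagram s (h x) (h y) (h z) <-> diagram s x y z.
Proof.
move=> [hI hP hF] s x y z; case: s => [||||n|n]; rewrite /diagram //.
- by have := hP LU [tuple x]; rewrite map_tuple1.
- by have := hP LV [tuple x]; rewrite map_tuple1.
- rewrite /p_ -map_tuple1 (hF Lp [tuple x]).
  by case: (fint _) => [w|] //=; split=> [[/hI ->]|[->]].
- rewrite /f_ -map_tuple2 (hF (Lf n) [tuple x; y]).
  by case: (fint _) => [w|] //=; split=> [[/hI ->]|[->]].
- by have := hP (LR n) [tuple x; y]; rewrite map_tuple2.
Qed.

Lemma embedding_of_diagram (M N : structure L) (h : M -> N) : bijective h ->
  (forall s x y z, diagram s (h x) (h y) (h z) <-> diagram s x y z) ->
  isomorphism h.
Proof.
move=> hB hd; split=> //; have [g hK gK] := hB; split; first exact: can_inj hK.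
- case=> [||n] z.
  + by rewrite (tuple1E z) map_tuple1; exact: (hd sU _ (tnth z ord0) (tnth z ord0)).
  + by rewrite (tuple1E z) map_tuple1; exact: (hd sV _ (tnth z ord0) (tnth z ord0)).
  + by rewrite (tuple2E z) map_tuple2; exact: (hd (sR n) _ _ (tnth z ord0)).
- have some_eq (o : option N) (o' : option M) :
      (forall y, o = Some (h y) <-> o' = Some y) -> o = omap h o'.
    case: o => [x|]; case: o' => [y|] //= e; first by have := (e y).2 erefl => ->.
      by have := (e (g x)).1; rewrite gK => /(_ erefl).
    by have := (e y).2 erefl.
  case=> [|n] z; apply: some_eq => y.
  + by rewrite (tuple1E z) map_tuple1; exact: (hd sP _ y y).
  + by rewrite (tuple2E z) map_tuple2; exact: (hd (sF n)).
Qed.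

(** With [U] empty, the axioms on functions and relations hold vacuously. Embedding these structures
    of all sizes makes [V] infinite in [B]. *)
Definition Vpoints (n : nat) : structure L := @Structure L 'I_n
  (fun _ _ => None) (fun P => if P is LV then setT else set0).

Lemma K_Vpoints n : K (Vpoints n).
Proof.
split=> //.
- exact: finite_finset.
- by apply/seteqP; split=> x [].
- by apply/seteqP; split=> x // _; right.
- by move=> x [].
- by move=> m [x y] [[]].
- by move=> x /(_ i0).
Qed.

(** The smallest member of [K] in which [p] has a value. Its only pair from [U] satisfies [R 0], so
    (vi) forces every [f_n] to be the first projection. *)
Definition UVpair : structure L := @Structure L bool
  (fun f => match f return (@far L f).-tuple bool -> option bool with
            | Lp => fun z => if tnth z ord0 then Some false else None
            | Lf _ => fun z => if tnth z ord0 && tnth z ord_max then Some true else None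
            end)
  (fun P => match P return set ((@par L P).-tuple bool) with
            | LU => [set z | tnth z ord0 = true]
            | LV => [set z | tnth z ord0 = false]
            | LR n => [set z | [/\ n = 0, tnth z ord0 = true & tnth z ord_max = true]]
            end).

Lemma K_UVpair : K UVpair.
Proof.
have UE (x : UVpair) : U x = (x = true) by [].
have VE (x : UVpair) : V x = (x = false) by [].
have RE n (x y : UVpair) : R n x y = [/\ n = 0, x = true & y = true] by [].
have pE (x : UVpair) : p_ x = if x then Some false else None by [].
have fE n (x y : UVpair) : f_ n x y = if x && y then Some true else None by [].
have clT (x : UVpair) : cl [set (true : UVpair); (true : UVpair)] x -> x = true.
  elim=> {x} [x [->|->]//|n b c y _ -> _ ->].
  by rewrite fE => -[].
split=> //.
- by apply: (@finite_finset bool).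
- by apply/seteqP; split=> x // []; rewrite UE VE => ->.
- by apply/seteqP; split=> -[] // _; [left|right].
- by case.
- move=> n [x y]; rewrite -[f_ n (x, y).1 _]/(f_ n x y) fE.
  by case: x y => [] []; [split| | |] => // -[].
- by move=> n x y; rewrite RE => -[_ -> ->].
- by move=> x y; rewrite !UE => -> ->; exists 0.
- by move=> m n x y; rewrite !RE => -[-> _ _] [->].
- by move=> n m x y _; rewrite RE => -[_ -> ->].
- move=> n x y x' y' cx cy; rewrite RE => -[_ ex ey].
  by move: cx cy; rewrite ex ey => /clT -> /clT ->; exists 0.
- move=> x xU; exists 1%g; apply: cl_base; left.
  have e i : x i = true := xU i.
  by rewrite !e.
Qed.

Section Partial_isomorphisms.
Variables (B : structure L).

Definition dom (T : Type) (r : seq (T * B)) : set T :=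
  fun x => exists b, List.In (x, b) r.
Definition ran (T : Type) (r : seq (T * B)) : set B :=
  fun b => exists x, List.In (x, b) r.

(* [at_] is the diagram of a structure with universe [D]; the domain of [r] is
   then closed in it as well, by [piso_dom_closed]. *)
Record piso (T : Type) (D : set T) (at_ : sym -> T -> T -> T -> Prop)
    (r : seq (T * B)) : Prop := {
  piso_D : dom r `<=` D;
  piso_eq : forall x x' y y', List.In (x, x') r -> List.In (y, y') r ->
    (x = y <-> x' = y');
  piso_at : forall s x x' y y' z z', List.In (x, x') r -> List.In (y, y') r ->
    List.In (z, z') r -> (at_ s x y z <-> diagram s x' y' z');
  piso_ran : closed_under (ran r) }.

Definition back_and_forth (T : Type) (D : set T) (at_ : sym -> T -> T -> T -> Prop) :=
  forall r, piso D at_ r ->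
    (forall x, D x -> exists r', [/\ piso D at_ r', List.incl r r' & dom r' x]) /\
    (forall b, exists r', [/\ piso D at_ r', List.incl r r' & ran r' b]).

Lemma piso_nil (T : Type) (D : set T) at_ : piso D at_ [::].
Proof. by split=> // x []. Qed.

(** Extend [r] to the value in question: its image lies in the closed set [ran r], hence already has
    a preimage under [r], and injectivity of the extension identifies the two. *)
Lemma piso_dom_closed (T : Type) (D : set T) at_ r :
    back_and_forth D at_ -> piso D at_ r ->
  (forall x y, dom r x -> D y -> at_ sP x y y -> dom r y) /\
  (forall n x y z, dom r x -> dom r y -> D z -> at_ (sF n) x y z -> dom r z).
Proof.
move=> bf rP; split=> [x y [x' xr]|n x y z [x' xr] [y' yr]].
  move=> /((bf _ rP).1)[r' [r'P rr' [y' yr']]] /(piso_at r'P _ (rr' _ xr) yr' yr').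
  move=> /(piso_ran rP).1 [|z zr]; first by exists x.
  by exists y'; rewrite -(_ : z = y) //; apply/(piso_eq r'P (rr' _ zr) yr').
move=> /((bf _ rP).1)[r' [r'P rr' [z' zr']]] /(piso_at r'P _ (rr' _ xr) (rr' _ yr) zr').
move=> /(piso_ran rP).2 []; [by exists x|by exists y|move=> w wr].
by exists z'; rewrite -(_ : w = z) //; apply/(piso_eq r'P (rr' _ wr) zr').
Qed.

End Partial_isomorphisms.

Section Generic.
Variables (B : structure L) (hB : generic B).

Let KB : locally_K B := generic_locally_K hB.

(** For [B] itself the back-and-forth property is still to be derived, so the image of the value is
    found from the definedness of the functions on [U]. *)
Lemma piso_dom_closedB (r : seq (B * B)) : piso setT (@diagram B) r -> closed_under (dom r).
Proof.
move=> rP; split=> [x y [x' xr] e|n x y z [x' xr] [y' yr] e].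
  have [Ux _] := lK_p_range KB e.
  have [y' e'] := lK_p_def KB ((piso_at rP sU xr xr xr).1 Ux).
  have [y0 yr] : ran r y' by apply: (piso_ran rP).1 e'; exists x.
  by have := (piso_at rP sP xr yr yr).2 e'; rewrite /= e => -[->]; exists y'.
have [Ux Uy _] := lK_f_range KB e.
have [z' e'] := lK_f_def KB n ((piso_at rP sU xr xr xr).1 Ux)
  ((piso_at rP sU yr yr yr).1 Uy).
have [z0 zr] : ran r z' by apply: (piso_ran rP).2 e'; [exists x|exists y].
by have := (piso_at rP (sF n) xr yr zr).2 e'; rewrite /= e => -[->]; exists z'.
Qed.

Lemma homogeneous (r : seq (B * B)) : piso setT (@diagram B) r ->
  exists2 alpha : B -> B, isomorphism alpha &
    forall x x', List.In (x, x') r -> alpha x = x'.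
Proof.
move=> rP; pose X : set B := dom r; pose Y : set B := ran r.
have cX : closed_under X := piso_dom_closedB rP.
have cY : closed_under Y := piso_ran rP.
have finX : finite_set X.
  apply: (@sub_finite_set _ _ (elts (map fst r))); last exact: elts_finite.
  by move=> x [x' xr]; apply/List.in_map_iff; exists (x, x').
have finY : finite_set Y.
  apply: (@sub_finite_set _ _ (elts (map snd r))); last exact: elts_finite.
  by move=> x' [x xr]; apply/List.in_map_iff; exists (x, x').
have /choice[phi phiP] : forall x : induced X, exists y : induced Y, List.In (val x, val y) r.
  move=> [x /= /set_mem[x' xr]].
  have Yx' : Y x' by exists x.
  by exists (exist _ x' (mem_set Yx')).
have /choice[psi psiP] : forall y : induced Y, exists x : induced X, List.In (val x, val y) r.
  move=> [x' /= /set_mem[x xr]].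
  have Xx : X x by exists x'.
  by exists (exist _ x (mem_set Xx)).
have phi_iso : isomorphism phi.
  apply: embedding_of_diagram.
    exists psi => [x|y]; apply: val_inj.
      by apply/(piso_eq rP (psiP (phi x)) (phiP x)).
    by apply/(piso_eq rP (phiP (psi y)) (psiP y)).
  move=> s x y z; rewrite !diagram_induced.
  by rewrite -(piso_at rP _ (phiP x) (phiP y) (phiP z)).
have [alpha aiso aphi] := generic_homogeneous hB ((sub_closedP X).2 cX) finX
  ((sub_closedP Y).2 cY) finY phi_iso.
exists alpha => // x x' xr.
have Xx : X x by exists x'.
rewrite (aphi (exist _ x (mem_set Xx))).
by apply/(piso_eq rP (phiP _) xr).
Qed.

Lemma iso_diagram (M N : structure L) (h : M -> N) : isomorphism h ->
  forall s x y z, diagram s (h x) (h y) (h z) <-> diagram s x y z.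
Proof. by case=> /embedding_diagram. Qed.

Lemma closed_under_iso (alpha : B -> B) (X : set B) : isomorphism alpha ->
  closed_under X -> closed_under [set alpha x | x in X].
Proof.
move=> aiso [cp cf]; have ad := iso_diagram aiso.
have [beta aK bK] := aiso.2; split.
  move=> _ y [x Xx <-] e; exists (beta y) => //; apply: cp Xx _.
  by apply/(ad sP x (beta y) y); rewrite /= bK.
move=> n _ _ z [x Xx <-] [y Xy <-] e; exists (beta z) => //.
apply: cf Xx Xy _.
by apply/(ad (sF n) x y (beta z)); rewrite /= bK.
Qed.

Definition graph_on (T : Type) (f : T -> B) (l : seq T) : seq (T * B) :=
  [seq (x, f x) | x <- l].

Lemma In_graph_on (T : Type) (f : T -> B) l x x' :
  List.In (x, x') (graph_on f l) <-> List.In x l /\ x' = f x.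
Proof.
rewrite /graph_on List.in_map_iff; split=> [[y [[-> <-] yl]]//|[xl ->]].
by exists x.
Qed.

Lemma piso_graph_on (alpha : B -> B) l : isomorphism alpha -> closed_under (elts l) ->
  piso setT (@diagram B) (graph_on alpha l).
Proof.
move=> aiso cl; have ad := iso_diagram aiso; split=> //.
- move=> x x' y y' /In_graph_on[_ ->] /In_graph_on[_ ->].
  by split=> [->//|/(bij_inj aiso.2)].
- move=> s x x' y y' z z' /In_graph_on[_ ->] /In_graph_on[_ ->] /In_graph_on[_ ->].
  by rewrite ad.
- have -> : ran (graph_on alpha l) = [set alpha x | x in elts l].
    apply/seteqP; split=> [y [x /In_graph_on[xl ->]]|_ [x xl <-]]; first by exists x.
    by exists x; apply/In_graph_on.
  exact: closed_under_iso.
Qed.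

(** Homogeneity extends [r] to an automorphism. Its restriction to a finite closed set containing
    [dom r] and the new point, or the preimage of the new point, is the required extension. *)
Lemma back_and_forth_generic : back_and_forth B setT (@diagram B).
Proof.
move=> r rP; have [alpha aiso ar] := homogeneous rP.
have [beta aK bK] := aiso.2.
have forth x : exists r', [/\ piso setT (@diagram B) r', List.incl r r' & List.In (x, alpha x) r'].
  have [l [cl incl]] := lK_finite KB (x :: map fst r).
  exists (graph_on alpha l); split; first exact: piso_graph_on.
    move=> [y y'] yr; apply/In_graph_on; split; last by rewrite (ar _ _ yr).
    by apply: incl; right; apply/List.in_map_iff; exists (y, y').
  by apply/In_graph_on; split=> //; apply: incl; left.
split=> [x _|b].
  by have [r' [? ? xr']] := forth x; exists r'; split=> //; exists (alpha x).
by have [r' [? ?]] := forth (beta b); rewrite bK => br'; exists r'; split=> //; exists (beta b).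
Qed.

Lemma infinite_V : infinite_set (@V B).
Proof.
move=> /finite_setP[n Vn].
have [h /[dup] [[hI _ _]] /embedding_diagram hd] := generic_universal hB (@K_Vpoints n.+1).
have Vh i : V (h i) by apply/(hd sV i i i).
have : `I_n.+1 #<= `I_n.
  rewrite (card_le_eql card_II) -(card_le_eqr Vn).
  apply/card_le_inj_fun; exists (fun i => exist _ (h (val i)) (mem_set (Vh (val i)))).
  by move=> i j [] /hI /val_inj.
by rewrite card_le_II ltnn.
Qed.

Lemma fresh_V (l : seq B) : exists2 v, V v & ~ List.In v l.
Proof.
apply: contrapT => H; apply: infinite_V.
apply: sub_finite_set (elts_finite l) => v Vv.
by apply: contrapT => vl; apply: H; exists v.
Qed.

(** A point of [V] outside a closed set is no function value on that set, and not being in [U] it is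
    an argument of no function and of no [R n]; so [sV] is the only condition on it. The statement
    is one-sided and is applied to a piso and to its converse. *)
Lemma diagram_addV (r : set (B * B)) v v' : V v -> V v' ->
    closed_under [set x | exists x', r (x, x')] ->
    (forall x', ~ r (v, x')) ->
    (forall s x x' y y' z z', r (x, x') -> r (y, y') -> r (z, z') ->
       diagram s x y z -> diagram s x' y' z') ->
  let r' := r `|` [set (v, v')] in
  forall s x x' y y' z z', r' (x, x') -> r' (y, y') -> r' (z, z') ->
    diagram s x y z -> diagram s x' y' z'.
Proof.
move=> Vv Vv' [cp cf] nv rd r'.
have nU : ~ U v by move=> Uv; exact: lK_disj KB _ Uv Vv.
have rU x x' : r' (x, x') -> U x -> r (x, x').
  by case=> // -[-> _].
have rX x x' : r' (x, x') -> (exists w, r (x, w)) -> r (x, x').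
  by case=> // -[-> _] [w /nv].
move=> s x x' y y' z z' xr yr zr; case: s => [||||n|n] e //.
- exact: (rd sU _ _ _ _ _ _ (rU _ _ xr e) (rU _ _ xr e) (rU _ _ xr e) e).
- case: xr => [xr|[_ ->]] //; exact: (rd sV _ _ _ _ _ _ xr xr xr e).
- have [Ux _] := lK_p_range KB e; have xr0 := rU _ _ xr Ux.
  have yr0 : r (y, y') by apply: rX => //; apply: cp e; exists x'.
  exact: (rd sP _ _ _ _ _ _ xr0 yr0 yr0 e).
- have [Ux Uy _] := lK_f_range KB e; have xr0 := rU _ _ xr Ux; have yr0 := rU _ _ yr Uy.
  have zr0 : r (z, z') by apply: rX => //; apply: cf e; [exists x'|exists y'].
  exact: (rd (sF n) _ _ _ _ _ _ xr0 yr0 zr0 e).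
- have [Ux Uy] := lK_RU KB e; have xr0 := rU _ _ xr Ux; have yr0 := rU _ _ yr Uy.
  exact: (rd (sR n) _ _ _ _ _ _ xr0 yr0 yr0 e).
Qed.

Lemma piso_addV (r : seq (B * B)) v v' : piso setT (@diagram B) r ->
  V v -> V v' -> ~ dom r v -> ~ ran r v' -> piso setT (@diagram B) ((v, v') :: r).
Proof.
move=> rP Vv Vv' nv nv'.
have cX := piso_dom_closedB rP; have cY := piso_ran rP.
have inE x x' : List.In (x, x') ((v, v') :: r) ->
    ((fun q => List.In q r) `|` [set (v, v')]) (x, x').
  by case=> [->|xr]; [right|left].
have inE' x x' : List.In (x, x') ((v, v') :: r) ->
    ((fun q => List.In (q.2, q.1) r) `|` [set (v', v)]) (x', x).
  by case=> [[-> ->]|xr]; [right|left].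
split=> //.
- move=> x x' y y' [[<- <-]|xr] [[<- <-]|yr] //.
  + by split=> e; [case: nv; rewrite e; exists y'|case: nv'; rewrite e; exists y].
  + by split=> e; [case: nv; rewrite -e; exists x'|case: nv'; rewrite -e; exists x].
  + exact: piso_eq rP _ _ _ _ xr yr.
- move=> s x x' y y' z z' xr yr zr; split.
    apply: (diagram_addV (r := fun q => List.In q r) Vv Vv')
      (inE _ _ xr) (inE _ _ yr) (inE _ _ zr) => //.
      by move=> w vw; apply: nv; exists w.
    by move=> s' ? ? ? ? ? ? h1 h2 h3 /(piso_at rP _ h1 h2 h3).
  apply: (diagram_addV (r := fun q => List.In (q.2, q.1) r) Vv' Vv)
    (inE' _ _ xr) (inE' _ _ yr) (inE' _ _ zr) => //.
    by move=> w vw; apply: nv'; exists w.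
  by move=> s' ? ? ? ? ? ? h1 h2 h3 /(piso_at rP _ h1 h2 h3).
- have sub : ran r `<=` ran ((v, v') :: r) by move=> b [x xr]; exists x; right.
  have ranU b : ran ((v, v') :: r) b -> U b -> ran r b.
    by move=> [x [[_ <-]|xr]] Ub; [case: (lK_disj KB Ub Vv')|exists x].
  split=> [x y xr e|n x y z xr yr e]; apply: sub.
    by have [Ux _] := lK_p_range KB e; exact: cY.1 (ranU _ xr Ux) e.
  by have [Ux Uy _] := lK_f_range KB e; exact: cY.2 (ranU _ xr Ux) (ranU _ yr Uy) e.
Qed.

(** A single point of [V] is a closed set, so homogeneity carries any point of [V] to any other. One
    point with a preimage, taken from a copy of [UVpair], therefore suffices. *)
Lemma p_onto (v : B) : V v -> exists u, p_ u = Some v.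
Proof.
move=> Vv; have [h /embedding_diagram hd] := generic_universal hB K_UVpair.
have e : p_ (h true) = Some (h false) by apply/(hd sP true false false).
have [_ Vw] := lK_p_range KB e.
have [alpha aiso av] : exists2 alpha : B -> B, isomorphism alpha &
    forall x x', List.In (x, x') [:: (h false, v)] -> alpha x = x'.
  apply: homogeneous; apply: (piso_addV (piso_nil _ _ _)) => //; by case.
exists (alpha (h true)); rewrite -(av (h false) v); last by left.
exact/(iso_diagram aiso sP _ _ (h false)).
Qed.

End Generic.

(** * Elementarity *)

(** Unlike [piso], this is symmetric in the two structures: transfer is proved in one direction only
    and reversed by [link_sym]. *)
Record link (M N : structure L) (r : M -> N -> Prop) : Prop := {
  link_eq : forall x x' y y', r x x' -> r y y' -> (x = y <-> x' = y');
  link_at : forall s x x' y y' z z', r x x' -> r y y' -> r z z' ->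
    (diagram s x y z <-> diagram s x' y' z');
  link_dom : closed_under [set x | exists x', r x x'];
  link_ran : closed_under [set x' | exists x, r x x'] }.

Lemma link_sym (M N : structure L) (r : M -> N -> Prop) :
  link r -> link (fun x' x => r x x').
Proof.
case=> re ra rd rr; split=> //.
- by move=> x x' y y' xr yr; rewrite (re _ _ _ _ xr yr).
- by move=> s x x' y y' z z' xr yr zr; rewrite (ra s _ _ _ _ _ _ xr yr zr).
Qed.

Definition sum_rel (M N : Type) (r : M -> N -> Prop) (x : M + nat) (y : N + nat) : Prop :=
  match x, y with
  | inl a, inl b => r a b
  | inr m, inr n => m = n
  | _, _ => False
  end.

Section Link.
Variables (M N : structure L) (r : M -> N -> Prop).
Hypothesis rl : link r.

Lemma link_p x x' y : r x x' -> p_ x = Some y -> exists2 y', r y y' & p_ x' = Some y'.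
Proof.
move=> xr e; have [y' yr] : exists y', r y y' by apply: (link_dom rl).1 e; exists x'.
by exists y' => //; apply/(link_at rl sP xr yr yr).
Qed.

Lemma link_f n x x' y y' z : r x x' -> r y y' -> f_ n x y = Some z ->
  exists2 z', r z z' & f_ n x' y' = Some z'.
Proof.
move=> xr yr e; have [z' zr] : exists z', r z z'.
  by apply: (link_dom rl).2 e; [exists x'|exists y'].
by exists z' => //; apply/(link_at rl (sF n) xr yr zr).
Qed.

Lemma link_cl (Z : set M) (Z' : set N) x :
  (forall z, Z z -> exists2 z', r z z' & Z' z') -> cl Z x ->
  exists2 x', r x x' & cl Z' x'.
Proof.
move=> ZZ'; elim=> {x} [x /ZZ'[x' xr Zx']|n b c y _ [b' br clb] _ [c' cr clc] e].
  by exists x' => //; exact: cl_base.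
by have [y' yr e'] := link_f br cr e; exists y' => //; exact: cl_step e'.
Qed.

Lemma card_le_cl (Z : set M) (Z' : set N) :
  (forall z, Z z -> exists2 z', r z z' & Z' z') -> cl Z #<= cl Z'.
Proof.
move=> ZZ'; apply/card_le_inj_fun.
have /choice[g gP] : forall x : cl Z, exists x' : cl Z', r (val x) (val x').
  move=> [x /= /set_mem clx]; have [x' xr clx'] := link_cl ZZ' clx.
  by exists (exist _ x' (mem_set clx')).
by exists g => x y e; apply/val_inj/(link_eq rl (gP x) (gP y)); rewrite e.
Qed.

End Link.

Section Link_Bprime.
Variables (M N : structure L) (r : M -> N -> Prop).
Hypothesis rl : link r.

(** Since [r] is injective and closed on both sides, it matches the two closures point by point.
    This is why [h], though not a symbol of [L], is preserved. *)
Lemma card_cl3 a b c a' b' c' : r a a' -> r b b' -> r c c' ->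
  cl [set a; b; c] #= cl [set a'; b'; c'].
Proof.
move=> ar br cr; rewrite card_eq_le; apply/andP; split.
  apply: (card_le_cl rl) => _ [[->|->]|->].
  - by exists a' => //; left; left.
  - by exists b' => //; left; right.
  - by exists c' => //; right.
apply: (card_le_cl (link_sym rl)) => _ [[->|->]|->].
- by exists a => //; left; left.
- by exists b => //; left; right.
- by exists c => //; right.
Qed.

Lemma link_fint (f : fsym L') (z : (far f).-tuple (Bprime M))
    (z' : (far f).-tuple (Bprime N)) y :
  (forall i, sum_rel r (tnth z i) (tnth z' i)) -> fint z = Some y ->
  exists2 y', sum_rel r y y' & fint z' = Some y'.
Proof.
case: f z z' => [[|n]|[||n]] z z' zz' /=.
- move: (zz' ord0); case: (tnth z ord0) (tnth z' ord0) => [a|m] [a'|m'] //= ar.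
  case e: (p_ a) => [b|//] [<-]; have [b' br ->] := link_p rl ar e.
  by exists (inl b').
- move: (zz' ord0) (zz' ord_max).
  case: (tnth z ord0) (tnth z' ord0) => [a|m] [a'|m'] //= ar.
  case: (tnth z ord_max) (tnth z' ord_max) => [b|m] [b'|m'] //= br.
  case e: (f_ n a b) => [c|//] [<-]; have [c' cr ->] := link_f rl ar br e.
  by exists (inl c').
- move: (zz' ord0) (zz' ord_max).
  case: (tnth z ord0) (tnth z' ord0) => [a|m] [a'|m'] //= ar.
  case: (tnth z ord_max) (tnth z' ord_max) => [b|m] [b'|m'] //= br.
  have -> : [set n | R n a b] = [set n | R n a' b'].
    by apply/seteqP; split=> n /(link_at rl (sR n) ar br br).
  by case: (the _) => [n|//] [<-]; exists (inr n).
- move: (zz' i0) (zz' i1) (zz' i2).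
  case: (tnth z i0) (tnth z' i0) => [a|m] [a'|m'] //= ar.
  case: (tnth z i1) (tnth z' i1) => [b|m] [b'|m'] //= br.
  case: (tnth z i2) (tnth z' i2) => [c|m] [c'|m'] //= cr.
  have -> : [set n | cl [set a; b; c] #= `I_n] = [set n | cl [set a'; b'; c'] #= `I_n].
    by apply/seteqP; split=> n /=; rewrite (card_eql (card_cl3 ar br cr)).
  by case: (the _) => [n|//] [<-]; exists (inr n).
- by move=> [<-]; exists (inr n).
Qed.

Lemma link_pint (P : psym L') (z : (par P).-tuple (Bprime M))
    (z' : (par P).-tuple (Bprime N)) :
  (forall i, sum_rel r (tnth z i) (tnth z' i)) -> pint z -> pint z'.
Proof.
case: P z z' => [[||n]|[]] z z' zz' /=.
- move=> [w Uw ez]; move: (zz' ord0); rewrite ez tnth_map.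
  case e: (tnth z' ord0) => [a'|//] /= ar; exists [tuple a'].
    by move: Uw; rewrite (tuple1E w) => /(link_at rl sU ar ar ar).
  by rewrite map_tuple1 -e; exact: tuple1E.
- move=> [w Uw ez]; move: (zz' ord0); rewrite ez tnth_map.
  case e: (tnth z' ord0) => [a'|//] /= ar; exists [tuple a'].
    by move: Uw; rewrite (tuple1E w) => /(link_at rl sV ar ar ar).
  by rewrite map_tuple1 -e; exact: tuple1E.
- move=> [w Uw ez]; move: (zz' ord0) (zz' ord_max); rewrite ez !tnth_map.
  case e: (tnth z' ord0) => [a'|//] /= ar.
  case e': (tnth z' ord_max) => [b'|//] /= br; exists [tuple a'; b'].
    by move: Uw; rewrite (tuple2E w) => /(link_at rl (sR n) ar br br).
  by rewrite map_tuple2 -e -e'; exact: tuple2E.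
- move=> [n e]; move: (zz' ord0); rewrite e.
  by case e': (tnth z' ord0) => [//|n'] _; exists n'.
Qed.

Lemma link_tval n (t : term L' n) (e : n.-tuple (Bprime M)) (e' : n.-tuple (Bprime N)) y :
  (forall i, sum_rel r (tnth e i) (tnth e' i)) -> tval e t y ->
  exists2 y', sum_rel r y y' & tval e' t y'.
Proof.
move=> ee'; elim: t y => [i|f ts ih] y /=; first by move=> <-; exists (tnth e' i).
move=> [z [zt zy]].
have /choice[g gP] : forall i, exists y', sum_rel r (tnth z i) y' /\ tval e' (ts i) y'.
  by move=> i; have [y' ? ?] := ih i _ (zt i); exists y'.
have [|y' yr ey'] := link_fint (z' := mktuple g) _ zy.
  by move=> i; rewrite tnth_mktuple; have [] := gP i.
exists y' => //; exists (mktuple g); split=> // i.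
by rewrite tnth_mktuple; have [] := gP i.
Qed.

Lemma sum_rel_eq x x' y y' : sum_rel r x x' -> sum_rel r y y' -> (x = y <-> x' = y').
Proof.
case: x x' y y' => [a|m] [a'|m'] [b|n] [b'|n'] //=.
  by move=> ar br; split=> -[/(link_eq rl ar br) ->].
by move=> -> ->; split=> -[->].
Qed.

End Link_Bprime.

Section Elementary.
Variables (B : structure L) (hB : generic B).
Variables (N : structure L) (bf : back_and_forth B setT (@diagram N)).

Definition pairs (T : Type) (r : seq (T * B)) : T -> B -> Prop :=
  fun x b => List.In (x, b) r.

Lemma piso_link (r : seq (N * B)) : piso setT (@diagram N) r -> link (pairs r).
Proof.
move=> rP; split.
- exact: piso_eq rP.
- exact: piso_at rP.
- have [cp cf] := piso_dom_closed bf rP; split=> [x y|n x y z].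
    by move=> xr; exact: cp.
  by move=> xr yr; exact: cf.
- exact: piso_ran rP.
Qed.

Lemma sum_rel_incl (T : Type) (r r' : seq (T * B)) x y : List.incl r r' ->
  sum_rel (pairs r) x y -> sum_rel (pairs r') x y.
Proof. by move=> rr'; case: x y => [a|m] [b|n] //=; exact: rr'. Qed.

(** The Ehrenfeucht-Fraisse argument. At a quantifier, a point of the [L]-part is answered by
    extending [r], and a point of [D] by the point with the same index. *)
Lemma piso_sat n (phi : formula L' n) (r : seq (N * B))
    (e : n.-tuple (Bprime N)) (e' : n.-tuple (Bprime B)) :
  piso setT (@diagram N) r -> (forall i, sum_rel (pairs r) (tnth e i) (tnth e' i)) ->
  (sat phi e <-> sat phi e').
Proof.
elim: {n} phi r e e' => [n|n t u|n P ts|n phi ihphi psi ihpsi|n phi ih] r e e' rP ee' //=.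
- have rl := piso_link rP; have rl' := link_sym rl.
  have e'e i : sum_rel (fun x y => pairs r y x) (tnth e' i) (tnth e i).
    by move: (ee' i); case: (tnth e i) (tnth e' i) => [a|m] [b|k] //=.
  split=> -[y [ty uy]].
    have [y1 yr1 ty1] := link_tval rl ee' ty; have [y2 yr2 uy2] := link_tval rl ee' uy.
    by exists y1; split=> //; rewrite ((sum_rel_eq rl yr1 yr2).1 erefl).
  have [y1 yr1 ty1] := link_tval rl' e'e ty; have [y2 yr2 uy2] := link_tval rl' e'e uy.
  by exists y1; split=> //; rewrite ((sum_rel_eq rl' yr1 yr2).1 erefl).
- have rl := piso_link rP; have rl' := link_sym rl.
  have e'e i : sum_rel (fun x y => pairs r y x) (tnth e' i) (tnth e i).
    by move: (ee' i); case: (tnth e i) (tnth e' i) => [a|m] [b|k] //=.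
  split=> -[z [zt Pz]].
    have /choice[g gP] : forall i, exists y', sum_rel (pairs r) (tnth z i) y' /\ tval e' (ts i) y'.
      by move=> i; have [y' ? ?] := link_tval rl ee' (zt i); exists y'.
    exists (mktuple g); split=> [i|]; first by rewrite tnth_mktuple; have [] := gP i.
    apply: (link_pint rl) Pz => i.
    by rewrite tnth_mktuple; have [] := gP i.
  have /choice[g gP] : forall i, exists y',
      sum_rel (fun x y => pairs r y x) (tnth z i) y' /\ tval e (ts i) y'.
    by move=> i; have [y' ? ?] := link_tval rl' e'e (zt i); exists y'.
  exists (mktuple g); split=> [i|]; first by rewrite tnth_mktuple; have [] := gP i.
  apply: (link_pint rl') Pz => i.
  by rewrite tnth_mktuple; have [] := gP i.
- by rewrite (ihphi _ _ _ rP ee') (ihpsi _ _ _ rP ee').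
- have cons_rel r' a b : List.incl r r' -> sum_rel (pairs r') a b ->
      forall i, sum_rel (pairs r') (tnth [tuple of a :: e] i) (tnth [tuple of b :: e'] i).
    move=> rr' ab i; case: (unliftP ord0 i) => [j|] ->; last by rewrite !tnth0.
    by rewrite !tnthS; exact: sum_rel_incl rr' (ee' j).
  split=> H.
    case=> [b|m].
      have [r' [r'P rr' [x xr]]] := (bf rP).2 b.
      by apply/(ih r' [tuple of inl x :: e] _ r'P) => //; exact: cons_rel.
    by apply/(ih r [tuple of inr m :: e] _ rP) => //; exact: cons_rel.
  case=> [x|m].
    have [r' [r'P rr' [b xr]]] := (bf rP).1 x I.
    by apply/(ih r' _ [tuple of inl b :: e'] r'P) => //; exact: cons_rel.
  by apply/(ih r _ [tuple of inr m :: e'] rP) => //; exact: cons_rel.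
Qed.

End Elementary.

(** * Definability *)

(** Formulas are produced from closure properties of this class instead of being written out, so
    that the properties keep their semantic form. One formula has to serve all structures, since it
    is moved between models. *)
Definition definable (Lg : language) n (P : forall M : structure Lg, n.-tuple M -> Prop) :=
  exists phi : formula Lg n, forall (M : structure Lg) (e : n.-tuple M), sat phi e <-> P M e.

Section Definable.
Variable Lg : language.
Implicit Types (n m k : nat).

Lemma definable_sat n (phi : formula Lg n) : definable (fun M e => @sat _ M _ phi e).
Proof. by exists phi. Qed.

Lemma definable_ext n (P Q : forall M : structure Lg, n.-tuple M -> Prop) :
  (forall M e, P M e <-> Q M e) -> definable P -> definable Q.
Proof. by move=> PQ [phi h]; exists phi => M e; rewrite h. Qed.

Lemma definable_imp n (P Q : forall M : structure Lg, n.-tuple M -> Prop) :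
  definable P -> definable Q -> definable (fun M e => P M e -> Q M e).
Proof. by move=> [phi h] [psi h']; exists (Imp phi psi) => M e /=; rewrite h h'. Qed.

(** [Q] is any proposition of the metalanguage. In this way facts about a fixed tuple of [B] are
    written into a formula. *)
Lemma definable_const n (Q : Prop) : definable (fun (M : structure Lg) (_ : n.-tuple M) => Q).
Proof.
have [q|nq] := pselect Q; last by exists (Bot Lg n) => M e; split.
by exists (Neg (Bot Lg n)) => M e; split => // _ [].
Qed.

Lemma definable_not n (P : forall M : structure Lg, n.-tuple M -> Prop) :
  definable P -> definable (fun M e => ~ P M e).
Proof. by move=> dP; apply: definable_imp dP _; exact: definable_const. Qed.

Lemma definable_and n (P Q : forall M : structure Lg, n.-tuple M -> Prop) :
  definable P -> definable Q -> definable (fun M e => P M e /\ Q M e).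
Proof.
move=> dP dQ; apply: definable_ext (definable_not (definable_imp dP (definable_not dQ))).
move=> M e; split=> [H|[p q] /(_ p)//].
by split; apply: contrapT => np; apply: H => p; [case: np|exact: np].
Qed.

Lemma definable_or n (P Q : forall M : structure Lg, n.-tuple M -> Prop) :
  definable P -> definable Q -> definable (fun M e => P M e \/ Q M e).
Proof.
move=> dP dQ; apply: definable_ext (definable_imp (definable_not dP) dQ).
by move=> M e; split=> [H|[]//]; have [p|/H] := pselect (P M e); [left|right].
Qed.

Lemma definable_iff n (P Q : forall M : structure Lg, n.-tuple M -> Prop) :
  definable P -> definable Q -> definable (fun M e => P M e <-> Q M e).
Proof. by move=> dP dQ; apply: definable_and; exact: definable_imp. Qed.

Lemma definable_seq n (I : Type) (l : seq I) (P : I -> forall M : structure Lg, n.-tuple M -> Prop) :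
  (forall i, definable (P i)) -> definable (fun M e => forall i, List.In i l -> P i M e).
Proof.
move=> dP; elim: l => [|i l ih].
  by apply: definable_ext (definable_const n True) => M e; split.
apply: definable_ext (definable_and (dP i) ih) => M e; split.
  by case=> Pi Pl j [<-|/Pl].
by move=> H; split=> [|j jl]; apply: H; [left|right].
Qed.

Lemma In_enum (I : finType) (i : I) : List.In i (enum I).
Proof.
have: i \in enum I by rewrite mem_enum.
by elim: (enum I) => //= j l ih; rewrite inE => /predU1P[->|/ih]; [left|right].
Qed.

Lemma definable_forall n (I : finType) (P : I -> forall M : structure Lg, n.-tuple M -> Prop) :
  (forall i, definable (P i)) -> definable (fun M e => forall i, P i M e).
Proof.
move=> /(definable_seq (enum I)); apply: definable_ext => M e.
by split=> H i => [|_]; apply: H; exact: In_enum.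
Qed.

Lemma definable_exists n (I : finType) (P : I -> forall M : structure Lg, n.-tuple M -> Prop) :
  (forall i, definable (P i)) -> definable (fun M e => exists i, P i M e).
Proof.
move=> dP.
apply: definable_ext (definable_not (definable_forall (fun i => definable_not (dP i)))).
by move=> M e; split=> [/existsNP[i /contrapT Pi]|[i Pi] /(_ i)]; [exists i|].
Qed.

Lemma definable_all n m (P : forall M : structure Lg, (n + m).-tuple M -> Prop) :
  definable P -> definable (fun M (e : m.-tuple M) => forall x : n.-tuple M, P M (cat_tuple x e)).
Proof.
elim: n P => [|n ih] P dP.
  apply: definable_ext dP => M e; split=> [Pe x|/(_ [tuple])].
    by rewrite (tuple0 x) (_ : cat_tuple _ _ = e) //; exact: val_inj.
  by rewrite (_ : cat_tuple _ _ = e) //; exact: val_inj.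
have dQ : definable (fun M (e : (n + m).-tuple M) => forall a : M, P M [tuple of a :: e]).
  by case: dP => phi h; exists (@All _ (n + m) phi) => M e /=; split=> H a; apply/h.
apply: definable_ext (ih _ dQ) => M e; split=> [H x|H x a].
  case: x / (tupleP x) => a x.
  have := H x a; congr (P M _); exact: val_inj.
have := H [tuple of a :: x]; congr (P M _); exact: val_inj.
Qed.

Lemma definable_ex n m (P : forall M : structure Lg, (n + m).-tuple M -> Prop) :
  definable P -> definable (fun M (e : m.-tuple M) => exists x : n.-tuple M, P M (cat_tuple x e)).
Proof.
move=> /definable_not/definable_all/definable_not; apply: definable_ext => M e.
by split=> [/existsNP[x /contrapT Px]|[x Px] /(_ x)]; [exists x|].
Qed.

(** Sentences are what a theory transfers between its models; every later transfer from [Bprime B]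
    passes through such a universal closure. *)
Lemma definable_closure n (P : forall M : structure Lg, n.-tuple M -> Prop) :
  definable P -> exists sigma : formula Lg 0, forall M : structure Lg,
    sat sigma ([tuple] : 0.-tuple M) <-> forall x : n.-tuple M, P M x.
Proof.
elim: n P => [|n ih] P dP.
  case: dP => phi h; exists phi => M; rewrite h; split=> [H x|]; last exact.
  by rewrite (tuple0 x).
have [|sigma h] := ih (fun M x => forall a, P M [tuple of a :: x]).
  by case: dP => phi h; exists (All phi) => M e /=; split=> H a; apply/h.
exists sigma => M; rewrite h; split=> [H x|H x a]; last exact: H.
by case: x / (tupleP x) => a x; exact: H.
Qed.

Lemma definable_eq n (i j : 'I_n) : definable (fun (M : structure Lg) e => tnth e i = tnth e j :> M).
Proof.
exists (Eq (Var Lg i) (Var Lg j)) => M e /=; split=> [[y [-> ->]]//|->].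
by exists (tnth e j).
Qed.

Lemma definable_pint n (P : psym Lg) (v : 'I_(par P) -> 'I_n) :
  definable (fun (M : structure Lg) e => pint [tuple tnth e (v i) | i < par P] : Prop).
Proof.
exists (Pred (fun i => Var Lg (v i))) => M e /=; split=> [[z [ez Pz]]|Pe].
  by rewrite (_ : mktuple _ = z) //; apply: eq_from_tnth => i; rewrite tnth_mktuple.
by exists [tuple tnth e (v i) | i < par P]; split=> // i; rewrite tnth_mktuple.
Qed.

Lemma definable_fint n (f : fsym Lg) (v : 'I_(far f) -> 'I_n) (j : 'I_n) :
  definable (fun (M : structure Lg) e =>
    fint [tuple tnth e (v i) | i < far f] = Some (tnth e j)).
Proof.
exists (Eq (App (fun i => Var Lg (v i))) (Var Lg j)) => M e /=; split.
  move=> [y [[z [ez zj]] ->]].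
  by rewrite (_ : mktuple _ = z) //; apply: eq_from_tnth => i; rewrite tnth_mktuple.
move=> fe; exists (tnth e j); split=> //.
by exists [tuple tnth e (v i) | i < far f]; split=> // i; rewrite tnth_mktuple.
Qed.

End Definable.

Lemma definable_reduct (L1 L2 : language) n (P : forall M : structure L1, n.-tuple M -> Prop) :
  definable P -> definable (fun (M : structure (lang_sum L1 L2)) e => P (reduct M) e).
Proof.
have liftt k (t : term L1 k) : exists t' : term (lang_sum L1 L2) k,
    forall (M : structure (lang_sum L1 L2)) (e : k.-tuple M) y,
      tval e t' y <-> @tval L1 (reduct M) _ e t y.
  elim: t => [i|f ts /choice[ts' h]]; first by exists (Var _ i).
  exists (@App (lang_sum L1 L2) k (inl f) ts') => M e y /=.
  by split=> -[z [zt zy]]; exists z; split=> // i; apply/h; exact: zt.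
case=> phi h; suff [psi h'] : exists psi : formula (lang_sum L1 L2) n,
    forall (M : structure (lang_sum L1 L2)) (e : n.-tuple M),
      sat psi e <-> @sat L1 (reduct M) _ phi e.
  by exists psi => M e; rewrite h' h.
elim: {n P h} phi => [n|n t u|n Q ts|n phi [phi' h] psi [psi' h']|n phi [phi' h]].
- by exists (Bot _ n).
- have [[t' ht] [u' hu]] := (liftt _ t, liftt _ u); exists (Eq t' u') => M e /=.
  by split=> -[y [ty uy]]; exists y; split; [apply/ht|apply/hu|apply/ht|apply/hu].
- have /choice[ts' hts] := fun i => liftt _ (ts i).
  exists (@Pred (lang_sum L1 L2) n (inl Q) ts') => M e /=.
  by split=> -[z [zt zy]]; exists z; split=> // i; apply/hts; exact: zt.
- by exists (Imp phi' psi') => M e /=; rewrite h h'.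
- by exists (All phi') => M e /=; split=> H a; apply/h; exact: H.
Qed.

Lemma mktuple1E (T : Type) (g : 'I_1 -> T) : mktuple g = [tuple g ord0].
Proof. by rewrite (tuple1E (mktuple g)) tnth_mktuple. Qed.

Lemma mktuple2E (T : Type) (g : 'I_2 -> T) : mktuple g = [tuple g ord0; g ord_max].
Proof. by rewrite (tuple2E (mktuple g)) !tnth_mktuple. Qed.

Lemma definable_diagram n s (i j k : 'I_n) :
  definable (fun (M : structure L) e => diagram s (tnth e i : M) (tnth e j) (tnth e k)).
Proof.
pose v2 (b : 'I_2) := if b == ord0 then i else j.
case: s => [||||m|m]; rewrite /diagram.
- exact: definable_const.
- apply: definable_ext (@definable_pint L n LU (fun=> i)) => M e.
  by rewrite mktuple1E.
- apply: definable_ext (@definable_pint L n LV (fun=> i)) => M e.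
  by rewrite mktuple1E.
- apply: definable_ext (@definable_fint L n Lp (fun=> i) j) => M e.
  by rewrite mktuple1E.
- apply: definable_ext (@definable_fint L n (Lf m) v2 k) => M e.
  by rewrite mktuple2E.
- apply: definable_ext (@definable_pint L n (LR m) v2) => M e.
  by rewrite mktuple2E.
Qed.

(** * Formulas with parameters, and their finite supports *)

Section Constants.
Variables (L1 : language) (A : Type).
Notation LA := (lang_sum L1 (const_lang A)).

Definition interprets (M : structure LA) (c : A -> M) :=
  forall (a : A) z, @fint LA M (inr a) z = Some (c a).

(** Constants become variables appended after the free ones. The same [chi'] serves every structure
    and every interpretation [c], which lets the parameters be reread in [B]. *)
Definition supports n (chi : formula LA n) (s : seq A) :=
  exists chi' : formula L1 (n + size s), forall (M : structure LA) (c : A -> M),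
    interprets c -> forall e : n.-tuple M,
    sat chi e <-> @sat L1 (reduct M) _ chi' (cat_tuple e (map_tuple c (in_tuple s))).

Lemma In_tnth (T : Type) (s : seq T) a : List.In a s -> exists i, tnth (in_tuple s) i = a.
Proof.
elim: s => //= b s ih [->|/ih[i <-]].
  by exists ord0; rewrite (tnth_nth a).
exists (lift ord0 i); rewrite !(tnth_nth a) /=; by [].
Qed.

Lemma tnth_In (T : Type) (s : seq T) i : List.In (tnth (in_tuple s) i) s.
Proof.
have nth_In (a : T) k : k < size s -> List.In (nth a s k) s.
  by elim: s k {i} => //= b s ih [_|k /ih]; [left|right].
by rewrite (tnth_nth (tnth (in_tuple s) i)); exact: nth_In.
Qed.

Lemma incl_bound (I : finType) (T : Type) (g : I -> seq T) :
  exists s, forall i, List.incl (g i) s.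
Proof.
suff [s h] : exists s, forall i, List.In i (enum I) -> List.incl (g i) s.
  by exists s => i; apply: h; exact: In_enum.
elim: (enum I) => [|i l [s h]]; first by exists [::].
exists (g i ++ s) => j [<-|jl] x xg; apply/List.in_app_iff; [by left|right].
exact: h jl _ xg.
Qed.

(** All larger lists are allowed as supports, so that several formulas can share one. *)
Lemma supports_ex n (chi : formula LA n) :
  exists s0, forall s, List.incl s0 s -> supports chi s.
Proof.
pose val_of (M : structure LA) k (e : k.-tuple M) s (c : A -> M) : (k + size s).-tuple M :=
  cat_tuple e (map_tuple c (in_tuple s)).
have term_ex k (t : term LA k) : exists s0, forall s, List.incl s0 s ->
    exists t' : term L1 (k + size s), forall (M : structure LA) (c : A -> M),
    interprets c -> forall (e : k.-tuple M) y,
    tval e t y <-> @tval L1 (reduct M) _ (val_of M k e s c) t' y.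
  elim: t => [i|[f|a] ts].
  - exists [::] => s _; exists (Var L1 (lshift (size s) i)) => M c _ e y /=.
    by rewrite tnth_lshift.
  - move=> /choice[g h]; have [s0 gs] := incl_bound g; exists s0 => s s0s.
    have /choice[ts' hts] := fun i => h i s (List.incl_tran (gs i) s0s).
    exists (@App L1 _ f ts') => M c Mc e y /=.
    by split=> -[z [zt zy]]; exists z; split=> // i; apply/(hts i M c Mc); exact: zt.
  - move=> _; exists [:: a] => s sa; have [i ia] := In_tnth (sa a (or_introl erefl)).
    exists (Var L1 (rshift k i)) => M c Mc e y /=.
    rewrite tnth_rshift tnth_map ia; split=> [[z [_]]|<-].
      by rewrite Mc => -[].
    by exists [tuple]; split=> [[]|]; [|exact: Mc].
elim: chi => [k|k t u|k [Q|[]] ts|k phi [s1 h1] psi [s2 h2]|k phi [s1 h1]].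
- by exists [::] => s _; exists (Bot _ _).
- have [s1 h1] := term_ex _ t; have [s2 h2] := term_ex _ u.
  exists (s1 ++ s2) => s /List.incl_app_inv[/h1[t' ht] /h2[u' hu]].
  exists (Eq t' u') => M c Mc e /=.
  by split=> -[y [ty uy]]; exists y; split;
    [apply/(ht M c Mc)|apply/(hu M c Mc)|apply/(ht M c Mc)|apply/(hu M c Mc)].
- have /choice[g h] := fun i => term_ex _ (ts i).
  have [s0 gs] := incl_bound g; exists s0 => s s0s.
  have /choice[ts' hts] := fun i => h i s (List.incl_tran (gs i) s0s).
  exists (@Pred L1 _ Q ts') => M c Mc e /=.
  by split=> -[z [zt zy]]; exists z; split=> // i; apply/(hts i M c Mc); exact: zt.
- exists (s1 ++ s2) => s /List.incl_app_inv[/h1[phi' h] /h2[psi' h']].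
  by exists (Imp phi' psi') => M c Mc e /=; rewrite (h M c Mc) (h' M c Mc).
- exists s1 => s /h1[phi' h]; exists (@All L1 (k + size s) phi') => M c Mc e /=.
  have consE a : val_of M k.+1 [tuple of a :: e] s c =
      [tuple of a :: cat_tuple e (map_tuple c (in_tuple s))] by exact: val_inj.
  by split=> H a; have := H a; rewrite (h M c Mc) -consE.
Qed.

End Constants.

(** * The type of a tuple from V *)

Lemma definable_diagram' n s (i j k : 'I_n) :
  definable (fun (M : structure L') e => @diagram (reduct M) s (tnth e i) (tnth e j) (tnth e k)).
Proof. exact: definable_reduct (definable_diagram s i j k). Qed.

Lemma definable_diagram_const (A : Type) n s (i j k : 'I_n) :
  definable (fun (M : structure (lang_sum L' (const_lang A))) e =>
    @diagram (reduct (reduct M)) s (tnth e i) (tnth e j) (tnth e k)).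
Proof. exact: definable_reduct (definable_diagram' s i j k). Qed.

Definition zip_tuples (S T : Type) k (x : k.-tuple S) (y : k.-tuple T) : seq (S * T) :=
  [seq (tnth x i, tnth y i) | i <- enum 'I_k].

Lemma In_zip_tuples (S T : Type) k (x : k.-tuple S) (y : k.-tuple T) a b :
  List.In (a, b) (zip_tuples x y) <-> exists i, a = tnth x i /\ b = tnth y i.
Proof.
rewrite List.in_map_iff; split=> [[i [[<- <-] _]]|[i [-> ->]]]; first by exists i.
by exists i; split=> //; exact: In_enum.
Qed.

Lemma diagram_Bprime (N : structure L) s (x y z : N) :
  @diagram (reduct (Bprime N)) s (inl x) (inl y) (inl z) <-> diagram s x y z.
Proof.
case: s => [||||n|n]; rewrite /diagram //.
- split=> [[w Uw /(congr1 (fun t => tnth t ord0))]|Ux]; last first.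
    by exists [tuple x] => //; exact: val_inj.
  by rewrite tnth_map => -[->]; rewrite (tuple1E w) in Uw.
- split=> [[w Uw /(congr1 (fun t => tnth t ord0))]|Ux]; last first.
    by exists [tuple x] => //; exact: val_inj.
  by rewrite tnth_map => -[->]; rewrite (tuple1E w) in Uw.
- rewrite {1}/p_ /=; case: (p_ x) => [w|] //=.
  by split=> -[->].
- rewrite {1}/f_ /=; case: (f_ n x y) => [w|] //=.
  by split=> -[->].
- split=> [[w Uw e]|Ux]; last by exists [tuple x; y] => //; exact: val_inj.
  have := congr1 (fun t => tnth t ord0) e; have := congr1 (fun t => tnth t ord_max) e.
  by rewrite !tnth_map => -[->] [->]; rewrite (tuple2E w) in Uw.
Qed.

Lemma V_Bprime (N : structure L) (x : reduct (Bprime N)) : V x -> exists b, x = inl b.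
Proof.
case=> w _ /(congr1 (fun t => tnth t ord0)); rewrite tnth_map => e.
by exists (tnth w ord0).
Qed.

Lemma U_Bprime (N : structure L) (x : reduct (Bprime N)) : U x -> exists b, x = inl b.
Proof.
case=> w _ /(congr1 (fun t => tnth t ord0)); rewrite tnth_map => e.
by exists (tnth w ord0).
Qed.

Section With_const.
Variables (L1 : language) (M : structure L1) (A : Type) (c : A -> M).

Definition with_const : structure (lang_sum L1 (const_lang A)) :=
  @Structure (lang_sum L1 (const_lang A)) M
    (fun f => match f with
              | inl f1 => @fint _ M f1
              | inr a => fun=> Some (c a)
              end)
    (fun P => match P with
              | inl P1 => @pint _ M P1
              | inr P2 => match P2 with end
              end).

Lemma with_const_interprets : @interprets _ _ with_const c.
Proof. by []. Qed.

End With_const.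

Section Generic.
Variables (B : structure L) (hB : generic B).

Let KB : locally_K B := generic_locally_K hB.
Let bfB := back_and_forth_generic hB.

Lemma diagram_V s (x y z : B) : V x -> V y -> V z ->
  (diagram s x y z <-> match s with sD | sV => True | _ => False end).
Proof.
move=> Vx Vy Vz; have nU (w : B) : V w -> U w -> False by move=> Vw Uw; case: (lK_disj KB Uw Vw).
case: s => [||||n|n]; rewrite /diagram; split=> // e; first by case: (nU _ Vx e).
- by have [/(nU _ Vx)] := lK_p_range KB e.
- by have [/(nU _ Vx)] := lK_f_range KB e.
- by have [/(nU _ Vx)] := lK_RU KB e.
Qed.

(** No function has an argument in [V], so every finite subset of [V] is closed, and by [diagram_V]
    its diagram carries no information. *)
Lemma piso_V m (v v' : m.-tuple B) : (forall i, V (tnth v i)) -> (forall i, V (tnth v' i)) ->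
  (forall i j, tnth v i = tnth v j <-> tnth v' i = tnth v' j) ->
  piso setT (@diagram B) (zip_tuples v v').
Proof.
move=> Vv Vv' vv'; split=> //.
- by move=> x x' y y' /In_zip_tuples[i [-> ->]] /In_zip_tuples[j [-> ->]].
- move=> s x x' y y' z z' /In_zip_tuples[i [-> ->]] /In_zip_tuples[j [-> ->]].
  by move=> /In_zip_tuples[k [-> ->]]; rewrite !diagram_V.
- split=> [x y [x0 /In_zip_tuples[i [_ ->]]] e|n x y z [x0 /In_zip_tuples[i [_ ->]]] _ e].
    by have [] := lK_disj KB (lK_p_range KB e).1 (Vv' i).
  by have [Ux _ _] := lK_f_range KB e; have [] := lK_disj KB Ux (Vv' i).
Qed.

(** By [piso_V] and [piso_sat], the sentence that every tuple from [V] with the equality pattern of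
    [v] satisfies [psi] holds in [Bprime B] as soon as [v] satisfies [psi]. It is used for [phi] and
    for its negation. *)
Lemma V_type m (phi : formula L' m) (v : m.-tuple B) (M : structure L') (a : m.-tuple M) :
  model (Th (Bprime B)) M -> (forall i, V (tnth v i)) ->
  (forall i, V (tnth a i : reduct M)) ->
  (forall i j, tnth a i = tnth a j <-> tnth v i = tnth v j) ->
  (sat phi a <-> sat phi (map_tuple inl v : m.-tuple (Bprime B))).
Proof.
move=> MT Vv Va av.
have key (psi : formula L' m) : sat psi (map_tuple inl v : m.-tuple (Bprime B)) -> sat psi a.
  move=> psiv.
  have [|sigma hsigma] := @definable_closure L' m (fun M a =>
      ((forall i, V (tnth a i : reduct M)) /\
       (forall ij : 'I_m * 'I_m, tnth a ij.1 = tnth a ij.2 <-> tnth v ij.1 = tnth v ij.2)) ->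
      sat psi a).
    apply: definable_imp (definable_sat psi); apply: definable_and.
      apply: definable_forall => i.
      exact: (definable_diagram' sV i i i).
    apply: definable_forall => ij; apply: definable_iff; first exact: definable_eq.
    exact: definable_const.
  have /MT/hsigma : Th (Bprime B) sigma.
    apply/hsigma => b [Vb bv].
    have /choice[b' hb'] : forall i, exists x, tnth b i = inl x.
      by move=> i; exact: V_Bprime (Vb i).
    have eb : b = map_tuple inl (mktuple b').
      by apply: eq_from_tnth => i; rewrite tnth_map tnth_mktuple.
    apply/(piso_sat bfB psi (r := zip_tuples v (mktuple b')) (e := map_tuple inl v)) => //.
      apply: piso_V => // [i|i j]; rewrite !tnth_mktuple.
        by apply/(diagram_Bprime sV _ (b' i) (b' i)); rewrite -hb'; exact: Vb.
      by rewrite -(bv (i, j)) /= !hb'; split=> [[->]|->].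
    by move=> i; rewrite eb 2!tnth_map /= /pairs In_zip_tuples; exists i.
  by apply; split=> // -[i j]; exact: av.
split; last exact: key.
move=> phia; apply: contrapT => nphi.
by have := key (Neg phi) nphi; exact.
Qed.

(** By [V_type] this is all that matters for a reading of the parameters of [s] in [B]: any two good
    readings give the same truth values to sentences supported by [s]. *)
Definition good (A : Type) (c : A -> B) (s : seq A) :=
  (forall a, List.In a s -> V (c a)) /\
  (forall a b, List.In a s -> List.In b s -> c a = c b -> a = b).

Lemma extend_good (A : Type) (c : A -> B) (s0 s : seq A) : good c s0 ->
  exists c', (forall a, List.In a s0 -> c' a = c a) /\ good c' (s0 ++ s).
Proof.
move=> gc; elim: s => [|a s [c' [c'c [Vc' Ic']]]]; first by exists c; rewrite cats0.
have [asg|nas] := pselect (List.In a (s0 ++ s)).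
  exists c'; split=> //.
  have sub b : List.In b (s0 ++ a :: s) -> List.In b (s0 ++ s).
    by rewrite !List.in_app_iff => -[h|[<-|h]]; [left|apply/List.in_app_iff|right].
  by split=> [b /sub/Vc'//|b b' /sub bs /sub bs']; exact: Ic'.
have [v Vv vn] := fresh_V hB (map c' (s0 ++ s)).
have sub b : List.In b (s0 ++ a :: s) -> b = a \/ b <> a /\ List.In b (s0 ++ s).
  have [->|ba] := pselect (b = a); first by left.
  by rewrite !List.in_app_iff => -[h|[/esym//|h]]; right; split=> //; [left|right].
pose c1 b := if pselect (b = a) then v else c' b.
have c1a : c1 a = v by rewrite /c1; case: pselect.
have c1n b : b <> a -> c1 b = c' b by rewrite /c1; case: pselect.
exists c1; split.
  move=> b bs; rewrite c1n ?c'c // => ba; apply: nas; rewrite -ba.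
  by apply/List.in_app_iff; left.
split=> [b /sub[->|[ba bs]]|b b' /sub[->|[ba bs]] /sub[->|[ba' bs']]] //.
- by rewrite c1a.
- by rewrite c1n //; exact: Vc'.
- by rewrite c1a c1n // => e; case: vn; rewrite e; apply/List.in_map_iff; exists b'.
- by rewrite c1a c1n // => e; case: vn; rewrite -e; apply/List.in_map_iff; exists b.
- by rewrite !c1n //; exact: Ic'.
Qed.

Definition Bc (A : Type) (c : A -> B) := with_const (fun a => inl (c a) : Bprime B).

Lemma supports_sat (A : Type) n (chi : formula (lang_sum L' (const_lang A)) n) s
    (N : structure L) (bf : back_and_forth B setT (@diagram N)) (cN : A -> N) (c : A -> B)
    (r : seq (N * B)) (e : n.-tuple (Bprime N)) (e' : n.-tuple (Bprime B)) :
  supports chi s -> piso setT (@diagram N) r ->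
  (forall a, List.In a s -> List.In (cN a, c a) r) ->
  (forall i, sum_rel (pairs r) (tnth e i) (tnth e' i)) ->
  (@sat _ (with_const (fun a => inl (cN a) : Bprime N)) _ chi e <-> @sat _ (Bc c) _ chi e').
Proof.
move=> [chi' h] rP cr ee'.
have hN := h (with_const (fun a => inl (cN a) : Bprime N)) _ (@with_const_interprets _ _ _ _) e.
have hB' := h (Bc c) _ (@with_const_interprets _ _ _ _) e'.
apply: iff_trans hN (iff_trans _ (iff_sym hB')).
apply: (@piso_sat B N bf _ chi' r) => // i; case: (split_ordP i) => j ->.
  by rewrite !tnth_lshift.
by rewrite !tnth_rshift !(tnth_map, tnth_map); apply: cr; exact: tnth_In.
Qed.

Lemma supports_agree (A : Type) n (chi : formula (lang_sum L' (const_lang A)) n) s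
    (c c' : A -> B) (e : n.-tuple (Bprime B)) :
  supports chi s -> (forall a, List.In a s -> c' a = c a) ->
  (@sat _ (Bc c) _ chi e <-> @sat _ (Bc c') _ chi e).
Proof.
move=> [chi' h] cc'.
have h1 := h (Bc c) _ (@with_const_interprets _ _ _ _) e.
have h2 := h (Bc c') _ (@with_const_interprets _ _ _ _) e.
apply: iff_trans h1 (iff_trans _ (iff_sym h2)).
rewrite (_ : map_tuple _ _ = map_tuple (fun a => inl (c' a) : Bprime B) (in_tuple s)) //.
by apply: eq_from_tnth => i; rewrite 2!tnth_map cc' //; exact: tnth_In.
Qed.

End Generic.

(** * Isolating formulas *)

Lemma definable_nullary (Lg : language) n (f : fsym Lg) (j : 'I_n) : far f = 0 ->
  definable (fun (M : structure Lg) e => forall z, @fint Lg M f z = Some (tnth e j)).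
Proof.
move=> f0; apply: definable_ext (@definable_fint Lg n f (fun=> j) j) => M e.
have z1 (z z' : (far f).-tuple M) : z = z'.
  by apply: eq_from_tnth => i; have := ltn_ord i; rewrite [X in _ < X]f0.
by split=> [h z|]; [rewrite (z1 z [tuple tnth e j | _ < far f])|exact].
Qed.

Section Isolation.
Variables (B : structure L) (hB : generic B).

Let KB : locally_K B := generic_locally_K hB.

Lemma bounded_R k (x : k.-tuple B) : exists m, forall i j, U (tnth x i) -> U (tnth x j) ->
  exists2 n, n < m & R n (tnth x i) (tnth x j).
Proof.
have /choice[g gP] : forall q : 'I_k * 'I_k, exists n,
    U (tnth x q.1) -> U (tnth x q.2) -> R n (tnth x q.1) (tnth x q.2).
  move=> [i j] /=; have [[Ui Uj]|nU] := pselect (U (tnth x i) /\ U (tnth x j)).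
    by have [n Rn] := lK_R_def KB Ui Uj; exists n.
  by exists 0 => Ui Uj; case: nU.
exists (\max_q g q).+1 => i j Ui Uj; exists (g (i, j)); last exact: gP.
by rewrite ltnS; exact: leq_bigmax.
Qed.

Definition syms_below (m : nat) : seq sym :=
  [:: sU; sV; sP] ++ [seq sF n | n <- iota 0 m] ++ [seq sR n | n <- iota 0 m].

Lemma In_iota n m : n < m -> List.In n (iota 0 m).
Proof.
move=> nm; have: n \in iota 0 m by rewrite mem_iota.
by elim: (iota 0 m) => //= a l ih; rewrite inE => /predU1P[->|/ih]; [left|right].
Qed.

Lemma In_syms_below m s :
  match s with sD => False | sF n | sR n => n < m | _ => True end ->
  List.In s (syms_below m).
Proof.
case: s => [||||n|n] // h.
- by left.
- by right; left.
- by right; right; left.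
- by do 3!right; apply/List.in_app_iff; left; apply/List.in_map_iff; exists n; split=> //; exact: In_iota.
- by do 3!right; apply/List.in_app_iff; right; apply/List.in_map_iff; exists n; split=> //; exact: In_iota.
Qed.

(* Beyond the indices of the relations holding in [x], all [f_n] are the first
   projection, so that finitely many atomic formulas determine the diagram. *)
Lemma piso_of_finite_diagram k (x y : k.-tuple B) m :
  closed_under [set b | exists i, b = tnth x i] ->
  (forall i j, U (tnth x i) -> U (tnth x j) -> exists2 n, n < m & R n (tnth x i) (tnth x j)) ->
  (forall i j, tnth x i = tnth x j <-> tnth y i = tnth y j) ->
  (forall s, List.In s (syms_below m) -> forall i j l,
    diagram s (tnth x i) (tnth x j) (tnth x l) <-> diagram s (tnth y i) (tnth y j) (tnth y l)) ->
  piso setT (@diagram B) (zip_tuples x y).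
Proof.
move=> cx Rm xy dxy.
have Uxy i : U (tnth x i) <-> U (tnth y i).
  exact: (dxy sU (In_syms_below (m := m) (s := sU) I) i i i).
have Rxy i j : U (tnth x i) -> U (tnth x j) ->
    exists n, [/\ n < m, R n (tnth x i) (tnth x j) & R n (tnth y i) (tnth y j)].
  move=> Ui Uj; have [n nm Rn] := Rm i j Ui Uj; exists n; split=> //.
  exact: (dxy (sR n) (In_syms_below (m := m) (s := sR n) nm) i j j).1.
have dxy' s i j l :
    diagram s (tnth x i) (tnth x j) (tnth x l) <-> diagram s (tnth y i) (tnth y j) (tnth y l).
  case: s => [||||n|n]; try exact/dxy/In_syms_below.
  - by [].
  - have [nm|mn] := ltnP n m; first exact/dxy/In_syms_below.
    split=> e.
      have [Ui Uj _] := lK_f_range KB e; have [n' [n'm Rx Ry]] := Rxy i j Ui Uj.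
      have n'n : n' <= n by exact: leq_trans (ltnW n'm) mn.
      move: e; rewrite /diagram (lK_R_f KB n'n Rx) (lK_R_f KB n'n Ry) => -[] /xy ->.
      by [].
    have [/Uxy Ui /Uxy Uj _] := lK_f_range KB e; have [n' [n'm Rx Ry]] := Rxy i j Ui Uj.
    have n'n : n' <= n by exact: leq_trans (ltnW n'm) mn.
    move: e; rewrite /diagram (lK_R_f KB n'n Rx) (lK_R_f KB n'n Ry) => -[] /xy ->.
    by [].
  - have [nm|mn] := ltnP n m; first exact/dxy/In_syms_below.
    split=> e.
      have [Ui Uj] := lK_RU KB e; have [n' [n'm Rx Ry]] := Rxy i j Ui Uj.
      by move: n'm; rewrite (lK_R_inj KB Rx e) ltnNge mn.
    have [/Uxy Ui /Uxy Uj] := lK_RU KB e; have [n' [n'm Rx Ry]] := Rxy i j Ui Uj.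
    by move: n'm; rewrite (lK_R_inj KB Ry e) ltnNge mn.
split=> //.
- by move=> a a' b b' /In_zip_tuples[i [-> ->]] /In_zip_tuples[j [-> ->]].
- move=> s a a' b b' c c' /In_zip_tuples[i [-> ->]] /In_zip_tuples[j [-> ->]].
  by move=> /In_zip_tuples[l [-> ->]].
- have ranE w i : w = tnth y i -> ran (zip_tuples x y) w.
    by move=> ->; exists (tnth x i); apply/In_zip_tuples; exists i.
  split=> [a b [a0 /In_zip_tuples[i [_ ->]]] e|
           n a b c [a0 /In_zip_tuples[i [_ ->]]] [b0 /In_zip_tuples[j [_ ->]]] e].
    have [/Uxy Ui _] := lK_p_range KB e; have [w e'] := lK_p_def KB Ui.
    have [l wl] : exists l, w = tnth x l by apply: cx.1 e'; exists i.
    apply: (ranE _ l); rewrite wl in e'.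
    by have := (dxy' sP i l l).1 e'; rewrite /diagram e => -[].
  have [/Uxy Ui /Uxy Uj _] := lK_f_range KB e; have [w e'] := lK_f_def KB n Ui Uj.
  have [l wl] : exists l, w = tnth x l by apply: cx.2 e'; [exists i|exists j].
  apply: (ranE _ l); rewrite wl in e'.
  by have := (dxy' (sF n) i j l).1 e'; rewrite /diagram e => -[].
Qed.

Lemma tnth_in_tuple_ex (T : Type) (l : seq T) x :
  List.In x l <-> exists i, x = tnth (in_tuple l) i.
Proof.
split=> [xl|[i ->]]; last exact: tnth_In.
by have [i <-] := In_tnth xl; exists i.
Qed.

(** [psi] asserts the existence of a copy of [X] with the same finite part of the diagram, in which
    the entries of the tuple and the constants of [s0] have the same places; an entry d_l of [e] is
    fixed by its constant c_l. [psi] does not depend on [c'], so the parameters outside [s0] stay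
    free. *)
Lemma isolating_formula (A : Type) n (e : n.-tuple (Bprime B)) (X : seq B) (c : A -> B)
    (s0 : seq A) :
  closed_under (elts X) -> (forall i b, tnth e i = inl b -> List.In b X) ->
  (forall a, List.In a s0 -> List.In (c a) X) ->
  exists psi : formula (lang_sum L' (const_lang A)) n, forall c' : A -> B,
    (forall a, List.In a s0 -> c' a = c a) -> forall e' : n.-tuple (Bprime B),
    @sat _ (Bc c') _ psi e' <-> exists r, [/\ piso setT (@diagram B) r,
      dom r = elts X, forall i, sum_rel (pairs r) (tnth e i) (tnth e' i)
    & forall a, List.In a s0 -> List.In (c a, c a) r].
Proof.
move=> cX eX s0X; pose x := in_tuple X; pose k := size X.
have cx : closed_under [set b | exists i, b = tnth x i].
  suff -> : [set b | exists i, b = tnth x i] = elts X by [].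
  by apply/seteqP; split=> b /tnth_in_tuple_ex.
have [m Rm] := bounded_R x.
pose Peq (M : structure (lang_sum L' (const_lang A))) (t : (k + n).-tuple M) :=
  forall q : 'I_k * 'I_k, tnth t (lshift n q.1) = tnth t (lshift n q.2) <->
    tnth x q.1 = tnth x q.2.
pose Pdg (M : structure (lang_sum L' (const_lang A))) (t : (k + n).-tuple M) :=
  forall s, List.In s (syms_below m) -> forall q : 'I_k * 'I_k * 'I_k,
    @diagram (reduct (reduct M)) s (tnth t (lshift n q.1.1)) (tnth t (lshift n q.1.2))
      (tnth t (lshift n q.2)) <->
    diagram s (tnth x q.1.1) (tnth x q.1.2) (tnth x q.2).
pose Pe (M : structure (lang_sum L' (const_lang A))) (t : (k + n).-tuple M) :=
  forall i : 'I_n, match tnth e i with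
    | inl b => forall j : 'I_k, (tnth x j = b) -> tnth t (rshift k i) = tnth t (lshift n j)
    | inr l => forall z, @fint _ M (inl (inr (Lc l))) z = Some (tnth t (rshift k i))
    end.
pose Pc (M : structure (lang_sum L' (const_lang A))) (t : (k + n).-tuple M) :=
  forall a, List.In a s0 -> forall j : 'I_k, tnth x j = c a ->
    forall z, @fint _ M (inr a) z = Some (tnth t (lshift n j)).
have dP : definable (fun M t => [/\ @Peq M t, @Pdg M t, @Pe M t & @Pc M t]).
  have deq : definable Peq.
    apply: definable_forall => q; apply: definable_iff; first exact: definable_eq.
    exact: definable_const.
  have ddg : definable Pdg.
    apply: definable_seq => s; apply: definable_forall => q.
    apply: definable_iff; first exact: definable_diagram_const.
    exact: definable_const.
  have de : definable Pe.
    apply: definable_forall => i; case: (tnth e i) => [b|l].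
      apply: definable_forall => j; apply: definable_imp; first exact: definable_const.
      exact: definable_eq.
    exact: definable_nullary.
  have dc : definable Pc.
    apply: definable_seq => a; apply: definable_forall => j.
    apply: definable_imp; first exact: definable_const.
    exact: definable_nullary.
  apply: definable_ext (definable_and deq (definable_and ddg (definable_and de dc))) => M t.
  by split=> [[? [? [? ?]]]|[]].
have [psi hpsi] := definable_ex dP; exists psi => c' c'c e'.
have /= -> := hpsi (Bc c') e'; split.
  case=> y; set t := cat_tuple y e'; case=> heq hdg he hc.
  have tl j : tnth t (lshift n j) = tnth y j by rewrite tnth_lshift.
  have tr i : tnth t (rshift k i) = tnth e' i by rewrite tnth_rshift.
  (* The copy avoids [D]: each entry satisfies [U] or [V] like its original, and these predicates
     hold in [B] only. *)
  have /choice[y' hy] : forall j, exists b, tnth y j = inl b.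
    move=> j; have [Ux|Vx] := lK_cover KB (tnth x j).
      have := (hdg sU (In_syms_below (s := sU) I) (j, j, j)).2 Ux.
      by rewrite /= tl => /U_Bprime.
    have := (hdg sV (In_syms_below (s := sV) I) (j, j, j)).2 Vx.
    by rewrite /= tl => /V_Bprime.
  exists (zip_tuples x (mktuple y')); split.
  - apply: (piso_of_finite_diagram cx Rm) => [i j|s sm i j l].
      rewrite !tnth_mktuple -(heq (i, j)) /= !tl !hy.
      by split=> [[->]|->].
    rewrite !tnth_mktuple; apply: iff_trans (iff_sym (hdg s sm (i, j, l))) _.
    by rewrite /= !tl !hy; exact: diagram_Bprime.
  - apply/seteqP; split=> [b [b' /In_zip_tuples[i [-> _]]]|b /tnth_in_tuple_ex[i ->]].
      exact: tnth_In.
    by exists (y' i); apply/In_zip_tuples; exists i; rewrite tnth_mktuple.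
  - move=> i; have := he i; have := eX i.
    case: (tnth e i) => [b|l] eXi hei.
      have [j bj] := (tnth_in_tuple_ex _ _).1 (eXi b erefl).
      rewrite -tr (hei j (esym bj)) tl hy /= /pairs In_zip_tuples; exists j.
      by rewrite tnth_mktuple.
    by have := hei [tuple]; rewrite tr => -[<-].
  - move=> a as0; have [j aj] := (tnth_in_tuple_ex _ _).1 (s0X a as0).
    apply/In_zip_tuples; exists j; split=> //.
    have := hc a as0 j (esym aj) [tuple]; rewrite tl hy /= c'c // => -[->].
    by rewrite tnth_mktuple.
case=> r [rP rX ree' rc].
have /choice[y hy] : forall j, exists b, List.In (tnth x j, b) r.
  by move=> j; have : dom r (tnth x j) by rewrite rX; exact: tnth_In.
exists (map_tuple inl (mktuple y)).
set t := cat_tuple _ _.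
have tl j : tnth t (lshift n j) = inl (y j) by rewrite tnth_lshift tnth_map tnth_mktuple.
have tr i : tnth t (rshift k i) = tnth e' i by rewrite tnth_rshift.
split.
- move=> [i j] /=; rewrite !tl (piso_eq rP (hy i) (hy j)).
  by split=> [[->]|->].
- move=> s _ [[i j] l] /=; rewrite !tl (piso_at rP s (hy i) (hy j) (hy l)).
  exact: diagram_Bprime.
- move=> i; have := ree' i; have := eX i.
  case: (tnth e i) => [b|l] _.
    case e'i : (tnth e' i) => [b'|//] /= bb' j xjb; rewrite tl tr e'i.
    by congr inl; apply/(piso_eq rP bb' (hy j)).
  by case e'i : (tnth e' i) => [//|l'] /= -> z; rewrite tr e'i.
- move=> a as0 j xja z; rewrite tl /= c'c //; congr (Some (inl _)).
  by apply/(piso_eq rP (rc a as0) (hy j)).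
Qed.

End Isolation.

(** * The theory with parameters from A *)

Lemma reduct_expand_const (L1 : language) (M : structure L1) (A : set M) :
  reduct (expand_const A) = M.
Proof. by case: M A. Qed.

Lemma sum_rel_graph_on (B : Type) n (e : n.-tuple (B + nat)) (l : seq B) :
  (forall i b, tnth e i = inl b -> List.In b l) ->
  forall i, sum_rel (fun x b => List.In (x, b) [seq (y, y) | y <- l]) (tnth e i) (tnth e i).
Proof.
move=> el i; have := el i; case: (tnth e i) => [b|m] //= /(_ b erefl) bl.
by apply/List.in_map_iff; exists b.
Qed.

Lemma inl_bound (B : Type) n (e : n.-tuple (B + nat)) :
  exists l, forall i b, tnth e i = inl b -> List.In b l.
Proof.
have [l h] := incl_bound (fun i : 'I_n => if tnth e i is inl b then [:: b] else [::]).
by exists l => i b ei; apply: (h i); rewrite ei; left.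
Qed.

Section Over_A.
Variables (B : structure L) (hB : generic B).
Variables (C' : structure L') (hC' : model (Th (Bprime B)) C').
Variables (A : set C') (hA : A `<=` @V (reduct C')).

Let bfB := back_and_forth_generic hB.
Notation LA := (lang_sum L' (const_lang A)).
Notation TA := (Th (expand_const A)).

(** Both tuples have the type of one and the same tuple of [n] distinct points of [V] in [B]. *)
Lemma indiscernible_V : indiscernible_set A.
Proof.
move=> n a b aI bI aA bA phi.
have [l lN lV] : exists2 l : seq B, List.NoDup l /\ size l = n & forall x, List.In x l -> V x.
  elim: n {a b aI bI aA bA phi} => [|n [l [lN ls] lV]].
    by exists [::] => //; split=> //; exact: List.NoDup_nil.
  have [v Vv vl] := fresh_V hB l; exists (v :: l); last by move=> x [<-|/lV].
  by split; [exact: List.NoDup_cons|rewrite /= ls].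
have [v [vI Vv]] : exists v : n.-tuple B, injective (tnth v) /\ forall i, V (tnth v i).
  case: lN => lN <-; exists (in_tuple l); split; last by move=> i; apply: lV; exact: tnth_In.
  elim: l lN {lV} => [|x l ih] lN i j; first by case: i.
  have xl : ~ List.In x l by inversion lN.
  have lN' : List.NoDup l by inversion lN.
  case: (unliftP ord0 i) => [i' ->|->]; case: (unliftP ord0 j) => [j' ->|->] //.
  - rewrite !(tnth_nth x) /= -!(tnth_nth x (in_tuple l)) => /(ih lN') ->.
    by [].
  - rewrite !(tnth_nth x) /= -!(tnth_nth x (in_tuple l)) => e; case: xl; rewrite -e; exact: tnth_In.
  - rewrite !(tnth_nth x) /= -!(tnth_nth x (in_tuple l)) => e; case: xl; rewrite e; exact: tnth_In.
have key (x : n.-tuple C') : injective (tnth x) -> (forall i, A (tnth x i)) ->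
    sat phi x <-> sat phi (map_tuple inl v : n.-tuple (Bprime B)).
  move=> xI xA; apply: V_type => // [i|i j]; first exact/hA/xA.
  by split=> [/xI ->|/vI ->].
by rewrite (key a aI aA) (key b bI bA).
Qed.

Definition const_term (a : A) : term LA 0 :=
  @App LA 0 (inr a) (fun i : 'I_0 => Var LA i).

Lemma tval_const (M : structure LA) (a : A) y :
  tval ([tuple] : 0.-tuple M) (const_term a) y <-> @fint LA M (inr a) [tuple] = Some y.
Proof.
split=> /= [[z [_ <-]]|e]; first by rewrite (tuple0 z).
by exists [tuple]; split=> // -[].
Qed.

(** Together with [sat_sentence], this shows that T'(A) is axiomatized by T' and the statements that
    the constants name distinct points of [V]. *)
Lemma model_TA (M : structure LA) : model TA M ->
  model (Th (Bprime B)) (reduct M) /\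
  exists c : A -> M, [/\ interprets c, injective c
    & forall a, V (c a : reduct (reduct M))].
Proof.
move=> MT; split.
  move=> sigma /hC' sC.
  have [sigma' h] := @definable_reduct L' (const_lang A) 0 _ (definable_sat sigma).
  apply/(h M [tuple]); apply: MT; apply/h.
  by rewrite -[sat _ _]/(Th (reduct (expand_const A)) sigma) reduct_expand_const.
have /choice[c hc] : forall a, exists y, @fint LA M (inr a) [tuple] = Some y.
  move=> a; have /MT [y [/tval_const ya _]] : TA (Eq (const_term a) (const_term a)).
    by exists (val a); split; exact/tval_const.
  by exists y.
exists c; split.
- by move=> a z; rewrite (tuple0 z).
- move=> a b cab; apply: contrapT => ab.
  have /MT : TA (Neg (Eq (const_term a) (const_term b))).
    by move=> [y [/tval_const[<-] /tval_const[/val_inj]]] ba; apply: ab.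
  apply; exists (c a); split; apply/tval_const => //.
  by rewrite hc cab.
- move=> a; have /MT [z [/(_ ord0) /= /tval_const]] :
      TA (@Pred LA 0 (inl (inl LV)) (fun=> const_term a)).
    exists [tuple val a]; split; last exact/hA/set_valP.
    by move=> i; rewrite (ord1 i); exact/tval_const.
  by rewrite hc => -[e]; rewrite (tuple1E z) -e.
Qed.

(** Once its constants are replaced by variables, [sigma] is evaluated at a tuple of distinct points
    of [V], where [V_type] applies. *)
Lemma sat_sentence (sigma : formula LA 0) s (c : A -> B) (M : structure LA) :
  supports sigma s -> good c s -> model TA M ->
  (sat sigma ([tuple] : 0.-tuple M) <-> @sat _ (Bc c) _ sigma [tuple]).
Proof.
move=> [chi h] [Vc Ic] /model_TA[MT [cM [McM cMI cMV]]].
have h1 := h M _ McM [tuple].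
have h2 := h (Bc c) _ (@with_const_interprets _ _ _ _) [tuple].
have cat0 (T : Type) m (t : m.-tuple T) : cat_tuple [tuple] t = t by exact: val_inj.
apply: iff_trans h1 (iff_trans _ (iff_sym h2)); rewrite !cat0.
have -> : map_tuple (fun a => inl (c a)) (in_tuple s) =
    map_tuple inl (map_tuple c (in_tuple s)) :> (size s).-tuple (Bprime B).
  by apply: eq_from_tnth => i; rewrite !tnth_map.
apply: (V_type hB) => // [i|i|i j]; rewrite ?tnth_map.
- by apply: Vc; exact: tnth_In.
- exact: cMV.
- split=> [/cMI ->//|/Ic -> //]; exact: tnth_In.
Qed.

(** A missing [c a] can be added as a fixed point by [piso_addV]: were it in [ran r'], its preimage
    would lie in [V], hence be fixed, and [c a] would be in the domain already. *)
Lemma add_constants (r : seq (B * B)) (c : A -> B) (s : seq A) :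
  piso setT (@diagram B) r -> (forall x b, List.In (x, b) r -> V x -> x = b) ->
  (forall a, List.In a s -> V (c a)) ->
  exists r', [/\ piso setT (@diagram B) r', List.incl r r'
    & forall a, List.In a s -> List.In (c a, c a) r'].
Proof.
move=> rP rV Vc.
suff [r' [? ? _ ?]] : exists r', [/\ piso setT (@diagram B) r', List.incl r r',
    forall x b, List.In (x, b) r' -> V x -> x = b
  & forall a, List.In a s -> List.In (c a, c a) r'] by exists r'.
elim: s Vc => [|a s ih] Vc; first by exists r; split=> //; exact: List.incl_refl.
have [|r' [r'P rr' r'V r's]] := ih; first by move=> b bs; apply: Vc; right.
have Va : V (c a) by apply: Vc; left.
have [[b ab]|na] := pselect (dom r' (c a)).
  exists r'; split=> // _ [<-|/r's//].
  by rewrite {2}(r'V _ _ ab Va).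
exists ((c a, c a) :: r'); split.
- apply: piso_addV => // -[x xa]; apply: na.
  have Vx : V x by apply/(piso_at r'P sV xa xa xa).
  by exists (c a); rewrite -{1}(r'V _ _ xa Vx).
- by move=> q /rr'; right.
- by move=> x b [[-> ->]//|/r'V].
- by move=> b [<-|/r's]; [left|right].
Qed.

(** * The type isolated by the diagram of a finite closed set *)

Section Isolated.
Variables (n : nat) (e : n.-tuple (Bprime B)) (X : seq B) (c0 : A -> B) (s0 : seq A).
Variable psi : formula LA n.
Hypothesis gc0 : good c0 s0.
Hypothesis cX : closed_under (elts X).
Hypothesis eX : forall i b, tnth e i = inl b -> List.In b X.
Hypothesis s0X : forall a, List.In a s0 -> List.In (c0 a) X.
Hypothesis Xs0 : (forall b, List.In b X -> V b -> exists2 a, List.In a s0 & b = c0 a) \/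
  forall a, List.In a s0.
Hypothesis psiP : forall c' : A -> B,
  (forall a, List.In a s0 -> c' a = c0 a) -> forall e' : n.-tuple (Bprime B),
  @sat _ (Bc c') _ psi e' <-> exists r, [/\ piso setT (@diagram B) r,
    dom r = elts X, forall i, sum_rel (pairs r) (tnth e i) (tnth e' i)
  & forall a, List.In a s0 -> List.In (c0 a, c0 a) r].

Lemma isolating_self (c' : A -> B) : (forall a, List.In a s0 -> c' a = c0 a) ->
  @sat _ (Bc c') _ psi e.
Proof.
move=> c'c; apply/(psiP c'c); exists (graph_on id X); split.
- apply: piso_graph_on => //; apply: embedding_of_diagram => //.
  by exists id.
- apply/seteqP; split=> [b [b' /In_graph_on[]]//|b bX].
  by exists b; apply/In_graph_on.
- exact: sum_rel_graph_on.
- by move=> a /s0X aX; apply/In_graph_on.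
Qed.

(** A piso [r] given by [psi] has to be extended so as to fix all parameters of [chi]. If the points
    of [V] in [X] are named in [s0], then [r] fixes them and [add_constants] applies; if [s0] lists
    all parameters, there is nothing to add. This is the use of [Xs0]. *)
Lemma isolating_entails (chi : formula LA n) s (c : A -> B) :
  (forall a, List.In a s0 -> c a = c0 a) -> List.incl s0 s -> good c s ->
  supports chi s -> @sat _ (Bc c) _ chi e -> entails TA psi chi.
Proof.
move=> cc0 s0s gc chis chie.
have [sigma hsigma] := definable_closure (definable_imp (definable_sat psi) (definable_sat chi)).
have [s1 hs1] := supports_ex sigma.
(* The implication from [psi] to [chi] may have a larger support; the reading is extended to it
   without changing its values on [s]. *)
have [c1 [c1c gc1]] := extend_good hB s1 gc.
have c1c0 a : List.In a s0 -> c1 a = c0 a by move=> as0; rewrite c1c ?cc0 //; exact: s0s.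
have sup : supports sigma (s ++ s1) by apply: hs1; exact: List.incl_appr (List.incl_refl _).
move=> M MT x psix; apply: (hsigma M).1 psix.
apply/(sat_sentence sup gc1 MT); apply/hsigma => e' /(psiP c1c0)[r [rP rX ee' rc]].
have [r' [r'P rr' r's]] : exists r', [/\ piso setT (@diagram B) r', List.incl r r'
    & forall a, List.In a s -> List.In (c1 a, c1 a) r'].
  case: Xs0 => [XV|As0].
    apply: add_constants => // [x' b xb Vx|a ask].
      have [|a as0 xa] := XV x' _ Vx; first by rewrite -/(elts X x') -rX; exists b.
      by rewrite xa; apply/(piso_eq rP (rc a as0) xb); rewrite xa.
    by apply: gc1.1; apply/List.in_app_iff; left.
  exists r; split=> [//||a _]; first exact: List.incl_refl.
  by rewrite c1c0 //; exact: rc.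
apply/(supports_sat bfB (cN := c1) (r := r') (e := e) (e' := e') chis r'P) => //.
  by move=> i; exact: sum_rel_incl rr' (ee' i).
by apply/(supports_agree e chis c1c).
Qed.

Lemma isolating_decides (chi : formula LA n) :
  entails TA psi chi \/ entails TA psi (Neg chi).
Proof.
have [s1 hs1] := supports_ex chi; have [s2 hs2] := supports_ex (Neg chi).
have [c [cc0 gc]] := extend_good hB (s1 ++ s2) gc0.
have i0 : List.incl s0 (s0 ++ s1 ++ s2) by exact: List.incl_appl (List.incl_refl _).
have i1 : List.incl s1 (s0 ++ s1 ++ s2).
  by apply: List.incl_appr; exact: List.incl_appl (List.incl_refl _).
have i2 : List.incl s2 (s0 ++ s1 ++ s2).
  by apply: List.incl_appr; exact: List.incl_appr (List.incl_refl _).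
have [chie|nchie] := pselect (@sat _ (Bc c) _ chi e).
  by left; exact: isolating_entails cc0 i0 gc (hs1 _ i1) chie.
by right; exact: isolating_entails cc0 i0 gc (hs2 _ i2) nchie.
Qed.

(** The sentence denying that [psi] is satisfied is false in [B], where [e] itself satisfies [psi],
    and truth of sentences is the same in [M]. *)
Lemma isolating_consistent (M : structure LA) : model TA M -> exists x : n.-tuple M, sat psi x.
Proof.
move=> MT; apply: contrapT => npsi.
have [sigma hsigma] := definable_closure (definable_not (definable_sat psi)).
have [s1 hs1] := supports_ex sigma.
have [c [cc0 gc]] := extend_good hB s1 gc0.
have sup : supports sigma (s0 ++ s1) by apply: hs1; exact: List.incl_appr (List.incl_refl _).
have /hsigma : @sat _ (Bc c) _ sigma [tuple].
  by apply/(sat_sentence sup gc MT)/hsigma => x psix; apply: npsi; exists x.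
by apply; exact: isolating_self cc0.
Qed.

End Isolated.

End Over_A.

(** * Density and atomic models *)

Section Density.
Variables (B : structure L) (hB : generic B).
Variables (C' : structure L') (hC' : model (Th (Bprime B)) C').
Variables (A : set C') (hA : A `<=` @V (reduct C')).

Let KB : locally_K B := generic_locally_K hB.
Notation LA := (lang_sum L' (const_lang A)).
Notation TA := (Th (expand_const A)).

Lemma fresh_infinite (T : Type) (l : seq T) : infinite_set [set: T] -> exists x, ~ List.In x l.
Proof.
move=> Tinf; apply: contrapT => H; apply: Tinf; apply: sub_finite_set (elts_finite l) => x _.
by apply: contrapT => xl; apply: H; exists x.
Qed.

(** Each unnamed point of [V] in [X] becomes the value of a parameter outside the current list. The
    last clause keeps the values of the new parameters in [X], so that [X] need not grow. *)
Lemma cover_V (T : Type) (c : T -> B) (s : seq T) (X : seq B) :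
  infinite_set [set: T] -> good c s ->
  exists c' s', [/\ List.incl s s', forall a, List.In a s -> c' a = c a, good c' s',
    forall b, List.In b X -> V b -> exists2 a, List.In a s' & b = c' a
  & forall a, List.In a s' -> List.In a s \/ List.In (c' a) X].
Proof.
move=> Tinf gc; elim: X => [|b X [c' [s' [ss' c'c [Vc' Ic'] XV s'X]]]].
  by exists c, s; split=> // a; left.
have [|nb] := pselect (~ V b \/ exists2 a, List.In a s' & b = c' a).
  move=> H; exists c', s'; split=> //.
    by move=> x [<-|/XV//] Vb; case: H => // /(_ Vb).
  by move=> a /s'X[|]; [left|right; right].
have Vb : V b by apply: contrapT => nV; apply: nb; left.
have nbs a : List.In a s' -> b <> c' a by move=> as' e; apply: nb; right; exists a.
have [a na] := fresh_infinite s' Tinf.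
pose c1 x := if pselect (x = a) then b else c' x.
have c1a : c1 a = b by rewrite /c1; case: pselect.
have c1n x : List.In x s' -> c1 x = c' x.
  by move=> xs; rewrite /c1; case: pselect => // xa; case: na; rewrite -xa.
exists c1, (a :: s'); split.
- by move=> x /ss'; right.
- by move=> x xs; rewrite c1n ?c'c //; exact: ss'.
- split=> [x [<-|xs]|x y [<-|xs] [<-|ys]] //; rewrite ?c1a ?c1n //.
  + exact: Vc'.
  + by move=> /(nbs _ ys).
  + by move=> /esym/(nbs _ xs).
  + exact: Ic'.
- move=> x [<-|xX] Vx; first by exists a => //; left.
  by have [y ys ->] := XV x xX Vx; exists y; [right|rewrite c1n].
- move=> x [<-|xs]; first by right; left.
  by case: (s'X x xs); [left|right; right; rewrite c1n].
Qed.

Lemma principal_types_dense_V : principal_types_dense TA.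
Proof.
move=> n phi [M MT [x phix]].
have [sphi hphi] := supports_ex phi.
have [sigma hsigma] := definable_closure (definable_not (definable_sat phi)).
have [s1 hs1] := supports_ex sigma.
have [v0 Vv0 _] := fresh_V hB [::].
(* For finite [A] every parameter goes into the support, which yields the second alternative of
   [Xs0]. *)
have [sA hsA] : exists sA : seq A, infinite_set [set: A] \/ forall a, List.In a sA.
  have [/finite_elts[l lA]|inf] := pselect (finite_set [set: A]); last by exists [::]; left.
  by exists l; right => a; rewrite -/(elts l a) -lA.
have [c [_ gc]] : exists c : A -> B, (forall a, List.In a [::] -> c a = v0) /\
    good c ([::] ++ sphi ++ s1 ++ sA).
  by apply: (extend_good hB (c := fun=> v0)).
move: gc; rewrite cat0s => gc.
have sup : supports sigma (sphi ++ s1 ++ sA).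
  by apply: hs1; apply: List.incl_appr; exact: List.incl_appl (List.incl_refl _).
(* [phi] has a realization in [M], so the sentence denying one fails there, and hence also in [B]
   read through [c]. *)
have [e phie] : exists e, @sat _ (Bc c) _ phi e.
  apply: contrapT => ne; have /hsigma/(_ x) : sat sigma ([tuple] : 0.-tuple M).
    by apply/(sat_sentence hB hC' hA sup gc MT)/hsigma => e phie; apply: ne; exists e.
  exact.
have [l el] := inl_bound e.
have [X [cX lX]] := lK_finite KB (l ++ map c (sphi ++ s1 ++ sA)).
have eX i b : tnth e i = inl b -> List.In b X.
  by move=> /el bl; apply: lX; apply/List.in_app_iff; left.
have sX a : List.In a (sphi ++ s1 ++ sA) -> List.In (c a) X.
  by move=> h; apply: lX; apply/List.in_app_iff; right; apply/List.in_map_iff; exists a.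
have [c0 [s0 [ss0 c0c gc0 s0X Xs0]]] : exists c0 s0, [/\ List.incl (sphi ++ s1 ++ sA) s0,
    forall a, List.In a (sphi ++ s1 ++ sA) -> c0 a = c a, good c0 s0,
    forall a, List.In a s0 -> List.In (c0 a) X
  & (forall b, List.In b X -> V b -> exists2 a, List.In a s0 & b = c0 a) \/
    forall a, List.In a s0].
  case: hsA => [inf|all].
    have [c0 [s0 [ss0 c0c gc0 XV s0X]]] := cover_V X inf gc.
    exists c0, s0; split=> //; last by left.
    by move=> a /s0X[ah|//]; rewrite c0c //; exact: sX.
  exists c, (sphi ++ s1 ++ sA); split=> //.
  by right => a; do 2!(apply/List.in_app_iff; right).
have [psi psiP] := isolating_formula hB cX eX s0X.
(* The isolated type consists of the consequences of [psi]; it is complete because [psi] decides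
   every formula. *)
exists psi, (entails TA psi); split.
- split; last by move=> chi; exact: (isolating_decides hB hC' hA gc0 Xs0 psiP).
  exists (expand_const A); first by [].
  have [|y psiy] := isolating_consistent hB hC' hA gc0 cX eX s0X psiP (M := expand_const A).
    by [].
  by exists y => chi; apply.
- by split=> // M' MT' y.
- have sup0 : supports phi s0.
    by apply: hphi => a asp; apply: ss0; apply/List.in_app_iff; left.
  apply: (isolating_entails hB hC' hA Xs0 psiP (s := s0) (c := c0)) sup0 _ => //.
  apply/(supports_agree e (hphi (sphi ++ s1 ++ sA) _) c0c) => //.
  exact: List.incl_appl (List.incl_refl _).
Qed.

Lemma back_and_forth_cover (T : Type) (D : set T) at_ (r : seq (T * B)) (l : seq T) :
  back_and_forth B D at_ -> piso D at_ r -> elts l `<=` D ->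
  exists r', [/\ piso D at_ r', List.incl r r' & elts l `<=` dom r'].
Proof.
move=> bf rP lD; elim: l lD => [|x l ih] lD; first by exists r; split.
have [|r1 [r1P rr1 lr1]] := ih; first by move=> y yl; apply: lD; right.
have [r2 [r2P r12 xr2]] := (bf _ r1P).1 x (lD x (or_introl erefl)).
exists r2; split=> //; first exact: List.incl_tran rr1 r12.
by move=> y [<-//|/lr1[b yb]]; exists b; exact: r12.
Qed.

(** * Atomicity of structures with the back-and-forth property *)

Section Atomic.
Variables (N : structure L) (bf : back_and_forth B setT (@diagram N)) (iota : A -> N).
Hypothesis iotaI : injective iota.
Hypothesis iotaV : forall a, V (iota a).
Hypothesis iota_onto : finite_set [set: A] \/ forall x, V x -> exists a, x = iota a.

Let M : structure LA := with_const (fun a => inl (iota a) : Bprime N).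

Lemma constants_of_piso (r : seq (N * B)) (s : seq A) : piso setT (@diagram N) r ->
  (forall a, List.In a s -> dom r (iota a)) ->
  exists2 c : A -> B, forall a, List.In a s -> List.In (iota a, c a) r & good c s.
Proof.
move=> rP sr; have [v0 Vv0 _] := fresh_V hB [::].
have /choice[c hc] : forall a, exists b, List.In a s -> List.In (iota a, b) r.
  move=> a; have [/sr[b ab]|na] := pselect (List.In a s); first by exists b.
  by exists v0.
exists c => //; split=> [a /hc ar|a a' /hc ar /hc ar' e].
  by apply/(piso_at rP sV ar ar ar); exact: iotaV.
by apply: iotaI; apply/(piso_eq rP ar ar').
Qed.

(** A finite piso containing the support of [sigma] turns [iota] into a good reading in [B], through
    which both [M] and [expand_const A] decide [sigma] alike. *)
Lemma model_with_const : model TA M.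
Proof.
move=> sigma sC; have [s0 hs0] := supports_ex sigma.
have sup : supports sigma s0 by apply: hs0; exact: List.incl_refl.
have [r [rP _ rs]] := back_and_forth_cover (l := map iota s0) bf (piso_nil _ _ _) (fun _ _ => I).
have [a ha|c cr gc] := constants_of_piso (s := s0) rP.
  by apply: rs; apply/List.in_map_iff; exists a.
apply/(supports_sat bf sup rP cr (e := [tuple]) (e' := [tuple])); first by case.
apply/(sat_sentence hB hC' hA sup gc (M := expand_const A)) => //.
Qed.

Lemma atomic_with_const : atomic_model TA M.
Proof.
split; first exact: model_with_const.
move=> n e; have [l el] := inl_bound (e : n.-tuple (N + nat)).
have [sA hsA] : exists sA : seq A,
    (forall x : N, V x -> exists a, x = iota a) \/ forall a, List.In a sA.
  case: iota_onto => [/finite_elts[sA AE]|]; last by exists [::]; left.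
  by exists sA; right => a; rewrite -/(elts sA a) -AE.
have [r [rP _ lr]] := back_and_forth_cover (l := l ++ map iota sA) bf (piso_nil _ _ _) (fun _ _ => I).
(* [s0] names the points of [V] in [dom r] when [iota] is onto [V], and is all of [A] when [A] is
   finite; these are the alternatives of [Xs0]. *)
have [s0 [s0r s0V]] : exists s0, (forall a, List.In a s0 -> dom r (iota a)) /\
    ((forall x, dom r x -> V x -> exists2 a, List.In a s0 & x = iota a) \/
     forall a, List.In a s0).
  case: hsA => [onto|all]; last first.
    exists sA; split; last by right.
    move=> a aA; apply: lr; apply/List.in_app_iff; right.
    by apply/List.in_map_iff; exists a.
  suff H r' : List.incl r' r -> exists s0, (forall a, List.In a s0 -> dom r (iota a)) /\
      forall x b, List.In (x, b) r' -> V x -> exists2 a, List.In a s0 & x = iota a.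
    have [s0 [h1 h2]] := H r (List.incl_refl r).
    by exists s0; split=> //; left => x [b xb]; exact: h2 xb.
  elim: r' => [|[x b] r' ih] r'r; first by exists [::]; split=> // ? [].
  have [|s0 [h1 h2]] := ih; first by move=> q qr; apply: r'r; right.
  have [Vx|nVx] := pselect (V x); last first.
    by exists s0; split=> // x' b' [[<- _]//|]; exact: h2.
  have [a xa] := onto x Vx; exists (a :: s0); split.
    by move=> a' [<-|/h1//]; rewrite -xa; exists b; apply: r'r; left.
  move=> x' b' [[<- _] _|x'b' Vx']; first by exists a => //; left.
  by have [a' a's ->] := h2 _ _ x'b' Vx'; exists a' => //; right.
have [c cr gc] := constants_of_piso rP s0r.
have /choice[e' he'] : forall i, exists y : Bprime B, sum_rel (pairs r) (tnth e i) y.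
  move=> i; have := el i; case: (tnth e i) => [x|m] elx; last by exists (inr m).
  have [|b xb] := lr x; first by apply/List.in_app_iff; left; exact: elx.
  by exists (inl b).
have ee' i : sum_rel (pairs r) (tnth e i) (tnth (mktuple e') i) by rewrite tnth_mktuple.
pose X := map snd r.
have XE : elts X = ran r.
  apply/seteqP; split=> [b /List.in_map_iff[[x b'] [/= -> xb]]|b [x xb]]; first by exists x.
  by apply/List.in_map_iff; exists (x, b).
have inX x b : List.In (x, b) r -> List.In b X.
  by move=> xb; apply/List.in_map_iff; exists (x, b).
have cX : closed_under (elts X) by rewrite XE; exact: piso_ran rP.
have eX i b : tnth (mktuple e') i = inl b -> List.In b X.
  by move=> ei; have := ee' i; rewrite ei; case: (tnth e i) => // x; exact: inX.
have s0X a : List.In a s0 -> List.In (c a) X by move=> /cr; exact: inX.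
have Xs0 : (forall b, List.In b X -> V b -> exists2 a, List.In a s0 & b = c a) \/
    forall a, List.In a s0.
  case: s0V => [h|]; [left|by right] => b /List.in_map_iff[[x b'] [/= -> xb]] Vb.
  have [||a as0 xa] := h x; [by exists b|exact/(piso_at rP sV xb xb xb)|].
  by exists a => //; apply/(piso_eq rP xb (cr a as0)).
have [psi psiP] := isolating_formula hB cX eX s0X.
(* The support of [psi] obtained from [supports_ex] may exceed [s0], so [r] is first enlarged to
   cover it; the resulting reading agrees with [c] on [s0]. *)
have psie : sat psi e.
  have [s1 hs1] := supports_ex psi.
  have [r' [r'P rr' s1r']] := back_and_forth_cover (l := map iota s1) bf rP (fun _ _ => I).
  have [a|c' c'r gc'] := constants_of_piso (s := s0 ++ s1) r'P.
    move=> /List.in_app_iff[/s0r[b ab]|as1]; first by exists b; exact: rr'.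
    by apply: s1r'; apply/List.in_map_iff; exists a.
  have sup : supports psi (s0 ++ s1) by apply: hs1; exact: List.incl_appr (List.incl_refl _).
  apply/(supports_sat bf sup r'P c'r (e' := mktuple e')).
    by move=> i; exact: sum_rel_incl rr' (ee' i).
  apply: (isolating_self cX eX s0X psiP) => a as0.
  have ar' : List.In (iota a, c' a) r' by apply: c'r; apply/List.in_app_iff; left.
  by apply/(piso_eq r'P ar' (rr' _ (cr a as0))).
exists [set chi | sat chi e]; split; last by move=> chi.
  split; first by exists M; [exact: model_with_const|exists e].
  by move=> chi; have [h|h] := pselect (sat chi e); [left|right].
exists psi; split=> // chi chie.
have [//|H] := isolating_decides hB hC' hA gc Xs0 psiP chi.
by case: (H M model_with_const e psie chie).
Qed.

End Atomic.

End Density.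

(** * A structure of size aleph_1 *)

Section Transport.
Variables (B : structure L) (T1 T2 : Type).
Variables (D1 : set T1) (at1 : sym -> T1 -> T1 -> T1 -> Prop).
Variables (D2 : set T2) (at2 : sym -> T2 -> T2 -> T2 -> Prop).
Variable h : T1 -> T2.
Hypothesis hI : forall x y, D1 x -> D1 y -> h x = h y -> x = y.
Hypothesis hD : forall x, D1 x -> D2 (h x).
Hypothesis hat : forall s x y z, D1 x -> D1 y -> D1 z ->
  (at1 s x y z <-> at2 s (h x) (h y) (h z)).

Definition map_dom (r : seq (T1 * B)) : seq (T2 * B) := [seq (h q.1, q.2) | q <- r].

Lemma In_map_dom r x' b :
  List.In (x', b) (map_dom r) <-> exists2 x, x' = h x & List.In (x, b) r.
Proof.
rewrite /map_dom List.in_map_iff; split=> [[[x b'] [[<- <-] xb]]|[x -> xb]]; first by exists x.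
by exists (x, b).
Qed.

Lemma piso_map_dom r : piso D1 at1 r -> piso D2 at2 (map_dom r).
Proof.
move=> rP; have rD x b : List.In (x, b) r -> D1 x by move=> xb; apply: (piso_D rP); exists b.
split.
- by move=> _ [b /In_map_dom[x -> /rD/hD]].
- move=> _ x' _ y' /In_map_dom[x -> xr] /In_map_dom[y -> yr].
  rewrite -(piso_eq rP xr yr); split=> [|->//].
  by apply: hI; [exact: rD xr|exact: rD yr].
- move=> s _ x' _ y' _ z' /In_map_dom[x -> xr] /In_map_dom[y -> yr] /In_map_dom[z -> zr].
  rewrite -(piso_at rP s xr yr zr) (hat s) //; [exact: rD xr|exact: rD yr|exact: rD zr].
- have -> : ran (map_dom r) = ran r; last exact: piso_ran rP.
  apply/seteqP; split=> b [x]; first by move=> /In_map_dom[y _ yb]; exists y.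
  by move=> xb; exists (h x); apply/In_map_dom; exists x.
Qed.

End Transport.

Lemma the_eq (T : Type) (P : set T) y : (forall x x', P x -> P x' -> x = x') ->
  (the P = Some y <-> P y).
Proof.
move=> PI; rewrite /the; case: pselect => [h|h]; last by split=> // Py; case: h; exists y.
by case: cid => x Px /=; split=> [[<-]//|Py]; congr Some; exact: PI.
Qed.

Section Construction.
Variables (B : structure L) (hB : generic B).
Variables (A : Type) (le : A -> A -> Prop).
Hypothesis le_min : forall P : set A, (exists a, P a) ->
  exists a, P a /\ forall b, P b -> le a b.
Hypothesis le_anti : forall a b, le a b -> le b a -> a = b.
Hypothesis le_countable : forall a, countable [set b | le b a /\ b <> a].

Let bfB := back_and_forth_generic hB.
Let T : Type := (A * nat)%type.

(* A diagram of a structure on a subset of [T]: [(true, s, t)] means that the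
   atomic formula [s] holds of [t], and [(false, s, t)] that it fails; recording
   the failures makes inclusion of diagrams the substructure relation. *)
Let signed_diagram : Type := set (bool * sym * (T * T * T)).
Implicit Types S : signed_diagram.

Definition universe S : set T := [set x | S (true, sD, (x, x, x))].
Definition positive S (s : sym) (x y z : T) := S (true, s, (x, y, z)).

(** The point [a] of [A] owns the column of pairs with first component [a]. The columns that are met
    form an initial segment, and each contains a point of [V]. [apx_back] presupposes a point of the
    universe because the empty diagram, the union of the empty chain, has to be an approximation. *)
Record approximation S : Prop := {
  apx_universe : forall b s x y z, S (b, s, (x, y, z)) ->
    [/\ universe S x, universe S y & universe S z];
  apx_sign : forall s x y z, universe S x -> universe S y -> universe S z ->
    (S (false, s, (x, y, z)) <-> ~ S (true, s, (x, y, z)));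
  apx_initial : forall a n a', universe S (a, n) -> le a' a ->
    exists n', positive S sV (a', n') (a', n') (a', n');
  apx_forth : forall (r : seq (T * B)) x, piso (universe S) (positive S) r -> universe S x ->
    exists r' : seq (T * B), [/\ piso (universe S) (positive S) r', List.incl r r' & dom r' x];
  apx_back : forall (r : seq (T * B)) x (b : B), piso (universe S) (positive S) r -> universe S x ->
    exists r' : seq (T * B), [/\ piso (universe S) (positive S) r', List.incl r r' & ran r' b] }.

(** * Unions of chains of approximations *)

Section Chain.
Variables (F : set signed_diagram) (FP : F `<=` approximation) (Ftot : total_on F subset).
Let S := \bigcup_(S in F) S.

(** This is what the recorded failures achieve: a larger member of the chain cannot make a new
    atomic formula true, or false, at old points. *)
Lemma chain_restrict S0 b s x y z : F S0 -> universe S0 x -> universe S0 y ->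
  universe S0 z -> S (b, s, (x, y, z)) -> S0 (b, s, (x, y, z)).
Proof.
move=> FS0 x0 y0 z0 [S1 FS1 S1b]; case: (Ftot FS0 FS1) => sub; last exact: sub.
have E0 := apx_sign (FP FS0) s x0 y0 z0.
have E1 := apx_sign (FP FS1) s (sub _ x0) (sub _ y0) (sub _ z0).
case: b S1b => S1b; apply: contrapT => nS0.
  by apply: (E1.1 _ S1b); apply: sub; exact/E0.
by apply: (E1.1 S1b); apply: sub; apply: contrapT => /E0.
Qed.

Lemma chain_seq S0 (l : seq T) : F S0 -> elts l `<=` universe S ->
  exists2 S1, F S1 & elts l `<=` universe S1.
Proof.
move=> FS0; elim: l => [|x l ih] lS; first by exists S0.
have [|S1 FS1 lS1] := ih; first by move=> y yl; apply: lS; right.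
have [S2 FS2 xS2] := lS x (or_introl erefl).
case: (Ftot FS1 FS2) => sub.
  by exists S2 => // y [<-//|/lS1 yS1]; exact: sub.
by exists S1 => // y [<-|/lS1//]; exact: sub.
Qed.

Lemma chain_piso S0 (r : seq (T * B)) : F S0 -> dom r `<=` universe S0 ->
  (piso (universe S) (positive S) r <-> piso (universe S0) (positive S0) r).
Proof.
move=> FS0 rS0; split=> -[h1 h2 h3 h4]; split=> //.
- move=> s x x' y y' z z' xr yr zr; rewrite -(h3 s _ _ _ _ _ _ xr yr zr).
  split=> h; first by exists S0.
  by apply: chain_restrict h => //; apply: rS0; [exists x'|exists y'|exists z'].
- by move=> x xr; exists S0 => //; exact: rS0.
- move=> s x x' y y' z z' xr yr zr; rewrite -(h3 s _ _ _ _ _ _ xr yr zr).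
  split=> h; last by exists S0.
  by apply: chain_restrict h => //; apply: rS0; [exists x'|exists y'|exists z'].
Qed.

Lemma chain_approximation : approximation S.
Proof.
have sub S0 : F S0 -> S0 `<=` S by move=> FS0 q; exists S0.
split.
- move=> b s x y z [S0 FS0 /(apx_universe (FP FS0))[x0 y0 z0]].
  by split; exact: sub FS0 _ _.
- move=> s x y z xS yS zS; have [S0 FS0 xS0] := xS.
  have [|S1 FS1 l1] := @chain_seq S0 [:: x; y; z] FS0.
    by move=> w [<-//|[<-//|[<-|]]].
  have x1 := l1 x (or_introl erefl); have y1 := l1 y (or_intror (or_introl erefl)).
  have z1 := l1 z (or_intror (or_intror (or_introl erefl))).
  have E b : S (b, s, (x, y, z)) <-> S1 (b, s, (x, y, z)).
    by split; [exact: chain_restrict|exact: sub].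
  apply: iff_trans (E false) (iff_trans (apx_sign (FP FS1) s x1 y1 z1) _).
  by split=> h h'; apply: h; exact/(E true).
- move=> a n a' [S0 FS0 aS0] /(apx_initial (FP FS0) aS0)[n' n'S0].
  by exists n'; exact: sub n'S0.
- move=> r x rP [S0 FS0 xS0].
  have [|S1 FS1 l1] := @chain_seq S0 (x :: map fst r) FS0.
    move=> y [<-|/List.in_map_iff[[y' b] [/= <- yb]]]; first by exists S0.
    by apply: (piso_D rP); exists b.
  have r1 : dom r `<=` universe S1.
    by move=> y [b yb]; apply: l1; right; apply/List.in_map_iff; exists (y, b).
  have [r' [r'P rr' xr']] := apx_forth (FP FS1) ((chain_piso FS1 r1).1 rP) (l1 x (or_introl erefl)).
  by exists r'; split=> //; apply/(chain_piso FS1 (piso_D r'P)).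
- move=> r x b rP [S0 FS0 xS0].
  have [|S1 FS1 l1] := @chain_seq S0 (x :: map fst r) FS0.
    move=> y [<-|/List.in_map_iff[[y' b'] [/= <- yb]]]; first by exists S0.
    by apply: (piso_D rP); exists b'.
  have r1 : dom r `<=` universe S1.
    by move=> y [b' yb]; apply: l1; right; apply/List.in_map_iff; exists (y, b').
  have [r' [r'P rr' br']] := apx_back (FP FS1) b ((chain_piso FS1 r1).1 rP) (l1 x (or_introl erefl)).
  by exists r'; split=> //; apply/(chain_piso FS1 (piso_D r'P)).
Qed.

End Chain.

Lemma piso_comp_iso (T' : Type) (D : set T') at_ (r : seq (T' * B)) (alpha : B -> B) :
  isomorphism alpha -> piso D at_ r -> piso D at_ [seq (q.1, alpha q.2) | q <- r].
Proof.
move=> aiso rP.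
have inE x b : List.In (x, b) [seq (q.1, alpha q.2) | q <- r] <->
    exists2 b', b = alpha b' & List.In (x, b') r.
  rewrite List.in_map_iff; split=> [[[x' b'] [[<- <-] xb]]|[b' -> xb]]; first by exists b'.
  by exists (x, b').
split.
- by move=> x [b /inE[b' _ xb']]; apply: (piso_D rP); exists b'.
- move=> x _ y _ /inE[x' -> xr] /inE[y' -> yr]; rewrite (piso_eq rP xr yr).
  by split=> [->//|/(bij_inj aiso.2)].
- move=> s x _ y _ z _ /inE[x' -> xr] /inE[y' -> yr] /inE[z' -> zr].
  by rewrite (piso_at rP s xr yr zr) (iso_diagram aiso).
- have -> : ran [seq (q.1, alpha q.2) | q <- r] = [set alpha b | b in ran r].
    apply/seteqP; split=> [b [x /inE[b' -> xb']]|_ [b [x xb] <-]]; first by exists b' => //; exists x.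
    by exists x; apply/inE; exists b.
  by apply: closed_under_iso => //; exact: piso_ran rP.
Qed.

(* If the extension hits [v0], move it by an automorphism fixing [ran r] and
   taking some unused point of [V] to [v0]. *)
Lemma forth_avoiding S (v0 : B) (r : seq (T * B)) x : approximation S -> V v0 ->
  piso (universe S) (positive S) r -> ~ ran r v0 -> universe S x ->
  exists r' : seq (T * B), [/\ piso (universe S) (positive S) r', List.incl r r', dom r' x & ~ ran r' v0].
Proof.
move=> SP Vv0 rP nv0 xS; have [r1 [r1P rr1 xr1]] := apx_forth SP rP xS.
have [v1 Vv1 nv1] := fresh_V hB (map snd r1).
have ran1 b : ran r1 b -> b <> v1.
  by move=> [y yb] e; apply: nv1; rewrite -e; apply/List.in_map_iff; exists (y, b).
have rE : elts (map snd r) = ran r.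
  apply/seteqP; split=> [b /List.in_map_iff[[y b'] [/= -> yb]]|b [y yb]]; first by exists y.
  by apply/List.in_map_iff; exists (y, b).
have [alpha aiso ar] : exists2 alpha : B -> B, isomorphism alpha &
    forall b b', List.In (b, b') ((v1, v0) :: graph_on id (map snd r)) -> alpha b = b'.
  apply: (homogeneous hB); apply: piso_addV => //.
  - apply: piso_graph_on; first by apply: embedding_of_diagram => //; exists id.
    by rewrite rE; exact: piso_ran rP.
  - move=> [b /In_graph_on[/List.in_map_iff[[y b'] [/= -> yv]] _]].
    by apply: (ran1 v1) => //; exists y; exact: rr1.
  - by move=> [b /In_graph_on[bl e]]; apply: nv0; rewrite -rE e.
exists [seq (q.1, alpha q.2) | q <- r1]; split.
- exact: piso_comp_iso.
- move=> [y b] yb; apply/List.in_map_iff; exists (y, b); split; last exact: rr1.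
  congr (_, _); apply: ar; right; apply/In_graph_on; split=> //.
  by apply/List.in_map_iff; exists (y, b).
- by have [b xb] := xr1; exists (alpha b); apply/List.in_map_iff; exists (x, b).
- move=> [y /List.in_map_iff[[y' b] [[_ e] yb]]].
  apply: (ran1 b); first by exists y'.
  by apply: (bij_inj aiso.2); rewrite e; apply/esym/ar; left.
Qed.

(** Only the forth direction is iterated, along an enumeration of the universe, so the union [E] of
    the pisos is an embedding that need not be onto; each extension is made to miss [v0]. *)
Lemma embed_avoiding S (v0 : B) : approximation S -> V v0 -> countable (universe S) ->
  exists E : T -> B -> Prop, [/\
    forall x, universe S x -> exists b, E x b,
    forall x b, E x b -> universe S x /\ b <> v0,
    forall x y b c, E x b -> E y c -> (x = y <-> b = c)
  & forall s x y z b c d, E x b -> E y c -> E z d ->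
      (positive S s x y z <-> diagram s b c d)].
Proof.
move=> SP Vv0 /countable_injP[f fI].
have fI' x y : universe S x -> universe S y -> f x = f y -> x = y.
  by move=> xS yS; apply: fI; exact: mem_set.
pose ok (r : seq (T * B)) := piso (universe S) (positive S) r /\ ~ ran r v0.
have /choice[next nextP] : forall q : nat * seq (T * B), exists r', ok q.2 ->
    [/\ ok r', List.incl q.2 r' & forall x, universe S x -> f x = q.1 -> dom r' x].
  move=> [n r] /=; have [[rP nv0]|nok] := pselect (ok r); last by exists r.
  have [[x xS fx]|nx] := pselect (exists2 x, universe S x & f x = n); last first.
    by exists r => _; split=> // x xS fx; case: nx; exists x.
  have [r' [r'P rr' xr' nv0']] := forth_avoiding SP Vv0 rP nv0 xS.
  by exists r' => _; split=> // y yS; rewrite -fx => /(fI' _ _ yS xS) ->.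
pose rr := fix rr n := if n is m.+1 then next (m, rr m) else [::].
have rrP n : ok (rr n).
  elim: n => [|n ih] /=; first by split; [exact: piso_nil|case].
  by have [] := nextP (n, rr n) ih.
have rrS n : List.incl (rr n) (rr n.+1) by have [] := nextP (n, rr n) (rrP n).
have rrM m n : m <= n -> List.incl (rr m) (rr n).
  move=> /subnKC <-; elim: (n - m) => [|k ih]; rewrite ?addn0 ?addnS //.
  exact: List.incl_tran ih (rrS _).
exists (fun x b => exists n, List.In (x, b) (rr n)); split.
- move=> x xS; have [_ _ /(_ x xS erefl)[b xb]] := nextP (f x, rr (f x)) (rrP _).
  by exists b, (f x).+1.
- move=> x b [n xb]; have [rP nv0] := rrP n; split; first by apply: (piso_D rP); exists b.
  by move=> e; apply: nv0; exists x; rewrite -e.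
- move=> x y b c [n xb] [m yc]; have [rP _] := rrP (maxn n m).
  by apply: (piso_eq rP); [apply: rrM xb; exact: leq_maxl|apply: rrM yc; exact: leq_maxr].
- move=> s x y z b c d [n xb] [m yc] [k zd]; have [rP _] := rrP (maxn (maxn n m) k).
  apply: (piso_at rP); [apply: rrM xb|apply: rrM yc|apply: rrM zd].
  + by rewrite !leq_max leqnn.
  + by rewrite !leq_max leqnn orbT.
  + by rewrite !leq_max leqnn orbT.
Qed.

(** If column [a] is empty, [apx_initial] confines the universe to the columns below [a], which are
    countably many. *)
Lemma universe_countable S a : approximation S -> (forall n, ~ universe S (a, n)) ->
  countable (universe S).
Proof.
move=> SP na; apply: (@sub_countable _ _ _ ([set b | le b a /\ b <> a] `*` [set: nat])); last first.
  by apply: countableX; [exact: le_countable|exact: countableP].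
apply: subset_card_le => -[b n] bS; split=> //=.
have ba : b <> a by move=> e; apply: (na n); rewrite -e.
(* Linearity of the order comes from the least element of the pair of [a] and [b]. *)
split=> //; have [|c [cab cmin]] := @le_min (fun c => c = a \/ c = b); first by exists a; left.
case: cab => ca; last by rewrite -ca; apply: cmin; left.
have [|n' /(apx_universe SP)[aS _ _]] := apx_initial SP (a' := a) bS; last by case: (na n').
by rewrite -ca; apply: cmin; right.
Qed.

(** [S] is embedded in [B] and completed to a copy of all of [B], the new points being put into
    column [a]. The point [v0] missed by the embedding is a point of [V] in that column, so the step
    is proper. *)
Lemma approximation_step S a : approximation S -> (forall n, ~ universe S (a, n)) ->
  (forall b, b <> a -> le b a -> exists n, universe S (b, n)) ->
  exists S', [/\ approximation S', S `<=` S' & exists n, universe S' (a, n)].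
Proof.
move=> SP na amin; have [v0 Vv0 _] := fresh_V hB [::].
have [E [Edef Eran Einj Eat]] := embed_avoiding SP Vv0 (universe_countable SP na).
have /countable_injP[cb /= cbI] := generic_countable hB.
(* [psi] inverts [E] on its range; any other point [b] of [B] is sent to place [cb b] of column [a],
   by an enumeration [cb] of [B]. *)
have /choice[psi psiP] : forall b, exists t, E t b \/ (forall x, ~ E x b) /\ t = (a, cb b).
  move=> b; have [[x xb]|nx] := pselect (exists x, E x b); first by exists x; left.
  by exists (a, cb b); right; split=> // x xb; apply: nx; exists x.
have psiE x b : E x b -> psi b = x.
  move=> xb; case: (psiP b) => [yb|[/(_ x)//]].
  exact/(Einj _ _ _ _ yb xb).
have psiI b c : psi b = psi c -> b = c.
  case: (psiP b) (psiP c) => [Eb|[nb ->]] [Ec|[nc ->]].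
  - by move=> e; apply/(Einj _ _ _ _ Eb Ec).
  - by move=> e; case: (na (cb c)); rewrite -e; have [] := Eran _ _ Eb.
  - by move=> e; case: (na (cb b)); rewrite e; have [] := Eran _ _ Ec.
  - by case=> /cbI; apply; exact: mem_set.
have [n0 psiv0] : exists n, psi v0 = (a, n).
  case: (psiP v0) => [/Eran[_ //]|[_ ->]]; by exists (cb v0).
pose S' : signed_diagram := [set q | exists b c d, q.2 = (psi b, psi c, psi d) /\
  (if q.1.1 then diagram q.1.2 b c d else ~ diagram q.1.2 b c d)].
have S'E sg s b c d : S' (sg, s, (psi b, psi c, psi d)) <->
    if sg then diagram s b c d else ~ diagram s b c d.
  split=> [[b' [c' [d' [/= []]]]]|h]; last by exists b, c, d.
  by move=> /psiI-> /psiI-> /psiI->.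
have uS' b : universe S' (psi b) by apply/S'E.
have uS'E x : universe S' x -> exists b, x = psi b.
  by case=> b [c [d [/= [-> _ _] _]]]; exists b.
have /choice[g gP] : forall x, exists b, universe S' x -> x = psi b.
  move=> x; have [/uS'E[b ->]|n] := pselect (universe S' x); first by exists b.
  by exists v0.
have gpsi b : g (psi b) = b by apply: psiI; rewrite -gP.
(* [S'] is a copy of [B] along [psi], with inverse [g]; its pisos are those of [B] relabelled, so
   the back-and-forth property of [B] carries over. *)
have toB (r : seq (T * B)) : piso (universe S') (positive S') r ->
    piso setT (@diagram B) (map_dom g r).
  apply: piso_map_dom => // [x y /gP -> /gP ->|s x y z /gP -> /gP -> /gP ->].
    by rewrite !gpsi => ->.
  by rewrite !gpsi; exact: (S'E true).
have fromB (r : seq (B * B)) : piso setT (@diagram B) r ->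
    piso (universe S') (positive S') (map_dom psi r).
  apply: piso_map_dom => [x y _ _ /psiI//|//|s x y z _ _ _].
  by symmetry; exact: (S'E true).
have round (r : seq (T * B)) (r' : seq (B * B)) : piso (universe S') (positive S') r ->
    List.incl (map_dom g r) r' -> List.incl r (map_dom psi r').
  move=> rP rr' [x b] xb; apply/In_map_dom; exists (g x).
    by apply: gP; apply: (piso_D rP); exists b.
  by apply: rr'; apply/In_map_dom; exists x.
have SS' : S `<=` S'.
  move=> [[sg s] [[x y] z]] Sq.
  have [xS yS zS] := apx_universe SP Sq.
  have [[b xb] [c yc] [d zd]] := And3 (Edef _ xS) (Edef _ yS) (Edef _ zS).
  rewrite -(psiE _ _ xb) -(psiE _ _ yc) -(psiE _ _ zd); apply/S'E.
  have e := Eat s _ _ _ _ _ _ xb yc zd.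
  case: sg Sq => Sq; first exact/e.
  by move=> /e; exact: (apx_sign SP s xS yS zS).1.
exists S'; split=> //; last by exists n0; rewrite -psiv0.
split.
- by move=> sg s x y z [b [c [d [/= [-> -> ->] _]]]]; split.
- move=> s x y z /uS'E[b ->] /uS'E[c ->] /uS'E[d ->].
  by rewrite (S'E false) (S'E true).
- have Va : exists n, positive S' sV (a, n) (a, n) (a, n).
    by exists n0; rewrite -psiv0; apply/S'E.
  have old b n b' : universe S (b, n) -> le b' b ->
      exists n', positive S' sV (b', n') (b', n') (b', n').
    by move=> bS /(apx_initial SP bS)[n' h]; exists n'; exact: SS'.
  move=> b n b' /uS'E[w e] b'b; case: (psiP w) => [/Eran[bS _]|[_ e']].
    by apply: (old b n); rewrite // e.
  have ba : b = a by rewrite e' in e; case: e.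
  have [->//|b'a] := pselect (b' = a).
  have [|n1 b'S] := amin b' b'a; first by rewrite -ba.
  have [|c [cE cmin]] := @le_min (fun c => c = b'); first by exists b'.
  by apply: old b'S _; rewrite -{1}cE; exact: cmin.
- move=> r x rP /gP xg; have [r' [r'P rr' [b xb]]] := (bfB (toB r rP)).1 (g x) I.
  exists (map_dom psi r'); split; [exact: fromB|exact: round rr'|].
  by exists b; apply/In_map_dom; exists (g x).
- move=> r x b rP _; have [r' [r'P rr' [x' xb]]] := (bfB (toB r rP)).2 b.
  exists (map_dom psi r'); split; [exact: fromB|exact: round rr'|].
  by exists (psi x'); apply/In_map_dom; exists x'.
Qed.

Lemma total_approximation : exists S, approximation S /\ forall a, exists n, universe S (a, n).
Proof.
have [F FP Ftot|S [SP Smax]] := @Zorn_bigcup _ approximation; first exact: chain_approximation.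
exists S; split=> //; apply: contrapT => /existsNP nS.
(* For the least missed column all earlier ones are met, so the step keeps the columns an initial
   segment. *)
have [a [na amin]] := le_min nS.
have [||S' [S'P SS' [n aS']]] := approximation_step (S := S) (a := a) SP.
- by move=> n aS; apply: na; exists n.
- move=> b ba ba'; apply: contrapT => nb; apply: ba; apply: le_anti => //.
  exact: amin.
apply: (Smax S') S'P; split=> // S'S.
by apply: na; exists n; exact: S'S.
Qed.

(** * From a total approximation to a structure *)

Section Realization.
Variables (S : signed_diagram) (SP : approximation S).
Hypothesis Sa : forall a, exists n, universe S (a, n).
Variable a0 : A.

Definition realization : structure L := @Structure L (universe S)
  (fun f => match f return (@far L f).-tuple (universe S) -> option (universe S) with
     | Lp => fun z => let x := tnth z ord0 in
         the [set y : universe S | positive S sP (val x) (val y) (val y)]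
     | Lf n => fun z => let x := tnth z ord0 in let y := tnth z ord_max in
         the [set w : universe S | positive S (sF n) (val x) (val y) (val w)]
     end)
  (fun P => match P return set ((@par L P).-tuple (universe S)) with
     | LU => [set z | positive S sU (val (tnth z ord0)) (val (tnth z ord0)) (val (tnth z ord0))]
     | LV => [set z | positive S sV (val (tnth z ord0)) (val (tnth z ord0)) (val (tnth z ord0))]
     | LR n => [set z | positive S (sR n) (val (tnth z ord0)) (val (tnth z ord_max))
                          (val (tnth z ord_max))]
     end).

Lemma universeP (x : realization) : universe S (val x).
Proof. exact: set_valP. Qed.

Lemma local_embedding (l : seq T) : elts l `<=` universe S ->
  exists2 r : seq (T * B), piso (universe S) (positive S) r & elts l `<=` dom r.
Proof.
elim: l => [|x l ih] lS; first by exists [::] => //; exact: piso_nil.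
have [|r rP lr] := ih; first by move=> y yl; apply: lS; right.
have [r' [r'P rr' xr']] := apx_forth SP rP (lS x (or_introl erefl)).
by exists r' => // y [<-//|/lr[b yb]]; exists b; exact: rr'.
Qed.

(** Four points are two arguments of a function and two candidates for its value. *)
Lemma local_embedding4 (x y z w : realization) : exists r : seq (T * B), exists x' y' z' w',
  [/\ piso (universe S) (positive S) r, List.In (val x, x') r, List.In (val y, y') r,
      List.In (val z, z') r & List.In (val w, w') r].
Proof.
have [|r rP lr] := local_embedding (l := [:: val x; val y; val z; val w]).
  by move=> t [<-|[<-|[<-|[<-|//]]]]; exact: universeP.
have [|x' xr] := lr (val x); first by left.
have [|y' yr] := lr (val y); first by right; left.
have [|z' zr] := lr (val z); first by do 2!right; left.
have [|w' wr] := lr (val w); first by do 3!right; left.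
by exists r, x', y', z', w'.
Qed.

(** A piso through the points involved imports from [B] what an approximation does not postulate:
    function values are unique, and the padding arguments do not matter. *)
Lemma diagram_realization s (x y z : realization) :
  diagram s x y z <-> positive S s (val x) (val y) (val z).
Proof.
have [r [x' [y' [z' [w' [rP xr yr zr _]]]]]] := local_embedding4 x y z z.
case: s => [||||n|n].
- by rewrite (piso_at rP sD xr yr zr).
- apply: iff_trans (iff_sym (piso_at rP sU xr yr zr)).
  exact: iff_trans (piso_at rP sU xr xr xr).
- apply: iff_trans (iff_sym (piso_at rP sV xr yr zr)).
  exact: iff_trans (piso_at rP sV xr xr xr).
- apply: iff_trans (iff_sym (piso_at rP sP xr yr zr)).
  apply: iff_trans (piso_at rP sP xr yr yr); apply: the_eq => u v hu hv.
  have [r1 [x1 [u1 [v1 [_ [r1P xr1 ur1 vr1 _]]]]]] := local_embedding4 x u v v.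
  apply: val_inj; apply/(piso_eq r1P ur1 vr1).
  move: ((piso_at r1P sP xr1 ur1 ur1).1 hu) ((piso_at r1P sP xr1 vr1 vr1).1 hv).
  by rewrite /diagram => -> [].
- apply: the_eq => u v hu hv.
  have [r1 [x1 [y1 [u1 [v1 [r1P xr1 yr1 ur1 vr1]]]]]] := local_embedding4 x y u v.
  apply: val_inj; apply/(piso_eq r1P ur1 vr1).
  move: ((piso_at r1P (sF n) xr1 yr1 ur1).1 hu) ((piso_at r1P (sF n) xr1 yr1 vr1).1 hv).
  by rewrite /diagram => -> [].
- apply: iff_trans (iff_sym (piso_at rP (sR n) xr yr zr)).
  exact: iff_trans (piso_at rP (sR n) xr yr yr).
Qed.

Lemma back_and_forth_realization : back_and_forth B setT (@diagram realization).
Proof.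
have [n0 n0S] := Sa a0.
pose x0 : realization := exist _ (a0, n0) (mem_set n0S).
pose g (x : T) : realization :=
  if pselect (universe S x) is left h then exist _ x (mem_set h) else x0.
have gK x : universe S x -> val (g x) = x by rewrite /g; case: pselect.
have toS (r : seq (realization * B)) : piso setT (@diagram realization) r ->
    piso (universe S) (positive S) (map_dom val r).
  apply: piso_map_dom => [x y _ _ /val_inj//|x _|s x y z _ _ _].
    exact: universeP.
  exact: diagram_realization.
have fromS (r : seq (T * B)) : piso (universe S) (positive S) r ->
    piso setT (@diagram realization) (map_dom g r).
  apply: piso_map_dom => [x y xS yS e|//|s x y z xS yS zS].
    by rewrite -(gK x xS) -(gK y yS) e.
  by apply: iff_trans (iff_sym (diagram_realization _ _ _ _)); rewrite !gK.
have gval (x : realization) : g (val x) = x by apply: val_inj; rewrite gK //; exact: universeP.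
have round (r : seq (realization * B)) (r' : seq (T * B)) :
    List.incl (map_dom val r) r' -> List.incl r (map_dom g r').
  move=> rr' [x b] xb; apply/In_map_dom; exists (val x); first by rewrite gval.
  by apply: rr'; apply/In_map_dom; exists x.
move=> r rP; split=> [x _|b].
  have [r' [r'P rr' [b xb]]] := apx_forth SP (toS r rP) (universeP x).
  exists (map_dom g r'); split; [exact: fromS|exact: round|].
  by exists b; apply/In_map_dom; exists (val x); rewrite ?gval.
have [r' [r'P rr' [x xb]]] := apx_back SP b (toS r rP) n0S.
exists (map_dom g r'); split; [exact: fromS|exact: round|].
by exists (g x); apply/In_map_dom; exists x.
Qed.

End Realization.

(** Every column contains a point of [V], and the universe lies in [A * nat], so [V] and [A] are
    equipotent. Any bijection serves as [iota], since points of [V] are indiscernible; it need not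
    respect the columns. *)
Lemma back_and_forth_enumerated : infinite_set [set: A] ->
  exists N : structure L, back_and_forth B setT (@diagram N) /\
  exists iota : A -> N, [/\ injective iota, forall a, V (iota a)
    & forall x, V x -> exists a, x = iota a].
Proof.
move=> Ainf; have [a0 _] := infinite_setN0 Ainf.
have [S [SP Sa]] := total_approximation.
exists (realization S); split; first exact: back_and_forth_realization a0.
have le_refl a : le a a.
  by have [|b [-> bmin]] := @le_min (fun b => b = a); [exists a|exact: bmin].
have /choice[c cP] : forall a, exists x : realization S, V x /\ (val x).1 = a.
  move=> a; have [n aS] := Sa a; have [n' h] := apx_initial SP aS (le_refl a).
  have [aS' _ _] := apx_universe SP h.
  by exists (exist _ (a, n') (mem_set aS')).
have [f fI] := infinite_prod_nat_inj Ainf.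
have AV : [set: A] #<= @V (realization S).
  apply/card_le_inj_fun; exists (fun a => exist _ (c (val a)) (mem_set (cP (val a)).1)).
  move=> a b [] e; apply: val_inj.
  by rewrite -(cP (val a)).2 -(cP (val b)).2 /= e.
have VA : @V (realization S) #<= [set: A].
  apply: (@card_le_of_inj _ _ _ (fun x => f (val x))) => x y _ _ /fI.
  exact: val_inj.
have := card_eq_le [set: A] (@V (realization S)); rewrite AV VA /=.
move=> /card_bijP[h [k hK kK]].
have sub (q : [set: A]) : exist _ (val q) (mem_set I) = q :> [set: A] by exact: val_inj.
exists (fun a => val (h (exist _ a (mem_set I)))); split.
- by move=> a b /val_inj/(can_inj hK)[].
- by move=> a; case: (h _) => x /= /set_mem.
- move=> x Vx; exists (val (k (exist _ x (mem_set Vx)))).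
  by rewrite sub kK.
Qed.

End Construction.

(** * Omitting p *)

(* Kuratowski's free set theorem for triples: fixing countably many third
   arguments [m k] turns [F] into a function with countable values and no free
   pair, which bounds the cardinality by aleph_1. *)
Lemma card_le_of_no_free_triple (T O : Type) (U : set T) (F : T -> T -> seq T) (j : O -> T) :
  ~ countable [set: O] -> injective j -> (forall o, U (j o)) ->
  (forall x y z, U x -> U y -> U z ->
    [\/ List.In z (F x y), List.In y (F x z) | List.In x (F y z)]) ->
  U #<= [set: O].
Proof.
move=> Ounc jI jU free.
have Oinf : infinite_set [set: O] by move=> /finite_set_countable.
have [m0 [m0I _]] := infinite_nat_inj Oinf.
pose m k := j (m0 k); have mI : injective m by move=> k l /jI /m0I.
(* The points [m k] are infinitely many, so a finite list omits one of them. *)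
have escape (l : seq T) : exists k, ~ List.In (m k) l.
  apply: contrapT => H; apply: infinite_nat.
  apply: (@sub_finite_set _ _ (m @^-1` elts l)).
    by move=> k _; apply: contrapT => kl; apply: H; exists k.
  by apply: finite_preimage (elts_finite l) => x y _ _ /mI.
(* Otherwise apply the hypothesis to [x], [j o] and an [m k] outside [F x (j o)]: the only case left
   is that [j o] lies in [F x (m k)], and the uncountably many [j o] would lie in a countable union
   of finite sets. *)
have cover x : U x -> exists o k i, nth (j o) (F (j o) (m k)) i = x.
  move=> Ux; suff [o [k xF]] : exists o k, List.In x (F (j o) (m k)).
    by have [i <-] := In_tnth xF; exists o, k, i; rewrite -(tnth_nth (j o) (in_tuple _)).
  apply: contrapT => nx; apply: Ounc.
  have jG o : (\bigcup_k elts (F x (m k))) (j o).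
    have [k mk] := escape (F x (j o)).
    case: (free x (j o) (m k) Ux (jU o) (jU _)) => // h; first by exists k.
    by case: nx; exists o, k.
  apply: (@sub_countable _ _ _ (\bigcup_k elts (F x (m k)))).
    apply/card_le_inj_fun; exists (fun o => exist _ (j (val o)) (mem_set (jG (val o)))).
    by move=> o o' [] /jI /val_inj.
  by apply: bigcup_countable => // k _; exact/finite_set_countable/elts_finite.
have [g gI] := infinite_prod_nat_inj Oinf.
have /choice[code codeP] : forall x, exists q : O * nat, U x ->
    exists k i, q.2 = pickle (k, i) /\ nth (j q.1) (F (j q.1) (m k)) i = x.
  move=> x; have [/cover[o [k [i e]]]|nU] := pselect (U x); last by exists (m0 0 , 0).
  by exists (o, pickle (k, i)) => _; exists k, i.
apply: (@card_le_of_inj _ _ _ (fun x => g (code x))) => x y Ux Uy /gI e.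
have [k [i [ek <-]]] := codeP x Ux; have [k' [i' [ek' <-]]] := codeP y Uy.
rewrite e in ek *; rewrite ek' in ek.
by have [-> ->] := pcan_inj (@pickleK _) ek.
Qed.

(** A first-order form of closedness: relation indices are at most [k], and the values of [f_l] for
    [l < k] are entries. In [B], (vi) makes the remaining functions first projections there, so the
    entries are closed under all of them. The map [v] selects the tuple from a longer list of
    variables. *)
Definition closed_tuple (M : structure L') K n k (t : K.-tuple M) (v : 'I_n -> 'I_K) :=
  forall q : 'I_n * 'I_n,
    (exists l : 'I_k.+1, @diagram (reduct M) (sR l) (tnth t (v q.1)) (tnth t (v q.2))
      (tnth t (v q.2))) /\
    (forall l : 'I_k, exists i : 'I_n,
      @diagram (reduct M) (sF l) (tnth t (v q.1)) (tnth t (v q.2)) (tnth t (v i))).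

Lemma definable_closed_tuple K n k (v : 'I_n -> 'I_K) :
  definable (fun (M : structure L') t => closed_tuple k t v).
Proof.
apply: definable_forall => q; apply: definable_and.
  by apply: definable_exists => l; exact: definable_diagram'.
by apply: definable_forall => l; apply: definable_exists => i; exact: definable_diagram'.
Qed.

Definition in_range (T : Type) K n (t : K.-tuple T) (v : 'I_n -> 'I_K) x :=
  exists i, tnth t (v i) = x.

Lemma the_some (T : Type) (P : set T) y : the P = Some y -> P y.
Proof. by rewrite /the; case: pselect => // h [<-]; case: cid. Qed.

Lemma the_ex (T : Type) (P : set T) : (exists x, P x) -> exists y, the P = Some y.
Proof. by move=> h; rewrite /the; case: pselect => // h'; exists (projT1 (cid h')). Qed.

Definition in_W (N : structure L') (x : N) := @pint L' N (inr tt) [tuple x].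
Definition graph_g (N : structure L') (x y w : N) := @fint L' N (inr Lg) [tuple x; y] = Some w.
(** The repeated argument makes [h] count the closure of a pair. *)
Definition graph_h (N : structure L') (x y w : N) := @fint L' N (inr Lh) [tuple x; y; y] = Some w.
Definition value_c (N : structure L') n (w : N) := forall z, @fint L' N (inr (Lc n)) z = Some w.
Definition in_U (N : structure L') (x : N) := @diagram (reduct N) sU x x x.

(** * Transfer to a model, and the bound on its [U] *)

Section Omitting.
Variables (B : structure L) (hB : generic B).
Variables (M : structure L') (MT : model (Th (Bprime B)) M).

Let KB : locally_K B := generic_locally_K hB.

Lemma transfer n (P : forall N : structure L', n.-tuple N -> Prop) : definable P ->
  (forall x : n.-tuple (Bprime B), P _ x) -> forall x : n.-tuple M, P M x.
Proof. by move=> /definable_closure[sigma h] PB; apply/h/MT/h. Qed.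

Lemma definable_W n (i : 'I_n) : definable (fun N e => in_W (tnth e i : N)).
Proof.
apply: definable_ext (@definable_pint L' n (inr tt) (fun=> i)) => N e.
by rewrite mktuple1E.
Qed.

Lemma definable_g n (i j k : 'I_n) : definable (fun N e => graph_g (tnth e i : N) (tnth e j) (tnth e k)).
Proof.
pose v2 (b : 'I_2) := if b == ord0 then i else j.
apply: definable_ext (@definable_fint L' n (inr Lg) v2 k) => N e.
by rewrite mktuple2E.
Qed.

Lemma definable_h n (i j k : 'I_n) : definable (fun N e => graph_h (tnth e i : N) (tnth e j) (tnth e k)).
Proof.
pose v3 (b : 'I_3) := if b == ord0 then i else j.
apply: definable_ext (@definable_fint L' n (inr Lh) v3 k) => N e.
rewrite (_ : mktuple _ = [tuple tnth e i; tnth e j; tnth e j]) //.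
apply: eq_from_tnth => -[[|[|[|//]]] b]; by rewrite tnth_mktuple [RHS](tnth_nth (tnth e i)).
Qed.

Lemma definable_U n (i : 'I_n) : definable (fun N e => in_U (tnth e i : N)).
Proof. exact: definable_diagram'. Qed.

Lemma definable_ex1 n (P : forall N : structure L', n.+1.-tuple N -> Prop) : definable P ->
  definable (fun N (e : n.-tuple N) => exists w, P N [tuple of w :: e]).
Proof.
move=> [phi h]; apply: definable_ext (definable_not (definable_sat (All (Neg phi)))) => N e /=.
split=> [/existsNP[w nw]|[w Pw] /(_ w)]; first by exists w; apply/h; apply: contrapT.
by apply; exact/h.
Qed.

Lemma g_total (x y : M) : in_U x -> in_U y -> exists w, graph_g x y w /\ in_W w.
Proof.
have := @transfer 2 (fun N e => in_U (tnth e ord0) -> in_U (tnth e ord_max) ->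
  exists w, graph_g (tnth [tuple of w :: e] (lift ord0 ord0)) (tnth [tuple of w :: e] (lift ord0 ord_max)) 
     (tnth [tuple of w :: e] ord0) /\ in_W (tnth [tuple of w :: e] ord0)).
move=> /(_ _ _ [tuple x; y]); apply.
  apply: definable_imp; first exact: definable_U.
  apply: definable_imp; first exact: definable_U.
  by apply: definable_ex1 (definable_and (definable_g _ _ _) (definable_W _)).
move=> e Ux Uy; move: (Ux) (Uy) => /U_Bprime[a ea] /U_Bprime[b eb].
rewrite ea in Ux; rewrite eb in Uy.
move: Ux Uy => /diagram_Bprime Ua /diagram_Bprime Ub.
have [n Rn] := lK_R_def KB Ua Ub.
exists (inr n); split; last by exists n.
rewrite /graph_g !tnthS !tnth0 ea eb /= .
have -> : the [set n | R n a b] = Some n by apply/the_eq => // k l; exact: lK_R_inj.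
by [].
Qed.

Lemma definable_c m n (i : 'I_n) : definable (fun N e => value_c m (tnth e i : N)).
Proof. exact: definable_nullary. Qed.

Lemma g_const n (x y w : M) : graph_g x y w -> value_c n w -> @diagram (reduct M) (sR n) x y y.
Proof.
have := @transfer 3 (fun N e => graph_g (tnth e i0) (tnth e i1) (tnth e i2) -> value_c n (tnth e i2) ->
  @diagram (reduct N) (sR n) (tnth e i0) (tnth e i1) (tnth e i1)).
move=> /(_ _ _ [tuple x; y; w]); apply.
  apply: definable_imp; first exact: definable_g.
  apply: definable_imp; first exact: definable_c.
  exact: definable_diagram'.
move=> e; move: (tnth e i0) (tnth e i1) (tnth e i2) => a b c.
rewrite /graph_g /= => e1 /(_ [tuple]) /= [e2]; move: e1; rewrite -e2.
rewrite !(tnth_nth a) /=; case: a => [a|//]; case: b => [b|//] /=.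
case e3: (the _) => [m|//] [<-]; apply/(diagram_Bprime (sR m) a b b).
exact: (the_some e3).
Qed.

Lemma h_total (x y : M) : in_U x -> in_U y -> exists w, graph_h x y w /\ in_W w.
Proof.
have := @transfer 2 (fun N e => in_U (tnth e ord0) -> in_U (tnth e ord_max) ->
  exists w, graph_h (tnth [tuple of w :: e] (lift ord0 ord0)) (tnth [tuple of w :: e] (lift ord0 ord_max))
     (tnth [tuple of w :: e] ord0) /\ in_W (tnth [tuple of w :: e] ord0)).
move=> /(_ _ _ [tuple x; y]); apply.
  apply: definable_imp; first exact: definable_U.
  apply: definable_imp; first exact: definable_U.
  by apply: definable_ex1 (definable_and (definable_h _ _ _) (definable_W _)).
move=> e Ux Uy; move: (Ux) (Uy) => /U_Bprime[a ea] /U_Bprime[b eb].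
have [n en] : exists n, the [set n | cl [set a; b; b] #= `I_n] = Some n.
  have [l [cl_l abl]] := lK_finite KB [:: a; b].
  have /finite_setP[n hn] : finite_set (cl [set a; b; b]).
    apply: sub_finite_set (elts_finite l); apply: cl_closed cl_l _ => z [[->|->]|->].
    - by apply: abl; left.
    - by apply: abl; right; left.
    - by apply: abl; right; left.
  by apply: the_ex; exists n.
exists (inr n); split; last by exists n.
by rewrite /graph_h !tnthS !tnth0 ea eb /= en.
Qed.

(** For fixed natural numbers [k] and [n] the claim is first-order. In [B] the elements of the
    closure form the tuple: the value of [h] says that there are [n] of them, and (vii) bounds their
    relation indices by [k]. *)
Lemma closure_exists k n (x y w : M) : @diagram (reduct M) (sR k) x y y ->
  graph_h x y w -> value_c n w ->
  exists z : n.-tuple M, [/\ closed_tuple k z id, in_range z id x & in_range z id y].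
Proof.
have := @transfer 3 (fun N e => @diagram (reduct N) (sR k) (tnth e i0) (tnth e i1) (tnth e i1) ->
  graph_h (tnth e i0) (tnth e i1) (tnth e i2) -> value_c n (tnth e i2) ->
  exists z : n.-tuple N, [/\ closed_tuple k (cat_tuple z e) (lshift 3),
    exists i, tnth (cat_tuple z e) (lshift 3 i) = tnth (cat_tuple z e) (rshift n i0)
  & exists i, tnth (cat_tuple z e) (lshift 3 i) = tnth (cat_tuple z e) (rshift n i1)]).
have unshift (N : structure L') (z : n.-tuple N) (e : 3.-tuple N) :
    closed_tuple k (cat_tuple z e) (lshift 3) <-> closed_tuple k z id.
  split=> H q; have [[l h] h'] := H q; move: h; rewrite !tnth_lshift => h; split;
    do ?[by exists l; rewrite ?tnth_lshift]; move=> l'; have [i hi] := h' l'; exists i;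
    by move: hi; rewrite !tnth_lshift.
move=> /(_ _ _ [tuple x; y; w]) H Rxy hxy cw.
have [||//|//|//|z [/unshift cz [i xi] [j yj]]] := H.
- apply: definable_imp; first exact: definable_diagram'.
  apply: definable_imp; first exact: definable_h.
  apply: definable_imp; first exact: definable_c.
  have dP : definable (fun (N : structure L') (t : (n + 3).-tuple N) =>
      [/\ closed_tuple k t (lshift 3), exists i, tnth t (lshift 3 i) = tnth t (rshift n i0)
      & exists i, tnth t (lshift 3 i) = tnth t (rshift n i1)]).
    apply: definable_ext (definable_and (definable_closed_tuple k (lshift 3))
      (definable_and (definable_exists (fun i => definable_eq L' (lshift 3 i) (rshift n i0)))
      (definable_exists (fun i => definable_eq L' (lshift 3 i) (rshift n i1))))) => N t.
    by split=> [[? []]|[]].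
  exact: definable_ex dP.
- move=> e Re he /(_ [tuple]) /= [e2]; rewrite -e2 in he.
  have [Ux Uy] : @U (reduct (Bprime B)) (tnth e i0) /\ @U (reduct (Bprime B)) (tnth e i1).
    case: Re => v Rv ev; rewrite (tuple2E v) in Rv.
    have -> : tnth e i0 = inl (tnth v ord0).
      by have := congr1 (fun t => tnth t ord0) ev; rewrite tnth_map => <-.
    have -> : tnth e i1 = inl (tnth v ord_max).
      by have := congr1 (fun t => tnth t ord_max) ev; rewrite tnth_map => <-.
    by have [Ua Ub] := lK_RU KB Rv; split;
      [apply/(diagram_Bprime sU _ (tnth v ord0) (tnth v ord0))
      |apply/(diagram_Bprime sU _ (tnth v ord_max) (tnth v ord_max))].
  have [[a ea] [b eb]] := (U_Bprime Ux, U_Bprime Uy).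
  rewrite ea eb in Re he.
  have {he} : omap inr (the [set n | cl [set a; b; b] #= `I_n]) = Some (inr n) :> option (B + nat).
    exact: he.
  case en: (the _) => [m|//] [mn]; rewrite mn in en => {m mn}.
  have Rab : R k a b by exact/(diagram_Bprime (sR k) a b b).
  have := the_some en; rewrite /= card_eq_sym => /card_bijP[h [h' hK h'K]].
  have abb : [set a; b; b] = [set a; b] by rewrite -setUA setUid.
  pose z := [tuple inl (val (h (exist _ (i : nat) (mem_set (ltn_ord i))))) : Bprime B | i < n].
  have zE c : cl [set a; b; b] c -> exists i, tnth z i = inl c.
    move=> cc; pose q := h' (exist _ c (mem_set cc)).
    have qn : val q < n by case: (q) => q' /= /set_mem.
    exists (Ordinal qn); rewrite tnth_mktuple /=.
    have -> : exist _ (val q) (mem_set (ltn_ord (Ordinal qn))) = q :> `I_n by exact: val_inj.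
    by rewrite h'K.
  have zcl i : exists2 c, cl [set a; b] c & tnth z i = inl c.
    rewrite tnth_mktuple; case: (h _) => c /= cc; exists c => //.
    by rewrite -abb; exact: set_mem cc.
  exists z; split; last 2 first.
  + have [|i zi] := zE a; first by apply: cl_base; left; left.
    by exists i; rewrite tnth_lshift tnth_rshift zi ea.
  + have [|i zi] := zE b; first by apply: cl_base; right.
    by exists i; rewrite tnth_lshift tnth_rshift zi eb.
  + apply/unshift => -[i j] /=; have [[c cc ci] [d dd dj]] := (zcl i, zcl j); split.
      have [l lk Rl] := lK_R_cl KB cc dd Rab.
      exists (Ordinal (lk : l < k.+1)); rewrite ci dj.
      by apply/(diagram_Bprime (sR l) c d d).
    move=> l; have [s _ Rs] := lK_R_cl KB cc dd Rab; have [Uc Ud] := lK_RU KB Rs.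
    have [t et] := lK_f_def KB l Uc Ud.
    have [|m zm] := zE t; first by rewrite abb; exact: cl_step cc dd et.
    by exists m; rewrite ci dj zm; apply/(diagram_Bprime (sF l) c d t).
- exists z; split=> //; [exists i|exists j].
    by move: xi; rewrite tnth_lshift tnth_rshift.
  by move: yj; rewrite tnth_lshift tnth_rshift.
Qed.

Lemma p_onto_model (y : M) : @diagram (reduct M) sV y y y ->
  exists x, @diagram (reduct M) sP x y y.
Proof.
have := @transfer 1 (fun N e => @diagram (reduct N) sV (tnth e ord0) (tnth e ord0) (tnth e ord0) ->
  exists x, @diagram (reduct N) sP (tnth [tuple of x :: e] ord0)
    (tnth [tuple of x :: e] (lift ord0 ord0)) (tnth [tuple of x :: e] (lift ord0 ord0))).
move=> /(_ _ _ [tuple y]); apply.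
  apply: definable_imp; first exact: definable_diagram'.
  exact: definable_ex1 (definable_diagram' sP ord0 (lift ord0 ord0) (lift ord0 ord0)).
move=> e Vy; have [b eb] := V_Bprime Vy; rewrite eb in Vy.
have [u pu] := p_onto hB ((diagram_Bprime sV b b b).1 Vy).
by exists (inl u); rewrite tnthS tnth0 eb; apply/(diagram_Bprime sP u b b).
Qed.

(** With all lengths and bounds fixed, this is a single first-order property of the concatenated
    tuples, hence only has to be checked in [B]. There a closed tuple containing two points contains
    their closure, and (viii) applies. *)
Lemma no_free_triple n1 n2 n3 k1 k2 k3 (x y z : M)
    (u : n1.-tuple M) (v : n2.-tuple M) (w : n3.-tuple M) :
  in_U x -> in_U y -> in_U z ->
  closed_tuple k1 u id -> in_range u id x -> in_range u id y ->
  closed_tuple k2 v id -> in_range v id x -> in_range v id z ->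
  closed_tuple k3 w id -> in_range w id y -> in_range w id z ->
  [\/ in_range u id z, in_range v id y | in_range w id x].
Proof.
pose K := 3 + (n1 + (n2 + n3)).
pose ix (i : 'I_3) : 'I_K := lshift _ i.
pose iu (i : 'I_n1) : 'I_K := rshift 3 (lshift _ i).
pose iv (i : 'I_n2) : 'I_K := rshift 3 (rshift n1 (lshift _ i)).
pose iw (i : 'I_n3) : 'I_K := rshift 3 (rshift n1 (rshift n2 i)).
pose P (N : structure L') (t : K.-tuple N) : Prop :=
  (in_U (tnth t (ix i0)) /\ in_U (tnth t (ix i1)) /\ in_U (tnth t (ix i2))) ->
  (closed_tuple k1 t iu /\ in_range t iu (tnth t (ix i0)) /\ in_range t iu (tnth t (ix i1))) ->
  (closed_tuple k2 t iv /\ in_range t iv (tnth t (ix i0)) /\ in_range t iv (tnth t (ix i2))) ->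
  (closed_tuple k3 t iw /\ in_range t iw (tnth t (ix i1)) /\ in_range t iw (tnth t (ix i2))) ->
  in_range t iu (tnth t (ix i2)) \/ in_range t iv (tnth t (ix i1)) \/ in_range t iw (tnth t (ix i0)).
have dP : definable P.
  have dr n (s : 'I_n -> 'I_K) i : definable (fun (N : structure L')
      (t : K.-tuple N) => in_range t s (tnth t i)).
    by apply: definable_exists => j; exact: definable_eq.
  have dc n k (s : 'I_n -> 'I_K) := definable_closed_tuple k s.
  have dU i : definable (fun (N : structure L') (t : K.-tuple N) => in_U (tnth t i)) := definable_U i.
  apply: definable_imp (definable_and (dU _) (definable_and (dU _) (dU _))) _.
  apply: definable_imp (definable_and (dc _ _ _) (definable_and (dr _ _ _) (dr _ _ _))) _.
  apply: definable_imp (definable_and (dc _ _ _) (definable_and (dr _ _ _) (dr _ _ _))) _.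
  apply: definable_imp (definable_and (dc _ _ _) (definable_and (dr _ _ _) (dr _ _ _))) _.
  exact: definable_or (dr _ _ _) (definable_or (dr _ _ _) (dr _ _ _)).
pose t : K.-tuple M := cat_tuple [tuple x; y; z] (cat_tuple u (cat_tuple v w)).
have tu i : tnth t (iu i) = tnth u i by rewrite tnth_rshift tnth_lshift.
have tv i : tnth t (iv i) = tnth v i by rewrite !tnth_rshift tnth_lshift.
have tw i : tnth t (iw i) = tnth w i by rewrite !tnth_rshift.
have tx i : tnth t (ix i) = tnth [tuple x; y; z] i by rewrite tnth_lshift.
have rangeE n (s : 'I_n -> 'I_K) (r : n.-tuple M) a : (forall i, tnth t (s i) = tnth r i) ->
    in_range t s a <-> in_range r id a.
  by move=> e; split=> -[i <-]; exists i; rewrite e.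
have closedE n k (s : 'I_n -> 'I_K) (r : n.-tuple M) : (forall i, tnth t (s i) = tnth r i) ->
    closed_tuple k r id -> closed_tuple k t s.
  move=> e c q; have [[l h] h'] := c q; split; first by exists l; rewrite !e.
  by move=> l'; have [i hi] := h' l'; exists i; rewrite !e.
move=> Ux Uy Uz cu ux uy cv vx vz cw wy wz.
have := transfer dP _ t; rewrite /P !tx => H.
have {}H : in_range t iu z \/ in_range t iv y \/ in_range t iw x.
  apply: H => //.
  - move=> s [Us0 [Us1 Us2]] [cu' [[a0 ea0] [a1 ea1]]] [cv' [[b0 eb0] [b2 eb2]]] [cw' [[c1 ec1] [c2 ec2]]].
    have [[p0 ep0] [p1 ep1] [p2 ep2]] := And3 (U_Bprime Us0) (U_Bprime Us1) (U_Bprime Us2).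
    have UB (q : B) w' : w' = inl q -> @in_U (Bprime B) w' -> U q.
      by move=> -> /(diagram_Bprime sU q q q).
    (* Below [k] the value of [f_m] is an entry by definition. From [k] on, the relation index is at
       most [m], so the value is the first argument. *)
    have cl_range n k (r : 'I_n -> 'I_K) : closed_tuple k s r -> forall (Z : set B) q,
        (forall q', Z q' -> in_range s r (inl q')) -> cl Z q -> in_range s r (inl q).
      move=> c Z q Zr; elim=> {q} [q /Zr//|m b d q _ [i ei] _ [j ej] e].
      have [[l]] := c (i, j); rewrite -[(i, j).1]/i -[(i, j).2]/j ei ej.
      move=> /(diagram_Bprime (sR l) b d d) Rl h.
      have [mk|km] := ltnP m k.
        have [i' e'] := h (Ordinal mk).
        have [Ub Ud _] := lK_f_range KB e.
        exists i'; move: e'; rewrite /diagram /f_ /= e => -[<-].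
        by [].
      have lm : l <= m by apply: leq_trans km; rewrite -ltnS.
      have := lK_R_f KB lm Rl; rewrite e => -[->]; by exists i.
    have := lK_dep KB (UB _ _ ep0 Us0) (UB _ _ ep1 Us1) (UB _ _ ep2 Us2).
    case=> h.
    + right; right; rewrite ep0; apply: cl_range cw' _ _ _ h => q [->|->].
        by exists c1; rewrite ec1.
      by exists c2; rewrite ec2.
    + right; left; rewrite ep1; apply: cl_range cv' _ _ _ h => q [->|->].
        by exists b0; rewrite eb0.
      by exists b2; rewrite eb2.
    + left; rewrite ep2; apply: cl_range cu' _ _ _ h => q [->|->].
        by exists a0; rewrite ea0.
      by exists a1; rewrite ea1.
  - split; [exact: closedE tu cu|by split; apply/(rangeE _ _ _ _ tu)].
  - split; [exact: closedE tv cv|by split; apply/(rangeE _ _ _ _ tv)].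
  - split; [exact: closedE tw cw|by split; apply/(rangeE _ _ _ _ tw)].
case: H => [/(rangeE _ _ _ _ tu)|[/(rangeE _ _ _ _ tv)|/(rangeE _ _ _ _ tw)]] h.
- exact: Or31.
- exact: Or32.
- exact: Or33.
Qed.

Lemma In_range (T : Type) n (z : n.-tuple T) x :
  in_range z id x <-> List.In x [seq tnth z i | i <- enum 'I_n].
Proof.
rewrite List.in_map_iff; split=> [[i <-]|[i [<- _]]]; last by exists i.
by exists i; split=> //; exact: In_enum.
Qed.

Lemma card_U_omitting (O : Type) (j : O -> M) :
  (forall x : M, in_W x -> exists n, value_c n x) ->
  ~ countable [set: O] -> injective j -> (forall o, in_U (j o)) ->
  [set x : M | in_U x] #<= [set: O].
Proof.
move=> omit Ounc jI jU.
(* The set mapping lists some closed tuple through both points. Omission of the type enters here: it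
   makes the values of [g] and [h] standard. *)
have /choice[F FP] : forall q : M * M, exists l : seq M, in_U q.1 -> in_U q.2 ->
    exists n k (u : n.-tuple M), [/\ l = [seq tnth u i | i <- enum 'I_n],
      closed_tuple k u id, in_range u id q.1 & in_range u id q.2].
  move=> [x y] /=; have [[Ux Uy]|nU] := pselect (in_U x /\ in_U y); last by exists [::] => Ux Uy; case: nU.
  have [w [gw /omit[k ck]]] := g_total Ux Uy.
  have [w' [hw /omit[n cn]]] := h_total Ux Uy.
  have [u [cu ux uy]] := closure_exists (g_const gw ck) hw cn.
  by exists [seq tnth u i | i <- enum 'I_n] => _ _; exists n, k, u.
apply: (card_le_of_no_free_triple (F := fun x y => F (x, y)) Ounc jI jU).
move=> x y z Ux Uy Uz.
have [n1 [k1 [u [-> cu ux uy]]]] := FP (x, y) Ux Uy.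
have [n2 [k2 [v [-> cv vx vz]]]] := FP (x, z) Ux Uz.
have [n3 [k3 [w [-> cw wy wz]]]] := FP (y, z) Uy Uz.
have [h|h|h] := no_free_triple Ux Uy Uz cu ux uy cv vx vz cw wy wz;
  [apply: Or31|apply: Or32|apply: Or33]; exact/In_range.
Qed.

End Omitting.

(** * The two cardinality statements *)

Section Final.
Variables (B : structure L) (hB : generic B).
Variables (aleph1 : Type) (haleph1 : is_aleph1 aleph1).
Variables (C' : structure L') (hC' : model (Th (Bprime B)) C').
Variables (A : set C') (hA : A `<=` @V (reduct C')).
Notation LA := (lang_sum L' (const_lang A)).
Notation TA := (Th (expand_const A)).

Lemma atomic_model_exists : A #<= [set: aleph1] -> exists M : structure LA, atomic_model TA M.
Proof.
case: haleph1 => le [wo _ le_countable] /card_le_inj_fun[i0 iI0].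
pose i (a : A) : aleph1 := val (i0 a).
have iI : injective i by move=> a b /val_inj /iI0.
have [/finite_elts[s As]|Ainf] := pselect (finite_set [set: A]).
  have [v0 _ _] := fresh_V hB [::].
  have [c [_ [cV cI]]] : exists c : A -> B, (forall a, List.In a [::] -> c a = v0) /\
      good c ([::] ++ s) by apply: (extend_good hB (c := fun=> v0)).
  have sT a : List.In a s by rewrite -/(elts s a) -As.
  (* For finite [A] the structure [B] itself serves, with any distinct points of [V] as
     constants. *)
  eexists; apply: (atomic_with_const hB hC' hA (back_and_forth_generic hB) (iota := c)).
  - by move=> a b; exact: cI.
  - by move=> a; exact: cV.
  - by left; rewrite As; exact: elts_finite.
(* The well-order of type omega_1 is pulled back along the injection [i], so initial segments of [A]
   stay countable. *)
pose leA (a b : A) : Prop := le (i a) (i b).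
have [|||N [bf [iota [iotaI iotaV onto]]]] := @back_and_forth_enumerated B hB A leA _ _ _ Ainf.
- move=> P [a Pa].
  have [|m [[/asboolP[b Pb <-] mmin] _]] := wo (fun o => `[< exists2 a, P a & i a = o >]).
    by exists (i a); apply/asboolP; exists a.
  by exists b; split=> // c Pc; apply: mmin; apply/asboolP; exists c.
- move=> a b ab ba; apply: iI.
  have le_refl o : le o o.
    have [|m [[/asboolP-> mmin] _]] := wo (fun o' => `[< o' = o >]).
      by exists o; apply/asboolP.
    by apply: mmin; apply/asboolP.
  have [|m [_ mI]] := wo (fun o => `[< o = i a \/ o = i b >]).
    by exists (i a); apply/asboolP; left.
  rewrite -(mI (i a)); first apply: mI; split.
  - by apply/asboolP; right.
  - by move=> o /asboolP[->|->].
  - by apply/asboolP; left.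
  - by move=> o /asboolP[->|->].
- move=> a; have /countable_injP[f fI] := le_countable (i a).
  apply/countable_injP; exists (f \o i) => b c /set_mem[ba nba] /set_mem[ca nca] /= e.
  apply: (iI); apply: fI e; apply: mem_set; split=> // /iI; [exact: nba|exact: nca].
eexists; apply: (atomic_with_const hB hC' hA bf iotaI iotaV); right; exact: onto.
Qed.

Lemma p_type_realized (M : structure LA) : ([set: aleph1] #<= A) -> ~ (A #<= [set: aleph1]) ->
  model TA M -> exists e : 1.-tuple (reduct M), realizes p_type e.
Proof.
move=> /card_le_inj_fun[f fI] nA MT; apply: contrapT => nreal; apply: nA.
have [MB [c [Mc cI cV]]] := model_TA hC' hA MT.
have omit (x : reduct M) : in_W x -> exists n, value_c n x.
  move=> Wx; apply: contrapT => nc; apply: nreal; exists [tuple x] => phi [->|[n ->]] /=.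
    by exists [tuple x]; split=> // j; rewrite (ord1 j).
  move=> [y [<- [z [_ e]]]]; apply: nc; exists n => z'.
  have -> : z' = z by rewrite (tuple0 z') (tuple0 z).
  exact: e.
(* The bound concerns [U], whereas [A] lies in [V]. Preimages under [p] move [A] into [U],
   injectively because [p] is single-valued. *)
have /choice[u uP] : forall a, exists x : reduct M, @diagram (reduct (reduct M)) sP x (c a) (c a).
  by move=> a; apply: (p_onto_model hB MB); exact: cV.
have uI : injective u.
  move=> a b e; apply: cI; move: (uP a) (uP b).
  by rewrite e /diagram => -> [].
have uU a : in_U (u a).
  have := @transfer B (reduct M) MB 2 (fun N e =>
    @diagram (reduct N) sP (tnth e ord0) (tnth e ord_max) (tnth e ord_max) -> in_U (tnth e ord0)).
  move=> /(_ _ _ [tuple u a; c a]); apply; last exact: uP.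
    by apply: definable_imp; [exact: definable_diagram'|exact: definable_U].
  move=> e; rewrite /diagram; move: (tnth e ord0) (tnth e ord_max) => x y.
  case: x => [x|//]; case: y => [y|//]; last first.
    by rewrite /p_ /=; case: (p_ x).
  move=> /(diagram_Bprime sP x y y) /(lK_p_range (generic_locally_K hB))[Ux _].
  exact/(diagram_Bprime sU x x x).
have [le [_ Ounc _]] := haleph1.
have AU : A #<= [set x : reduct M | in_U x].
  apply/card_le_inj_fun; exists (fun a => exist _ (u a) (mem_set (uU a))).
  by move=> a b [] /uI.
apply: card_le_trans AU _.
(* The uncountable family required in [U] comes from aleph_1 points of [A], moved by [u]. *)
apply: (card_U_omitting hB MB (j := fun o => u (f (exist _ o (mem_set I))))) => //.
by move=> o o' /uI/fI[].
Qed.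

End Final.

Theorem theorem5 (B : structure L) (hB : generic B)
    (aleph1 : Type) (haleph1 : is_aleph1 aleph1)
    (C' : structure L') (hC' : model (Th (Bprime B)) C')
    (A : set C') (hA : A `<=` @V (reduct C')) :
  let T'A := Th (expand_const A) in
  [/\ indiscernible_set A,
      principal_types_dense T'A,
      A #<= [set: aleph1] ->
        exists M : structure (lang_sum L' (const_lang A)), atomic_model T'A M
    & ([set: aleph1] #<= A) /\ ~ (A #<= [set: aleph1]) ->
        forall M : structure (lang_sum L' (const_lang A)), model T'A M ->
          exists e : 1.-tuple (reduct M), realizes p_type e].
Proof.
split.
- exact: (indiscernible_V hB hC' hA).
- exact: (principal_types_dense_V hB hC' hA).
- exact: (atomic_model_exists hB haleph1 hC' hA).
- by move=> [leA nA] M MT; exact: (p_type_realized hB haleph1 hC' hA leA nA MT).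
Qed.
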